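(* Let $\phi:\mathbb{D}\to\mathbb{D}$ be analytic, and let $C_\phi$ be the composition operator defined by $(C_\phi f)(z)=f(\phi(z))$. Let $p$ be a harmonic log-Hölder continuous exponent with bounded conjugate such that $0<p_-\le p_+<\infty$. Then $C_\phi$ is bounded from $A^{p(\cdot)}_\alpha$ to $A^{p(\phi(\cdot))}_\alpha$ for $-1\le\alpha<\infty$.
   Context: $\mathbb{D}$ is the open unit disc; $p_-=\operatorname{ess\,inf}p$, $p_+=\operatorname{ess\,sup}p$. An exponent $p$ on $\overline{\mathbb{D}}$ is log-Hölder continuous if there is a constant $C_0$ with $|p(z)-p(w)|\le C_0/\log\frac1{|z-w|}$ for all $z,w\in\overline{\mathbb{D}}$ with $|z-w|<1$; it is log-Hölder continuous with bounded conjugate if in addition the harmonic function in $\mathbb{D}$ with the same boundary values as $p$ has bounded harmonic conjugate. ''Harmonic exponent'' means $p$ is harmonic in $\mathbb{D}$. $p(\phi(\cdot))$ is the exponent $z\mapsto p(\phi(z))$ on $\mathbb{D}$. Let $dA$ be normalized area measure on $\mathbb{D}$, and for $-1<\alpha<\infty$ let $dA_\alpha(z)=(\alpha+1)(1-|z|^2)^\alpha dA(z)$. For an exponent $s$ on $\mathbb{D}$ and $\alpha>-1$, $A^{s(\cdot)}_\alpha$ is the space of analytic $f$ on $\mathbb{D}$ with $\int_{\mathbb{D}}|f|^{s(z)}dA_\alpha<\infty$, with (quasi-)norm $\inf\{\lambda>0:\int_{\mathbb{D}}|f(z)/\lambda|^{s(z)}dA_\alpha(z)<1\}$. For $\alpha=-1$,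 $A^{s(\cdot)}_{-1}=H^{s(\cdot)}$ is the space of analytic $f$ with $\sup_{0\le r<1}M_{s(\cdot)}(r,f)<\infty$, this supremum being its (quasi-)norm, where $M_{s(\cdot)}(r,f)=\inf\{\lambda>0:\frac1{2\pi}\int_0^{2\pi}|f(re^{i\theta})/\lambda|^{s(re^{i\theta})}d\theta<1\}$. ''Bounded'' means there is a constant $C$ with $\|C_\phi f\|\le C\|f\|$ for all $f$ in the domain space. *)

(* Defs.v *)
From HB Require Import structures.
From mathcomp Require Import all_boot all_order all_algebra.
From mathcomp Require Import all_classical all_reals all_analysis measurable_realfun
  ess_sup_inf.
From mathcomp Require Export complex.

Set Implicit Arguments.
Unset Strict Implicit.
Unset Printing Implicit Defensive.

Import Order.TTheory GRing.Theory Num.Theory.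
Import numFieldNormedType.Exports.
Import ComplexField.Normc.

Local Open Scope classical_set_scope.
Local Open Scope ring_scope.
Local Open Scope complex_scope.

(* Functions on the disc are total functions on R[i]; only their values on the
   disc (for exponents, on the closed disc) are ever used.  R[i]^o is R[i]
   with its topology and its structure of normed space over R[i], so that
   [derivable] on it is complex differentiability.  [normc] is the modulus as
   an element of R, while `|z| lives in R[i]. *)

Section Disc.
Variable R : realType.
Implicit Types (f phi : R[i] -> R[i]) (u v p s : R[i] -> R) (z w : R[i]).

Definition disc : set R[i]^o := [set z | normc z < 1].

Definition closed_disc : set R[i]^o := [set z | normc z <= 1].

Definition analytic_on_disc f : Prop :=
  forall z, disc z -> derivable (f : R[i]^o -> R[i]^o) z 1.

Definition derivable_x u z : Prop :=
  derivable (fun t : R => u (t +i* complex.Im z)) (complex.Re z) 1.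

Definition derivable_y u z : Prop :=
  derivable (fun t : R => u (complex.Re z +i* t)) (complex.Im z) 1.

Definition partial_x u z : R :=
  derive1 (fun t : R => u (t +i* complex.Im z)) (complex.Re z).

Definition partial_y u z : R :=
  derive1 (fun t : R => u (complex.Re z +i* t)) (complex.Im z).

Definition continuous_on_disc u : Prop :=
  forall z, disc z -> {for z, continuous (u : R[i]^o -> R)}.

Definition C2_on_disc u : Prop :=
  (forall z, disc z ->
     [/\ derivable_x u z /\ derivable_y u z,
         derivable_x (partial_x u) z /\ derivable_y (partial_x u) z &
         derivable_x (partial_y u) z /\ derivable_y (partial_y u) z]) /\
  [/\ continuous_on_disc (partial_x (partial_x u)),
      continuous_on_disc (partial_y (partial_x u)),
      continuous_on_disc (partial_x (partial_y u)) &
      continuous_on_disc (partial_y (partial_y u))].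

Definition harmonic_on_disc u : Prop :=
  C2_on_disc u /\
  forall z, disc z -> partial_x (partial_x u) z + partial_y (partial_y u) z = 0.

Definition harmonic_conjugate u v : Prop :=
  analytic_on_disc (fun z => u z +i* v z).

(* At z = w the right-hand side is 0, since x / 0 = 0 and ln 0 = 0. *)
Definition log_holder p : Prop :=
  exists C0 : R, forall z w, closed_disc z -> closed_disc w ->
    normc (z - w) < 1 -> `|p z - p w| <= C0 / ln (1 / normc (z - w)).

Definition log_holder_bounded_conjugate p : Prop :=
  log_holder p /\
  exists u v,
    [/\ harmonic_on_disc u,
        {within closed_disc, continuous (u : R[i]^o -> R)},
        forall z, normc z = 1 -> u z = p z,
        harmonic_conjugate u v &
        exists M : R, forall z, disc z -> `|v z| <= M].

(* Area measure lives on R * R; a point (x, y) stands for x + i y. *)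
Definition toC (x : measurableTypeR R * measurableTypeR R) : R[i] :=
  x.1 +i* x.2.

Lemma toC_disc_measurable : measurable (toC @^-1` disc).
Proof.
have sqrt_lt1 (a : R) : (Num.sqrt a < 1) = (a < 1).
  by rewrite -[X in _ < X = _](@sqrtr1 R) ltr_sqrt.
have -> : toC @^-1` disc =
    [set x : measurableTypeR R * measurableTypeR R |
      Num.sqrt (x.1 ^+ 2 + x.2 ^+ 2) < (1 : R)].
  by [].
have m1 : measurable_fun [set: measurableTypeR R * measurableTypeR R]
    (fun x => x.1 ^+ 2 + x.2 ^+ 2 : R).
  by apply: measurable_funD; apply: measurable_funX;
    [exact: measurable_fst|exact: measurable_snd].
have -> : [set x : measurableTypeR R * measurableTypeR R |
      Num.sqrt (x.1 ^+ 2 + x.2 ^+ 2) < (1 : R)] =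
    setT `&` (fun x => x.1 ^+ 2 + x.2 ^+ 2 : R) @^-1` `]-oo, (1 : R)[.
  rewrite setTI; apply/seteqP.
  by split=> x /=; rewrite in_itv /= sqrt_lt1.
by apply: m1 => //; exact: measurable_itv.
Qed.

Lemma pi_inv_ge0 : 0 <= (pi : R)^-1.
Proof. by rewrite invr_ge0 pi_ge0. Qed.

Definition dA : {measure set (measurableTypeR R * measurableTypeR R) -> \bar R} :=
  mscale (NngNum pi_inv_ge0)
    (mrestr (lebesgue_measure \x lebesgue_measure)%E toC_disc_measurable).

(* The integral of g over the disc against dA_alpha, for alpha > -1. *)
Definition integral_dA (alpha : R) (g : R[i] -> R) : \bar R :=
  (\int[dA]_(x in toC @^-1` disc)
     ((alpha + 1) * (1 - normc (toC x) ^+ 2) `^ alpha * g (toC x))%:E)%E.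

Definition exponent_inf p : \bar R := ess_inf dA (EFin \o p \o toC).

Definition exponent_sup p : \bar R := ess_sup dA (EFin \o p \o toC).

(* Infima are taken in \bar R, so that the infimum of the empty set is +oo. *)
Definition luxemburg (rho : R -> \bar R) : \bar R :=
  ereal_inf [set lambda%:E | lambda in [set l : R | 0 < l /\ (rho l < 1)%E]].

Definition bergman_norm (alpha : R) s f : \bar R :=
  luxemburg (fun lambda =>
    integral_dA alpha (fun z => normc (f z / lambda%:C) `^ s z)).

Definition circle_pt (r theta : R) : R[i] :=
  (r * cos theta) +i* (r * sin theta).

Definition circle_mean s (r : R) f : \bar R :=
  luxemburg (fun lambda =>
    ((2 * pi)^-1)%:E *
    \int[lebesgue_measure]_(theta in `[0%R, (2 * pi)%R])
      (normc (f (circle_pt r theta) / lambda%:C)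
         `^ s (circle_pt r theta))%:E)%E.

Definition hardy_norm s f : \bar R :=
  ereal_sup [set circle_mean s r f | r in [set r : R | 0 <= r < 1]].

Definition A_norm (alpha : R) s f : \bar R :=
  if alpha == -1 then hardy_norm s f else bergman_norm alpha s f.

Definition A_space (alpha : R) s : set (R[i] -> R[i]) :=
  [set f | analytic_on_disc f /\
    if alpha == -1 then (hardy_norm s f < +oo)%E
    else (integral_dA alpha (fun z => (normc (f z) `^ s z)%R) < +oo)%E].

Definition composition_operator phi f : R[i] -> R[i] := fun z => f (phi z).

Definition bounded_operator (alpha : R) s s'
    (T : (R[i] -> R[i]) -> R[i] -> R[i]) : Prop :=
  (forall f, A_space alpha s f -> A_space alpha s' (T f)) /\
  exists C : R, forall f, A_space alpha s f ->
    (A_norm alpha s' (T f) <= C%:E * A_norm alpha s f)%E.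

End Disc.

(* Main.v *)
From HB Require Import structures.
Require Import Defs.
From mathcomp Require Import all_boot all_order all_algebra.
From mathcomp Require Import all_classical all_reals all_analysis complex.
From mathcomp Require Import measurable_realfun ess_sup_inf ring lra.

Set Implicit Arguments.
Unset Strict Implicit.
Unset Printing Implicit Defensive.

Import Order.TTheory GRing.Theory Num.Theory.
Import numFieldNormedType.Exports.
Import ComplexField.Normc.

Local Open Scope classical_set_scope.
Local Open Scope ring_scope.
Local Open Scope complex_scope.

(** Write E_g(z) = max (1, |g(z)|)^{p(z)}. The theorem rests on a pointwise
estimate: for analytic g of modular at most 1, E_g(w) is at most a constant times
an average of E_g near w. For constant p this is the subharmonicity of |g|^p. In
general one starts from log^+ |g| = (1/p) ln E_g, which is at most its own
average. The concavity of the logarithm bounds the average of (1/p) ln E_g by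
(average of 1/p) * ln h + constant, where h is the average of E_g. The average of
1/p differs from 1/p(w) by O(1 / ln (1/d)), d being the distance of w to the
boundary, by log-Holder continuity; the modular bound gives h <= (1/d)^{O(1)}, so
the product of this difference with ln h is bounded, and exponentiation yields
E_g(w) <= K h (exponent_transfer).

For Hardy spaces the average is a Poisson integral over a circle of radius r < 1
(modp_le_poisson), so that E_g(phi(z)) is at most K times P(phi(z)) with P
harmonic. As P o phi is harmonic, its mean over any circle is P(phi(0)), which
Harnack's inequality bounds by the mean of E_g; this is Littlewood's subordination
(circle_modular_composition).

For Bergman spaces the average is over the ball of radius d/2 about w
(modp_le_area). Integrating at w = phi(z) against the weight and exchanging the
integrations leaves, for each zeta in the disc, the integral of
(1 - |phi(z)|)^{-2} (1 - |z|^2)^alpha over the set of z with phi(z) close to zeta.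
On that set the Poisson kernel of the direction of zeta is, at phi(z), at least a
constant multiple of 1 / (1 - |zeta|), and 1 - |z| is at most a constant multiple
of 1 - |zeta| (self_map_distance). Since the Poisson kernel composed with phi is
harmonic, its integral over a shell 1 - |z|^2 <= t against the radial weight is
its value at 0 times O(t^{1 + alpha}), and the whole is O((1 - |zeta|^2)^alpha)
(kernel_integral_le).

Both cases bound the modular of g o phi by a constant whenever the modular of g
is at most 1; dilating the level of the Luxemburg norm turns this into a bound of
norms (luxemburg_sup_transfer).

The function theory used here starts from the mean value property of an analytic
function. It is proved by Goursat's bisection in polar coordinates
(additive_rectangle_eq0, mean_value_Re), which needs no continuity of the
derivative. The bound of log |f| by a Poisson integral follows from the maximum
principle applied to f e^{-G}, with G the Herglotz integral of the boundary values
(normc_le_exp_poisson). *)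

(** * Modulus, continuity and complex differentiability *)

Section Cplx.
Variable R : realType.
Implicit Types z w : R[i].

Lemma normc_norm z : `|z| = (normc z)%:C.
Proof. by []. Qed.

Lemma normcD z w : normc (z + w) <= normc z + normc w.
Proof. exact: (@complex.le_normcD R z w). Qed.

Lemma normcN z : normc (- z) = normc z.
Proof. exact: (@complex.normcN R z). Qed.

Lemma normc_ge0 z : 0 <= normc z.
Proof. by case: z => a b; exact: sqrtr_ge0. Qed.

Lemma normcB z w : normc (z - w) = normc (w - z).
Proof. by rewrite -normcN opprB. Qed.

Lemma sqr_normcE z : normc z ^+ 2 = complex.Re z ^+ 2 + complex.Im z ^+ 2.
Proof. by case: z => a b /=; rewrite sqr_sqrtr// addr_ge0// sqr_ge0. Qed.

Lemma normcR (a : R) : normc a%:C = `|a|.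
Proof. by rewrite /= expr0n addr0 sqrtr_sqr. Qed.

Lemma ler_Re_normc z : `|complex.Re z| <= normc z.
Proof.
rewrite -ler_sqr ?nnegrE ?normc_ge0// sqr_normcE real_normK ?num_real//.
by rewrite lerDl sqr_ge0.
Qed.

Lemma ler_Im_normc z : `|complex.Im z| <= normc z.
Proof.
rewrite -ler_sqr ?nnegrE ?normc_ge0// sqr_normcE real_normK ?num_real//.
by rewrite lerDr sqr_ge0.
Qed.

Lemma normc_le_ReIm z : normc z <= `|complex.Re z| + `|complex.Im z|.
Proof.
rewrite -ler_sqr ?nnegrE ?normc_ge0 ?addr_ge0// sqr_normcE sqrrD.
rewrite !real_normK ?num_real//.
by rewrite addrAC lerDl mulrn_wge0// mulr_ge0.
Qed.

Lemma normc_eq0 z : (normc z == 0) = (z == 0).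
Proof.
apply/eqP/eqP => [/eq0_normc//|->]; exact: normc0.
Qed.

Lemma normc_gt0 z : (0 < normc z) = (z != 0).
Proof. by rewrite lt0r normc_ge0 normc_eq0 andbT. Qed.

Lemma normcJ z : normc (conjc z) = normc z.
Proof. by case: z => a b /=; rewrite sqrrN. Qed.

Lemma lec_R_gt0 (e : R[i]) : 0 < e -> exists2 r : R, 0 < r & e = r%:C.
Proof.
case: e => a b; rewrite ltcE /= => /andP[/eqP -> a0]; by exists a.
Qed.

Lemma nbhs_normcP (z : R[i]^o) (A : set R[i]^o) :
  nbhs z A <-> exists2 e : R, 0 < e & forall w, normc (w - z) < e -> A w.
Proof.
split.
- move=> /nbhs_ballP[e /= e0 eA]; have [r r0 er] := lec_R_gt0 e0.
  exists r => // w wz; apply: eA; rewrite -ball_normE /ball_ /= er distrC normc_norm.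
  by rewrite ltcR.
- move=> [e e0 eA]; apply/nbhs_ballP; exists e%:C => /=; first by rewrite ltcR.
  move=> w; rewrite -ball_normE /ball_ /= distrC normc_norm ltcR; exact: eA.
Qed.

Lemma near_normc (z : R[i]^o) (P : R[i] -> Prop) (e : R) : 0 < e ->
  (forall w, normc (w - z) < e -> P w) -> \forall w \near z, P w.
Proof. by move=> e0 H; apply/(@nbhs_normcP z P); exists e. Qed.

Lemma cvg_normcP {T : Type} {F : set_system T} {FF : Filter F}
    (f : T -> R[i]^o) (l : R[i]^o) :
  f x @[x --> F] --> l <->
  forall e : R, 0 < e -> \forall x \near F, normc (f x - l) < e.
Proof.
split.
- move=> fl e e0; apply: (fl [set w | normc (w - l) < e]).
  by apply/nbhs_normcP; exists e.
- move=> H A /nbhs_normcP[e e0 eA].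
  by apply: filterS (H _ e0) => x; exact: eA.
Qed.

Lemma cvg_at_normcP (u : R[i] -> R) (z : R[i]^o) (l : R) :
  u w @[w --> z] --> l <->
  forall e : R, 0 < e -> exists2 d : R, 0 < d &
    forall w, normc (w - z) < d -> `|u w - l| < e.
Proof.
have FF : Filter (nbhs z) by exact: nbhs_filter.
split.
- move=> /(@cvgrPdist_lt _ _ _ (nbhs z) FF) H e e0.
  have /nbhs_normcP[d d0 dH] := H _ e0.
  by exists d => // w /dH; rewrite distrC.
- move=> H; apply/(@cvgrPdist_lt _ _ _ (nbhs z) FF) => e e0.
  have [d d0 dH] := H _ e0; apply/(near_normc d0) => w /dH.
  by rewrite distrC.
Qed.

Lemma cvg_ReIm {T : Type} {F : set_system T} {FF : Filter F}
    (f : T -> R[i]^o) (l : R[i]^o) :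
  complex.Re (f x) @[x --> F] --> complex.Re l ->
  complex.Im (f x) @[x --> F] --> complex.Im l ->
  f x @[x --> F] --> l.
Proof.
move=> /cvgrPdist_lt fr /cvgrPdist_lt fi; apply/cvg_normcP => e e0.
have e20 : 0 < e / 2 by rewrite divr_gt0.
move: (fr _ e20) (fi _ e20); apply: filterS2 => x; case: (f x) l {fr fi} => [? ?] [? ?] hr hi.
rewrite (le_lt_trans (normc_le_ReIm _))// (splitr e) ltrD//.
- by rewrite -normrN opprB.
- by rewrite -normrN opprB.
Qed.

Lemma continuous_Re : continuous (fun z : R[i]^o => complex.Re z).
Proof.
move=> z; apply/cvg_at_normcP => e e0; exists e => // w wz.
apply: le_lt_trans wz; case: w z => [? ?] [? ?]; exact: (ler_Re_normc (_ +i* _)).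
Qed.

Lemma continuous_Im : continuous (fun z : R[i]^o => complex.Im z).
Proof.
move=> z; apply/cvg_at_normcP => e e0; exists e => // w wz.
apply: le_lt_trans wz; case: w z => [? ?] [? ?]; exact: (ler_Im_normc (_ +i* _)).
Qed.

Lemma ler_distB_normc z w : `|normc z - normc w| <= normc (z - w).
Proof.
rewrite ler_norml lerBlDr -[X in normc X <= _ + _](subrK w) normcD andbT.
rewrite lerNl opprB lerBlDr -[X in normc X <= _](subrK z).
by rewrite (le_trans (normcD _ _))// normcB.
Qed.

Lemma continuous_normc : continuous (@normc R : R[i]^o -> R).
Proof.
move=> z; apply/cvg_at_normcP => e e0; exists e => // w wz.
by rewrite (le_lt_trans _ wz)// ler_distB_normc.
Qed.

(** Complex differentiability in terms of the real modulus. *)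
Lemma derivable_normcP (f : R[i] -> R[i]) z :
  derivable (f : R[i]^o -> R[i]^o) z 1 <->
  exists l : R[i], forall e : R, 0 < e -> exists2 d : R, 0 < d &
    forall h, normc h < d ->
      normc (f (z + h) - f z - l * h) <= e * normc h.
Proof.
split.
- move=> /cvg_ex[/= l /cvg_normcP H]; exists l => e e0.
  have := H _ e0; rewrite near_withinE => /nbhs_normcP[d d0 dH].
  exists d => // h hd; have [->|h0] := eqVneq h 0.
    by rewrite mulr0 subr0 addr0 subrr normc0 mulr0.
  have := dH h; rewrite subr0 => /(_ hd h0) /=.
  move=> /ltW; rewrite -(ler_pM2r (_ : 0 < normc h)) ?normc_gt0//.
  rewrite -normcM; apply: le_trans.
  rewrite /GRing.scale /= mulr1 [h + z]addrC mulrBl mulrAC mulVf// mul1r.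
  exact: lexx.
- move=> [l H]; apply/cvg_ex; exists l; apply/cvg_normcP => e e0.
  have e20 : 0 < e / 2 by rewrite divr_gt0.
  have [d d0 dH] := H _ e20.
  rewrite near_withinE; apply: (near_normc d0) => h; rewrite subr0 => hd h0.
  have := dH _ hd; have hn : 0 < normc h by rewrite normc_gt0.
  rewrite -ler_pdivrMr// -normcV -normcM mulrBl mulfK//.
  move=> /le_lt_trans; rewrite /GRing.scale /= mulr1 [h + z]addrC [h^-1 * _]mulrC; apply.
  by rewrite ltr_pdivrMr// ltr_pMr// ltr1n.
Qed.

Lemma derivable_continuous_at (f : R[i] -> R[i]) z :
  derivable (f : R[i]^o -> R[i]^o) z 1 ->
  {for z, continuous (f : R[i]^o -> R[i]^o)}.
Proof. by move=> /derivable1_diffP/differentiable_continuous. Qed.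

Lemma derivable_circ (f g : R[i] -> R[i]) z :
  derivable (g : R[i]^o -> R[i]^o) z 1 ->
  derivable (f : R[i]^o -> R[i]^o) (g z) 1 ->
  derivable ((f \o g) : R[i]^o -> R[i]^o) z 1.
Proof.
move=> /derivable_normcP[lg Hg] /derivable_normcP[lf Hf].
apply/derivable_normcP; exists (lf * lg) => e e0.
pose A := normc lg + 1; have A0 : 0 < A by rewrite ltr_wpDl// normc_ge0.
pose B := normc lf + 1; have B0 : 0 < B by rewrite ltr_wpDl// normc_ge0.
have e10 : 0 < Num.min 1 (e / 2 / B) by rewrite lt_min ltr01 !divr_gt0.
have e20 : 0 < e / 2 / A by rewrite !divr_gt0.
have [d1 d10 {}Hg] := Hg _ e10; have [d2 d20 {}Hf] := Hf _ e20.
exists (Num.min d1 (d2 / A)); first by rewrite lt_min d10 divr_gt0.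
move=> h; rewrite lt_min => /andP[/Hg {}Hg hd].
set k := g (z + h) - g z; rewrite -/k in Hg.
have hn := normc_ge0 h.
have kA : normc k <= A * normc h.
  rewrite -(subrK (lg * h) k) (le_trans (normcD _ _))// normcM /A mulrDl mul1r addrC.
  rewrite lerD2l (le_trans Hg)// -{2}(mul1r (normc h)) ler_wpM2r// ge_min lexx//.
have kd : normc k < d2.
  by rewrite (le_lt_trans kA)// mulrC -ltr_pdivlMr.
have := Hf _ kd; rewrite /k subrKC -/k /= => {}Hf.
have -> : f (g (z + h)) - f (g z) - lf * lg * h =
    (f (g (z + h)) - f (g z) - lf * k) + lf * (k - lg * h) by ring.
apply: le_trans (normcD _ _) _; rewrite (splitr e) mulrDl lerD//.
  apply: le_trans Hf _; apply: le_trans (ler_wpM2l (ltW e20) kA) _.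
  by rewrite mulrA divfK// gt_eqF.
rewrite normcM; apply: (@le_trans _ _ (B * (e / 2 / B * normc h))).
  rewrite ler_pM ?normc_ge0//; first by rewrite /B lerDl.
  by apply: le_trans Hg _; rewrite ler_wpM2r// ge_min lexx orbT.
by rewrite mulrA [B * _]mulrC divfK// gt_eqF.
Qed.

(** Pointwise continuity of a real function of a complex variable, for the
topology in which complex differentiability is expressed. *)
Definition ctsat (u : R[i] -> R) z := {for z, continuous (u : R[i]^o -> R)}.

Lemma ctsatP u z : ctsat u z <-> forall e : R, 0 < e -> exists2 d : R, 0 < d &
  forall w, normc (w - z) < d -> `|u w - u z| < e.
Proof. exact: cvg_at_normcP. Qed.

Lemma ctsat_cst (k : R) z : ctsat (fun=> k) z.
Proof. exact: (@cvg_cst R k (R[i]^o) (nbhs (z : R[i]^o)) _). Qed.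

Lemma ctsatD (u v : R[i] -> R) z : ctsat u z -> ctsat v z -> ctsat (fun w => u w + v w) z.
Proof. by move=> cu cv; exact: (@cvgD R R (R[i]^o) (nbhs (z : R[i]^o)) _ u v _ _ cu cv). Qed.

Lemma ctsatM (u v : R[i] -> R) z : ctsat u z -> ctsat v z -> ctsat (fun w => u w * v w) z.
Proof. by move=> cu cv; exact: (@cvgM R (R[i]^o) (nbhs (z : R[i]^o)) _ u v _ _ cu cv). Qed.

Lemma ctsat_comp (u : R[i] -> R) (k : R -> R) z :
  ctsat u z -> {for u z, continuous k} -> ctsat (fun w => k (u w)) z.
Proof. by move=> cu ck; exact: (@continuous_comp (R[i]^o) R R u k z cu ck). Qed.

Lemma ctsat_circ (u : R[i] -> R) (F : R[i] -> R[i]) z :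
  {for z, continuous (F : R[i]^o -> R[i]^o)} -> ctsat u (F z) ->
  ctsat (fun w => u (F w)) z.
Proof. by move=> cF cu; exact: (@continuous_comp (R[i]^o) (R[i]^o) R F u z cF cu). Qed.

Lemma ctsat_normc z : ctsat (@normc R) z. Proof. exact: continuous_normc. Qed.
Lemma ctsat_Re z : ctsat (fun w => complex.Re w) z. Proof. exact: continuous_Re. Qed.
Lemma ctsat_Im z : ctsat (fun w => complex.Im w) z. Proof. exact: continuous_Im. Qed.

Lemma ctsat_path (u : R[i] -> R) (g : R -> R[i]) (t : R) :
  {for t, continuous (g : R -> R[i]^o)} -> ctsat u (g t) ->
  {for t, continuous (fun t => u (g t))}.
Proof. by move=> cg cu; exact: (@continuous_comp R (R[i]^o) R g u t cg cu). Qed.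

End Cplx.
Section CDer.
Variable R : realType.
Implicit Types (f g : R[i] -> R[i]) (z : R[i]).

Lemma cder_cst (c : R[i]) z : derivable ((fun=> c) : R[i]^o -> R[i]^o) z 1.
Proof. exact: derivable_cst. Qed.

Lemma cder_id z : derivable (id : R[i]^o -> R[i]^o) z 1.
Proof. exact: derivable_id. Qed.

Lemma cderD f g z : derivable (f : R[i]^o -> R[i]^o) z 1 ->
  derivable (g : R[i]^o -> R[i]^o) z 1 ->
  derivable ((fun w => f w + g w) : R[i]^o -> R[i]^o) z 1.
Proof.
move=> /derivable_normcP[l Hl] /derivable_normcP[k Hk].
apply/derivable_normcP; exists (l + k) => e e0.
have e20 : 0 < e / 2 by rewrite divr_gt0.
have [d1 d10 H1] := Hl _ e20; have [d2 d20 H2] := Hk _ e20.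
exists (Num.min d1 d2); first by rewrite lt_min d10.
move=> h; rewrite lt_min => /andP[/H1 {}H1 /H2 {}H2].
have -> : f (z + h) + g (z + h) - (f z + g z) - (l + k) * h =
  (f (z + h) - f z - l * h) + (g (z + h) - g z - k * h) by ring.
by rewrite (le_trans (normcD _ _))// (splitr e) mulrDl lerD.
Qed.

Lemma cderM f g z : derivable (f : R[i]^o -> R[i]^o) z 1 ->
  derivable (g : R[i]^o -> R[i]^o) z 1 ->
  derivable ((fun w => f w * g w) : R[i]^o -> R[i]^o) z 1.
Proof. by move=> df dg; exact: (@derivableM _ (R[i]^o) f g z 1 df dg). Qed.

Lemma cderV f z : f z != 0 -> derivable (f : R[i]^o -> R[i]^o) z 1 ->
  derivable ((fun w => (f w)^-1) : R[i]^o -> R[i]^o) z 1.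
Proof. by move=> f0 df; exact: (@derivableV _ (R[i]^o) f z 1 f0 df). Qed.

Lemma cderB f g z : derivable (f : R[i]^o -> R[i]^o) z 1 ->
  derivable (g : R[i]^o -> R[i]^o) z 1 ->
  derivable ((fun w => f w - g w) : R[i]^o -> R[i]^o) z 1.
Proof.
move=> df dg.
have -> : (fun w => f w - g w) = (fun w => f w + (- 1) * g w).
  by apply/funext => w; rewrite mulN1r.
exact: (cderD df (cderM (@cder_cst (-1) z) dg)).
Qed.

End CDer.

Section ContinuousPath.
Variable R : realType.
Implicit Types (f g : R -> R[i]) (t : R).

Definition ccat g t := {for t, continuous (g : R -> R[i]^o)}.

Lemma ccat_cst (c : R[i]) t : ccat (fun=> c) t.
Proof. exact: (@cvg_cst (R[i]^o) c R (nbhs t) _). Qed.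

Lemma ccat_ReIm g t : {for t, continuous (fun s => complex.Re (g s))} ->
  {for t, continuous (fun s => complex.Im (g s))} -> ccat g t.
Proof. by move=> cr ci; exact: (@cvg_ReIm R R (nbhs t) _ g (g t) cr ci). Qed.

Lemma ccat_Re g t : ccat g t -> {for t, continuous (fun s => complex.Re (g s))}.
Proof.
by move=> cg; exact: (@continuous_comp R (R[i]^o) R g (fun z => complex.Re z) t cg (@continuous_Re R _)).
Qed.

Lemma ccat_Im g t : ccat g t -> {for t, continuous (fun s => complex.Im (g s))}.
Proof.
by move=> cg; exact: (@continuous_comp R (R[i]^o) R g (fun z => complex.Im z) t cg (@continuous_Im R _)).
Qed.

Lemma ccatD f g t : ccat f t -> ccat g t -> ccat (fun s => f s + g s) t.
Proof.
move=> cf cg; apply: ccat_ReIm.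
  have -> : (fun s => complex.Re (f s + g s)) = (fun s => complex.Re (f s) + complex.Re (g s)).
    by apply/funext => s; case: (f s) (g s) => ? ? [].
  exact: (cvgD (ccat_Re cf) (ccat_Re cg)).
have -> : (fun s => complex.Im (f s + g s)) = (fun s => complex.Im (f s) + complex.Im (g s)).
  by apply/funext => s; case: (f s) (g s) => ? ? [].
exact: (cvgD (ccat_Im cf) (ccat_Im cg)).
Qed.

Lemma ccatM f g t : ccat f t -> ccat g t -> ccat (fun s => f s * g s) t.
Proof. by move=> cf cg; exact: (@cvgM (R[i]) R (nbhs t) _ f g _ _ cf cg). Qed.

Lemma ccatV f t : f t != 0 -> ccat f t -> ccat (fun s => (f s)^-1) t.
Proof. by move=> f0 cf; exact: (@cvgV (R[i]) R (nbhs t) _ f (f t) f0 cf). Qed.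

Lemma ccatN f t : ccat f t -> ccat (fun s => - f s) t.
Proof.
have -> : (fun s => - f s) = (fun s => - 1 * f s) by apply/funext => s; rewrite mulN1r.
by move=> cf; exact: (ccatM (@ccat_cst (-1) t) cf).
Qed.

Lemma ccatB f g t : ccat f t -> ccat g t -> ccat (fun s => f s - g s) t.
Proof. by move=> cf cg; exact: (ccatD cf (ccatN cg)). Qed.

Lemma ccat_real (u : R -> R) t : {for t, continuous u} -> ccat (fun s => (u s)%:C) t.
Proof. by move=> cu; apply: ccat_ReIm => //; exact: (@cvg_cst R 0 R (nbhs t) _). Qed.

End ContinuousPath.

(** * Cauchy's theorem in polar coordinates *)

Section RectangleFunction.
Variable R : realType.

Lemma expn2_gt (K : R) : exists n : nat, K < 2 ^+ n.
Proof.
have [n Kn] : exists n : nat, K < n%:R.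
  by exists (Num.bound `|K|); rewrite (le_lt_trans (ler_norm _))// archi_boundP.
exists n; apply: (lt_le_trans Kn); rewrite -natrX ler_nat ltnW//.
exact: ltn_expl.
Qed.

(** Goursat's bisection for an abstract additive function of rectangles. Some
quarter of a rectangle retains a quarter of |J|; the nested quarters shrink to a
point, where the local estimate, quadratic in the size with an arbitrarily small
constant, is contradicted. *)
Lemma additive_rectangle_eq0 (J : R -> R -> R -> R -> R) (a b c d : R) :
  a <= b -> c <= d ->
  (forall x1 x2 x3 y1 y2, a <= x1 -> x1 <= x2 -> x2 <= x3 -> x3 <= b ->
    c <= y1 -> y1 <= y2 -> y2 <= d ->
    J x1 x3 y1 y2 = J x1 x2 y1 y2 + J x2 x3 y1 y2) ->
  (forall x1 x2 y1 y2 y3, a <= x1 -> x1 <= x2 -> x2 <= b ->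
    c <= y1 -> y1 <= y2 -> y2 <= y3 -> y3 <= d ->
    J x1 x2 y1 y3 = J x1 x2 y1 y2 + J x1 x2 y2 y3) ->
  (forall x0 y0, a <= x0 <= b -> c <= y0 <= d ->
    forall e : R, 0 < e -> exists2 dl : R, 0 < dl &
      forall x1 x2 y1 y2, a <= x1 -> x1 <= x0 -> x0 <= x2 -> x2 <= b ->
        c <= y1 -> y1 <= y0 -> y0 <= y2 -> y2 <= d ->
        x2 - x1 < dl -> y2 - y1 < dl ->
        `|J x1 x2 y1 y2| <= e * (x2 - x1 + (y2 - y1)) ^+ 2) ->
  J a b c d = 0.
Proof.
move=> ab cd addx addy loc; apply/eqP/negPn/negP => J0.
pose w n : R := (b - a) / 2 ^+ n; pose h n : R := (d - c) / 2 ^+ n.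
have w0 n : 0 <= w n by rewrite divr_ge0// ?subr_ge0// exprn_ge0.
have h0 n : 0 <= h n by rewrite divr_ge0// ?subr_ge0// exprn_ge0.
have wS n : w n = w n.+1 + w n.+1.
  by rewrite /w exprS invfM; field; rewrite expf_neq0.
have hS n : h n = h n.+1 + h n.+1.
  by rewrite /h exprS invfM; field; rewrite expf_neq0.
pose Jn n (q : R * R) := J q.1 (q.1 + w n) q.2 (q.2 + h n).
pose inR n (q : R * R) :=
  [/\ a <= q.1, q.1 + w n <= b, c <= q.2 & q.2 + h n <= d].
pose nx n (q q' : R * R) := [/\ `|Jn n q| / 4 <= `|Jn n.+1 q'|, inR n.+1 q',
  q.1 <= q'.1 /\ q'.1 + w n.+1 <= q.1 + w n &
  q.2 <= q'.2 /\ q'.2 + h n.+1 <= q.2 + h n].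
have step n q : inR n q -> exists q', nx n q q'.
  move=> [q1 q2 q3 q4].
  pose x' := q.1 + w n.+1; pose y' := q.2 + h n.+1.
  have wn := w0 n.+1; have hn := h0 n.+1; have wSn := wS n; have hSn := hS n.
  have JE : Jn n q = Jn n.+1 q + Jn n.+1 (x', q.2) + Jn n.+1 (q.1, y') + Jn n.+1 (x', y').
    rewrite /Jn /= /x' /y'.
    have -> : q.1 + w n = q.1 + w n.+1 + w n.+1 by rewrite wSn addrA.
    have -> : q.2 + h n = q.2 + h n.+1 + h n.+1 by rewrite hSn addrA.
    rewrite (addy _ _ _ (q.2 + h n.+1)); [|by move: q1 q2 q3 q4 wn hn wSn hSn; clear; lra..].
    rewrite (addx _ (q.1 + w n.+1)); [|by move: q1 q2 q3 q4 wn hn wSn hSn; clear; lra..].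
    rewrite (addx _ (q.1 + w n.+1) _ (q.2 + h n.+1)); [|by move: q1 q2 q3 q4 wn hn wSn hSn; clear; lra..].
    by rewrite addrA.
  have : `|Jn n q| <= `|Jn n.+1 q| + `|Jn n.+1 (x', q.2)| + `|Jn n.+1 (q.1, y')| + `|Jn n.+1 (x', y')|.
    rewrite JE.
    by rewrite (le_trans (ler_normD _ _))// lerD// (le_trans (ler_normD _ _))// lerD// ler_normD.
  move=> Jle.
  clear JE.
  have [A|A] := leP (`|Jn n q| / 4) `|Jn n.+1 q|.
    exists q; split => //; rewrite /inR;
      move: q1 q2 q3 q4 wn hn wSn hSn; clear; by move=> *; split; lra.
  have [B|B] := leP (`|Jn n q| / 4) `|Jn n.+1 (x', q.2)|.
    exists (x', q.2); rewrite /x' /=; split => //; rewrite /inR /=;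
      move: q1 q2 q3 q4 wn hn wSn hSn; clear; by move=> *; split; lra.
  have [C|C] := leP (`|Jn n q| / 4) `|Jn n.+1 (q.1, y')|.
    exists (q.1, y'); rewrite /y' /=; split => //; rewrite /inR /=;
      move: q1 q2 q3 q4 wn hn wSn hSn; clear; by move=> *; split; lra.
  exists (x', y'); rewrite /y' /x' /=; split; rewrite /inR /=.
  - by rewrite -/x' -/y'; move: A B C Jle; clear; lra.
  - by move: q1 q2 q3 q4 wn hn wSn hSn; clear; move=> *; split; lra.
  - by move: q1 q2 q3 q4 wn hn wSn hSn; clear; move=> *; split; lra.
  - by move: q1 q2 q3 q4 wn hn wSn hSn; clear; move=> *; split; lra.
pose F n (q : R * R) := xget q [set q' | nx n q q'].
have FP n q : inR n q -> nx n q (F n q).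
  by move=> /step[q' qq']; exact: (@xgetPex _ q [set q' | nx n q q']) (ex_intro _ q' qq').
pose Q := fix Q n := if n is m.+1 then F m (Q m) else (a, c).
have QR n : inR n (Q n).
  elim: n => [|n ih /=]; first by rewrite /inR /= /w /h expr0 !divr1; split; lra.
  by have [] := FP n _ ih.
have QS n := FP n _ (QR n).
have J4 n : `|J a b c d| / 4 ^+ n <= `|Jn n (Q n)|.
  elim: n => [|n ih].
    by rewrite expr0 divr1 /Jn /= /w /h expr0 !divr1 !subrKC.
  have [+ _ _ _] := QS n; apply: le_trans.
  by rewrite exprSr invfM mulrA ler_wpM2r.
have mono1 m n : (Q n).1 <= (Q (n + m)%N).1 /\ (Q (n + m)%N).1 + w (n + m)%N <= (Q n).1 + w n.
  elim: m => [|m [i1 i2]]; first by rewrite addn0.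
  rewrite addnS /=; have [_ _ [s1 s2] _] := QS (n + m)%N.
  by move: i1 i2 s1 s2; clear; move=> *; split; lra.
have mono2 m n : (Q n).2 <= (Q (n + m)%N).2 /\ (Q (n + m)%N).2 + h (n + m)%N <= (Q n).2 + h n.
  elim: m => [|m [i1 i2]]; first by rewrite addn0.
  rewrite addnS /=; have [_ _ _ [s1 s2]] := QS (n + m)%N.
  by move: i1 i2 s1 s2; clear; move=> *; split; lra.
have cross1 m n : (Q m).1 <= (Q n).1 + w n.
  have [mn|/ltnW nm] := leqP m n.
    have [+ _] := mono1 (n - m)%N m; rewrite subnKC// => H.
    by rewrite (le_trans H)// lerDl.
  have [_ +] := mono1 (m - n)%N n; rewrite subnKC// => H.
  by rewrite (le_trans _ H)// lerDl.
have cross2 m n : (Q m).2 <= (Q n).2 + h n.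
  have [mn|/ltnW nm] := leqP m n.
    have [+ _] := mono2 (n - m)%N m; rewrite subnKC// => H.
    by rewrite (le_trans H)// lerDl.
  have [_ +] := mono2 (m - n)%N n; rewrite subnKC// => H.
  by rewrite (le_trans _ H)// lerDl.
pose x0 := sup (range (fun n => (Q n).1)); pose y0 := sup (range (fun n => (Q n).2)).
have x0l n : (Q n).1 <= x0.
  apply: ub_le_sup; last by exists n.
  by exists ((Q 0).1 + w 0) => _ [m _ <-]; exact: cross1.
have x0r n : x0 <= (Q n).1 + w n.
  by apply: ge_sup => [|_ [m _ <-]]; [by exists (Q 0).1, 0|exact: cross1].
have y0l n : (Q n).2 <= y0.
  apply: ub_le_sup; last by exists n.
  by exists ((Q 0).2 + h 0) => _ [m _ <-]; exact: cross2.
have y0r n : y0 <= (Q n).2 + h n.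
  by apply: ge_sup => [|_ [m _ <-]]; [by exists (Q 0).2, 0|exact: cross2].
have x0ab : a <= x0 <= b.
  by have [] := QR 0; have := x0l 0; have := x0r 0; clear; move=> *; apply/andP; split; lra.
have y0cd : c <= y0 <= d.
  by have [] := QR 0; have := y0l 0; have := y0r 0; clear; move=> *; apply/andP; split; lra.
have Jpos : 0 < `|J a b c d| by rewrite normr_gt0.
pose L := (b - a + (d - c)) ^+ 2 + 1.
have L0 : 0 < L by rewrite /L ltr_wpDl// sqr_ge0.
pose e := `|J a b c d| / L / 2.
have e0 : 0 < e by rewrite !divr_gt0.
have [dl dl0 H] := loc _ _ x0ab y0cd e e0.
have [n nK] := expn2_gt ((b - a + (d - c)) / dl).
have p2 : 0 < 2 ^+ n :> R by rewrite exprn_gt0.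
have wd : w n < dl.
  rewrite /w ltr_pdivrMr// mulrC -ltr_pdivrMr// (le_lt_trans _ nK)//.
  by rewrite ler_pM2r ?invr_gt0// lerDl subr_ge0.
have hd : h n < dl.
  rewrite /h ltr_pdivrMr// mulrC -ltr_pdivrMr// (le_lt_trans _ nK)//.
  by rewrite ler_pM2r ?invr_gt0// lerDr subr_ge0.
have [q1 q2 q3 q4] := QR n.
have := H _ _ _ _ q1 (x0l n) (x0r n) q2 q3 (y0l n) (y0r n) q4.
rewrite !(addrC (_.1) (w n)) !(addrC (_.2) (h n)) !addrK => /(_ wd hd).
rewrite !(addrC (w n)) !(addrC (h n)) => Jle.
have := le_trans (J4 n) Jle; apply/negP; rewrite -ltNge.
have -> : w n + h n = (b - a + (d - c)) / 2 ^+ n by rewrite /w /h -mulrDl.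
rewrite expr_div_n -exprM mulnC exprM.
rewrite (_ : 2 ^+ 2 = 4 :> R); last by rewrite expr2; lra.
rewrite mulrA ltr_pM2r ?invr_gt0 ?exprn_gt0// /e mulrAC.
rewrite ltr_pdivrMr// mulrAC ltr_pdivrMr// -mulrA ltr_pM2l//.
rewrite /L; have := sqr_ge0 (b - a + (d - c)); set S := _ ^+ 2; clear; lra.
Qed.

End RectangleFunction.

Section IntervalIntegral.
Variable R : realType.
Implicit Types (g : R -> R) (a b c : R).

Notation mu := (@lebesgue_measure R).

Definition Iab g a b : R := \int[mu]_(x in `[a, b]) g x.

Definition intab g a b := mu.-integrable `[a, b] (EFin \o g).

Lemma intab_cont g a b : {within `[a, b], continuous g} -> intab g a b.
Proof. by move=> cg; apply: continuous_compact_integrable => //; exact: segment_compact. Qed.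

Lemma intab_continuous g a b : continuous g -> intab g a b.
Proof. by move=> cg; apply: intab_cont; exact: continuous_subspaceT. Qed.

Lemma Iab_split g a b c : a <= b -> b <= c -> intab g a c ->
  Iab g a c = Iab g a b + Iab g b c.
Proof.
move=> ab bc ig; have := @Rintegral_itvB R g (BLeft a) (BRight c) b ig.
rewrite !bnd_simp => /(_ ab bc) H; rewrite /Iab.
rewrite -(Rintegral_itv_obnd_cbnd (r := b) (b := BRight c)).
  by rewrite -H; ring.
apply: integrableS ig => // x /=; rewrite !in_itv /=; lra.
Qed.

Lemma IabD g1 g2 a b : intab g1 a b -> intab g2 a b ->
  Iab (fun x => g1 x + g2 x) a b = Iab g1 a b + Iab g2 a b.
Proof. by move=> i1 i2; rewrite /Iab RintegralD. Qed.

Lemma IabB g1 g2 a b : intab g1 a b -> intab g2 a b ->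
  Iab (fun x => g1 x - g2 x) a b = Iab g1 a b - Iab g2 a b.
Proof. by move=> i1 i2; rewrite /Iab RintegralB. Qed.

Lemma IabZ k g a b : intab g a b ->
  Iab (fun x => k * g x) a b = k * Iab g a b.
Proof. by move=> i1; rewrite /Iab RintegralZl. Qed.

Lemma Iab_cst k a b : a <= b -> Iab (fun=> k) a b = k * (b - a).
Proof.
move=> ab; rewrite /Iab Rintegral_cst//= lebesgue_measure_itv /= lte_fin.
by have [ab'|ba] := ltP a b => //=; congr (_ * _); lra.
Qed.

Lemma intab_cst k a b : intab (fun=> k) a b.
Proof. by apply: intab_continuous => x; exact: cvg_cst. Qed.

Lemma intabD g1 g2 a b : intab g1 a b -> intab g2 a b ->
  intab (fun x => g1 x + g2 x) a b.
Proof. by move=> i1 i2; have := integrableD _ i1 i2; apply. Qed.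

Lemma intabB g1 g2 a b : intab g1 a b -> intab g2 a b ->
  intab (fun x => g1 x - g2 x) a b.
Proof. by move=> i1 i2; have := integrableB _ i1 i2; apply. Qed.

Lemma intabZ k g a b : intab g a b -> intab (fun x => k * g x) a b.
Proof. by move=> i1; have := integrableZl _ k i1; apply. Qed.

Lemma le_Iab g1 g2 a b : intab g1 a b -> intab g2 a b ->
  (forall x, a <= x <= b -> g1 x <= g2 x) -> Iab g1 a b <= Iab g2 a b.
Proof.
move=> i1 i2 H; apply: le_Rintegral => // x; rewrite /= in_itv /=; exact: H.
Qed.

Lemma Iab_near g a b k e : a <= b -> intab g a b ->
  (forall x, a <= x <= b -> `|g x - k| <= e) ->
  `|Iab g a b - k * (b - a)| <= e * (b - a).
Proof.
move=> ab ig H.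
have ik := intab_cst k a b; have ie := intab_cst e a b.
rewrite -[k * _]Iab_cst// -IabB// ler_norml -mulNr -!Iab_cst//.
apply/andP; split; apply: le_Iab => //; try exact: intab_cst; try exact: intabB.
- by move=> x /H; rewrite ler_norml => /andP[].
- by move=> x /H; rewrite ler_norml => /andP[].
Qed.

Lemma eq_Iab g1 g2 a b : (forall x, a <= x <= b -> g1 x = g2 x) ->
  Iab g1 a b = Iab g2 a b.
Proof.
by move=> H; apply: eq_Rintegral => x; rewrite inE /= in_itv /=; exact: H.
Qed.

Definition cmean g : R := (2 * pi)^-1 * Iab g 0 (2 * pi).

Lemma twopi_gt0 : 0 < 2 * pi :> R.
Proof. by rewrite mulr_gt0// pi_gt0. Qed.

End IntervalIntegral.

Section CirclePoint.
Variable R : realType.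

(** The point e^{it} of the unit circle. *)
Definition ept (t : R) : R[i] := cos t +i* sin t.

Lemma normc_ept t : normc (ept t) = 1.
Proof. by rewrite /= cos2Dsin2 sqrtr1. Qed.

Lemma circle_ptE (r t : R) : circle_pt r t = r%:C * ept t.
Proof. by rewrite /circle_pt /ept; simpc. Qed.

Lemma ept2pi : ept (2 * pi) = ept 0.
Proof. by rewrite /ept mulrC mulr_natr cos2pi sin2pi cos0 sin0. Qed.

Lemma is_derive_dist (f : R -> R) (x l : R) : is_derive x 1 f l ->
  forall e, 0 < e -> exists2 d : R, 0 < d & forall y, `|y - x| < d ->
    `|f y - f x - l * (y - x)| <= e * `|y - x|.
Proof.
move=> [df <-] e e0.
have /cvgrPdist_le/(_ e e0) : h^-1 *: (f (h *: 1 + x) - f x) @[h --> 0^'] --> 'D_1 f x.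
  exact: df.
rewrite near_withinE => /nbhs_ballP[d /= d0 dH]; exists d => // y yx.
have [->|yx0] := eqVneq y x; first by rewrite !subrr mulr0 subr0 normr0 mulr0.
have := dH (y - x); rewrite /ball /= sub0r normrN => /(_ yx).
rewrite subr_eq0 => /(_ yx0); rewrite /GRing.scale /= mulr1 subrK.
move: yx0; rewrite -subr_eq0 => yx0.
rewrite -(ler_pM2r (_ : 0 < `|y - x|)) ?normr_gt0// -normrM.
by rewrite mulrBl mulrAC mulVf// mul1r distrC.
Qed.

Lemma is_derive_lipschitz (f df : R -> R) (x y : R) :
  (forall z : R, is_derive z 1 f (df z)) -> (forall z, `|df z| <= 1) ->
  `|f x - f y| <= `|x - y|.
Proof.
move=> fd df1; wlog xy : x y / y <= x.
  by move=> H; have [/H//|/ltW/H] := leP y x; rewrite distrC (distrC y).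
have [|c _ ->] := @MVT_segment R f df y x xy (fun z _ => fd z).
  apply: continuous_subspaceT => z; apply: differentiable_continuous.
  by apply/derivable1_diffP; exact: ex_derive.
by rewrite normrM ler_piMl.
Qed.

Lemma normc_ept_dist (x y : R) : normc (ept x - ept y) <= 2 * `|x - y|.
Proof.
apply: le_trans (normc_le_ReIm _) _; rewrite mulr2n mulrDl mul1r lerD//=.
  apply: (@is_derive_lipschitz cos (fun z => - sin z)) => z.
  by rewrite normrN sin_max.
by apply: (@is_derive_lipschitz sin cos) => z; rewrite cos_max.
Qed.

Lemma normc_ept_deriv (x e : R) : 0 < e -> exists2 d : R, 0 < d &
  forall y, `|y - x| < d ->
    normc (ept y - ept x - 'i * ept x * (y - x)%:C) <= e * `|y - x|.
Proof.
move=> e0; have e20 : 0 < e / 2 by rewrite divr_gt0.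
have [d1 d10 H1] := is_derive_dist (is_derive_cos x) e20.
have [d2 d20 H2] := is_derive_dist (is_derive_sin x) e20.
exists (Num.min d1 d2); first by rewrite lt_min d10.
move=> y; rewrite lt_min => /andP[/H1 {}H1 /H2 {}H2].
apply: le_trans (normc_le_ReIm _) _; rewrite [e]splitr mulrDl.
rewrite /ept /= !(mul0r, mul1r, mulr0, subr0, addr0, sub0r, add0r, oppr0).
by rewrite lerD.
Qed.

Lemma continuous_ept : continuous (ept : R -> R[i]^o).
Proof. by move=> t; apply: cvg_ReIm; [exact: continuous_cos|exact: continuous_sin]. Qed.

End CirclePoint.

Section MeanValue.
Variable R : realType.
Implicit Types (a z w : R[i]) (f : R[i] -> R[i]).

Lemma normcR_ge0 (t : R) : 0 <= t -> normc t%:C = t.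
Proof. by move=> t0; rewrite normcR ger0_norm. Qed.

Lemma continuous_circle a (t : R) : continuous (fun s => a + t%:C * ept s : R[i]^o).
Proof.
move=> s; apply: cvgD; first exact: cvg_cst.
by apply: cvgM; [exact: cvg_cst|exact: continuous_ept].
Qed.

Lemma continuous_ray a (s : R) : continuous (fun t : R => a + t%:C * ept s : R[i]^o).
Proof.
move=> t; apply: cvgD; first exact: cvg_cst.
apply: cvgM; last exact: cvg_cst.
by apply: cvg_ReIm => /=; [exact: cvg_id|exact: cvg_cst].
Qed.

Lemma normc_circle a (t s : R) : 0 <= t -> normc (a + t%:C * ept s - a) = t.
Proof. by move=> t0; rewrite addrC addKr normcM normc_ept mulr1 normcR_ge0. Qed.

Lemma circle_dist a (t0 s0 t s : R) : 0 <= t0 ->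
  normc (a + t%:C * ept s - (a + t0%:C * ept s0)) <= `|t - t0| + t0 * (2 * `|s - s0|).
Proof.
move=> t00.
have -> : a + t%:C * ept s - (a + t0%:C * ept s0) =
    (t - t0)%:C * ept s + t0%:C * (ept s - ept s0).
  by rewrite rmorphB /=; ring.
apply: le_trans (normcD _ _) _; rewrite !normcM normc_ept mulr1 normcR lerD//.
by rewrite normcR_ge0// ler_wpM2l// normc_ept_dist.
Qed.

Lemma derivable_dist f z (e : R) :
  derivable (f : R[i]^o -> R[i]^o) z 1 -> 0 < e ->
  exists2 d : R, 0 < d & forall w, normc (w - z) < d -> normc (f w - f z) < e.
Proof.
move=> /derivable_continuous_at cf e0.
have : nbhs (z : R[i]^o) ((f : R[i]^o -> R[i]^o) @^-1` [set w | normc (w - f z) < e]).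
  by apply: cf; apply/nbhs_normcP; exists e.
by move=> /nbhs_normcP.
Qed.

Lemma ReBR (u v w : R[i]) (r : R) :
  complex.Re (u - v - w * r%:C) = complex.Re u - complex.Re v - complex.Re w * r.
Proof. by case: u v w => [? ?] [? ?] [? ?] /=; ring. Qed.

Lemma ImBR (u w : R[i]) (r : R) :
  complex.Im (u - 'i * w * r%:C) = complex.Im u - complex.Re w * r.
Proof. by case: u w => [? ?] [? ?] /=; ring. Qed.

Section Disc.
Variables (f : R[i] -> R[i]) (a : R[i]) (rho : R).
Hypothesis df : forall z, normc (z - a) < rho -> derivable (f : R[i]^o -> R[i]^o) z 1.

Let Q (t s : R) := complex.Re (f (a + t%:C * ept s)).
Let P (t s : R) := t^-1 * complex.Im (f (a + t%:C * ept s)).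

Lemma f_circle_cts (t : R) : 0 <= t -> t < rho ->
  continuous (fun s => f (a + t%:C * ept s) : R[i]^o).
Proof.
move=> t0 tr s.
apply: (@continuous_comp _ (R[i]^o) (R[i]^o) (fun s => a + t%:C * ept s) f).
  exact: continuous_circle.
by apply: derivable_continuous_at; apply: df; rewrite normc_circle.
Qed.

Lemma Q_cts (t : R) : 0 <= t -> t < rho -> continuous (Q t).
Proof.
move=> t0 tr s.
apply: (@continuous_comp _ (R[i]^o) _ (fun s => f (a + t%:C * ept s))
  (fun z => complex.Re z)); first exact: f_circle_cts.
exact: continuous_Re.
Qed.

Lemma P_cts (t s : R) : 0 < t -> t < rho -> {for t, continuous (P ^~ s)}.
Proof.
move=> t0 tr; apply: cvgM; first by apply: cvgV => //; rewrite gt_eqF.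
apply: (@continuous_comp _ (R[i]^o) _ (fun t : R => a + t%:C * ept s : R[i]^o)
  (fun z => complex.Im (f z))); first exact: continuous_ray.
apply: (@continuous_comp (R[i]^o) (R[i]^o) _ f (fun z => complex.Im z)).
  by apply: derivable_continuous_at; apply: df; rewrite normc_circle// ltW.
exact: continuous_Im.
Qed.

(** In the coordinates z = a + t e^{is} one of the Cauchy-Riemann equations is
dQ/dt = dP/ds; J is the integral of the difference of its two sides over a
rectangle, written with increments so that no continuity of f' is involved. *)
Let J (x1 x2 y1 y2 : R) : R :=
  Iab (fun y => Q x2 y - Q x1 y) y1 y2 - Iab (fun x => P x y2 - P x y1) x1 x2.

Lemma intQ (x y1 y2 : R) : 0 <= x -> x < rho -> intab (Q x) y1 y2.
Proof. by move=> x0 xr; apply: intab_continuous; exact: Q_cts. Qed.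

Lemma intP (x1 x2 y : R) : 0 < x1 -> x2 < rho -> intab (P ^~ y) x1 x2.
Proof.
move=> x0 xr; apply: intab_cont; apply: continuous_in_subspaceT => x.
by rewrite inE /= in_itv /= => /andP[? ?]; apply: P_cts; lra.
Qed.

(** Along circles and rays through the rectangle f is, up to a small multiple of
the size, the affine map with slope f'(z0), for which the two parts of J cancel
to first order. *)
Lemma J_local (b c : R) (x0 y0 : R) : 0 < b -> c < rho -> b <= x0 <= c ->
  forall e : R, 0 < e -> exists2 dl : R, 0 < dl &
    forall x1 x2 y1 y2, b <= x1 -> x1 <= x0 -> x0 <= x2 -> x2 <= c ->
      y1 <= y0 -> y0 <= y2 -> x2 - x1 < dl -> y2 - y1 < dl ->
      `|J x1 x2 y1 y2| <= e * (x2 - x1 + (y2 - y1)) ^+ 2.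
Proof.
move=> b0 cr /andP[bx0 x0c] e e0.
set z0 := a + x0%:C * ept y0.
have [l Hl] : exists l : R[i], forall e : R, 0 < e -> exists2 d : R, 0 < d &
    forall h, normc h < d -> normc (f (z0 + h) - f z0 - l * h) <= e * normc h.
  by apply/derivable_normcP/df; rewrite normc_circle; lra.
pose L := normc l; have L0 : 0 <= L by exact: normc_ge0.
pose K := 1 + 2 * c; have K0 : 0 < K by rewrite /K; lra.
pose M := 2 * K + 2 * K / b + 4 * L + 1.
have Kb : 0 <= K / b by rewrite divr_ge0 ?ltW.
have M0 : 0 < M by rewrite /M -(mulrA 2 K); lra.
pose e1 := e / M; have e10 : 0 < e1 by rewrite divr_gt0.
have [d1 d10 H1] := Hl _ e10.
have [d2 d20 H2] := normc_ept_deriv y0 e10.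
exists (Num.min (d1 / (2 * K)) (Num.min d2 (e1 / 2))).
  by rewrite !lt_min !divr_gt0// ?mulr_gt0//= d20.
move=> x1 x2 y1 y2 bx1 x10 x02 x2c y10 y02.
rewrite !lt_min => /and3P[xd1 xd2 xe] /and3P[yd1 yd2 ye].
set sz := x2 - x1 + (y2 - y1).
have sz0 : 0 <= sz by rewrite /sz; lra.
have szK : K * sz < d1.
  rewrite mulrC -ltr_pdivlMr//; move: xd1 yd1.
  by rewrite invfM mulrA [_ / _ / _]mulrAC /sz; lra.
have sze : sz <= e1 by rewrite /sz; lra.
pose E z := f z - f z0 - l * (z - z0).
have HE x y : x1 <= x -> x <= x2 -> y1 <= y -> y <= y2 ->
    normc (E (a + x%:C * ept y)) <= e1 * (K * sz).
  move=> hx1 hx2 hy1 hy2.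
  have D : normc (a + x%:C * ept y - z0) <= K * sz.
    apply: le_trans (circle_dist _ _ _ _ _) _; first lra.
    have A1 : `|x - x0| <= sz by rewrite ler_norml /sz; lra.
    have A2 : `|y - y0| <= sz by rewrite ler_norml /sz; lra.
    have : x0 * (2 * `|y - y0|) <= c * (2 * sz).
      by apply: ler_pM => //; [lra|rewrite ler_pM2l].
    by rewrite /K; lra.
  have := H1 (a + x%:C * ept y - z0) (le_lt_trans D szK).
  rewrite subrKC => /le_trans; apply.
  by rewrite ler_wpM2l// ltW.
pose k1 := complex.Re (l * ept y0).
have QE y : y1 <= y <= y2 ->
    `|Q x2 y - Q x1 y - k1 * (x2 - x1)| <= (2 * K + 2 * L) * e1 * sz.
  move=> /andP[hy1 hy2].
  have -> : Q x2 y - Q x1 y - k1 * (x2 - x1) =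
     complex.Re (E (a + x2%:C * ept y) - E (a + x1%:C * ept y) +
       l * (x2 - x1)%:C * (ept y - ept y0)).
    rewrite /Q /k1 -ReBR; congr (complex.Re _).
    by rewrite /E !rmorphB /=; ring.
  apply: le_trans (ler_Re_normc _) _; apply: le_trans (normcD _ _) _.
  have -> : (2 * K + 2 * L) * e1 * sz = e1 * (K * sz) + e1 * (K * sz) + L * sz * (2 * e1) by ring.
  apply: lerD.
    by apply: le_trans (normcD _ _) _; rewrite normcN lerD// HE//; lra.
  rewrite !normcM normcR_ge0; last lra.
  rewrite ler_pM//.
  - by rewrite mulr_ge0 ?normc_ge0//; lra.
  - exact: normc_ge0.
  - by rewrite ler_wpM2l//; rewrite /sz; lra.
  - apply: le_trans (normc_ept_dist _ _) _; rewrite ler_pM2l//.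
    by apply: le_trans sze; rewrite ler_norml /sz; lra.
have PE x : x1 <= x <= x2 ->
    `|P x y2 - P x y1 - k1 * (y2 - y1)| <= (2 * (K / b) + 2 * L) * e1 * sz.
  move=> /andP[hx1 hx2].
  have x_gt0 : 0 < x by lra.
  pose D y := ept y - ept y0 - 'i * ept y0 * (y - y0)%:C.
  have HD y : `|y - y0| < d2 -> `|y - y0| <= sz -> normc (D y) <= e1 * sz.
    by move=> /H2 + ys; move=> /le_trans; apply; rewrite ler_pM2l.
  have -> : P x y2 - P x y1 - k1 * (y2 - y1) =
     x^-1 * complex.Im (E (a + x%:C * ept y2) - E (a + x%:C * ept y1)) +
     complex.Im (l * (D y2 - D y1)).
    have -> : E (a + x%:C * ept y2) - E (a + x%:C * ept y1) =
        f (a + x%:C * ept y2) - f (a + x%:C * ept y1) - x%:C * (l * (ept y2 - ept y1)).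
      by rewrite /E; ring.
    have -> : D y2 - D y1 = ept y2 - ept y1 - 'i * ept y0 * (y2 - y1)%:C.
      by rewrite /D !rmorphB /=; ring.
    have -> : l * (ept y2 - ept y1 - 'i * ept y0 * (y2 - y1)%:C) =
       l * (ept y2 - ept y1) - 'i * (l * ept y0) * (y2 - y1)%:C by ring.
    rewrite /P /k1 ImBR; move: (f _) (f _) (l * _) (l * _) => [? ?] [? ?] [? ?] [? ?] /=.
    by field; rewrite gt_eqF.
  apply: le_trans (ler_normD _ _) _.
  have -> : (2 * (K / b) + 2 * L) * e1 * sz = b^-1 * (e1 * (K * sz) + e1 * (K * sz)) + L * (e1 * sz + e1 * sz).
    by ring.
  apply: lerD.
    rewrite normrM ler_pM// ?normr_ge0//.
      by rewrite gtr0_norm ?invr_gt0// lef_pV2 ?posrE//; lra.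
    apply: le_trans (ler_Im_normc _) _.
    by apply: le_trans (normcD _ _) _; rewrite normcN lerD// HE//; lra.
  apply: le_trans (ler_Im_normc _) _; rewrite normcM ler_wpM2l//.
  apply: le_trans (normcD _ _) _; rewrite normcN lerD// HD//.
  - by rewrite ltr_norml; lra.
  - by rewrite ler_norml /sz; lra.
  - by rewrite ltr_norml; lra.
  - by rewrite ler_norml /sz; lra.
have := Iab_near (le_trans y10 y02) _ QE.
have := Iab_near (le_trans x10 x02) _ PE.
rewrite -/(J x1 x2 y1 y2) => HP HQ.
have {}HP := HP (intabB (intP y2 (lt_le_trans b0 bx1) (le_lt_trans x2c cr))
   (intP y1 (lt_le_trans b0 bx1) (le_lt_trans x2c cr))).
have {}HQ : `|Iab (fun y => Q x2 y - Q x1 y) y1 y2 - k1 * (x2 - x1) * (y2 - y1)|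
    <= (2 * K + 2 * L) * e1 * sz * (y2 - y1).
  by apply: HQ; apply: intabB; apply: intQ; lra.
have -> : J x1 x2 y1 y2 =
  (Iab (fun y => Q x2 y - Q x1 y) y1 y2 - k1 * (x2 - x1) * (y2 - y1)) -
  (Iab (fun x => P x y2 - P x y1) x1 x2 - k1 * (y2 - y1) * (x2 - x1)).
  by rewrite /J; ring.
apply: le_trans (ler_normB _ _) _; apply: le_trans (lerD HQ HP) _.
have ee : e = e1 * M by rewrite /e1 divfK// gt_eqF.
have q1 : (2 * K + 2 * L) * e1 * sz * (y2 - y1) <= (2 * K + 2 * L) * e1 * sz * sz.
  apply: ler_wpM2l; last by rewrite /sz; lra.
  apply: mulr_ge0 => //; apply: mulr_ge0; last exact: ltW.
  by lra.
have q2 : (2 * (K / b) + 2 * L) * e1 * sz * (x2 - x1) <= (2 * (K / b) + 2 * L) * e1 * sz * sz.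
  apply: ler_wpM2l; last by rewrite /sz; lra.
  apply: mulr_ge0 => //; apply: mulr_ge0; last exact: ltW.
  by lra.
apply: le_trans (lerD q1 q2) _.
have -> : e * sz ^+ 2 = (2 * K + 2 * L) * e1 * sz * sz + (2 * (K / b) + 2 * L) * e1 * sz * sz + e1 * sz ^+ 2.
  by rewrite ee /M expr2; ring.
by rewrite lerDl mulr_ge0 ?sqr_ge0// ltW.
Qed.

(** Over a full period the P-part of J vanishes, so J = 0 compares the integrals
of Re f over two circles. *)
Lemma circle_integral_cst (t1 t2 : R) : 0 < t1 -> t1 <= t2 -> t2 < rho ->
  Iab (Q t1) 0 (2 * pi) = Iab (Q t2) 0 (2 * pi).
Proof.
move=> t10 t12 t2r; have pp := twopi_gt0 R.
have : J t1 t2 0 (2 * pi) = 0.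
  apply: (@additive_rectangle_eq0 R J t1 t2 0 (2 * pi)) => //.
  - exact: ltW.
  - move=> x1 x2 x3 y1 y2 h1 h2 h3 h4 h5 h6 h7; rewrite /J.
    rewrite (@Iab_split _ _ x1 x2 x3)//; last by apply: intabB; apply: intP; lra.
    rewrite !IabB; try by [apply: intQ; lra|apply: intP; lra].
    by ring.
  - move=> x1 x2 y1 y2 y3 h1 h2 h3 h4 h5 h6 h7; rewrite /J.
    rewrite (@Iab_split _ (fun y => Q x2 y - Q x1 y) y1 y2 y3)//; last first.
      by apply: intabB; apply: intQ; lra.
    rewrite !IabB; try by [apply: intQ; lra|apply: intP; lra].
    by ring.
  - move=> x0 y0 hx0 hy0 e e0; have [dl dl0 H] := J_local y0 t10 t2r hx0 e0.
    by exists dl => // x1 x2 y1 y2 *; apply: H.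
rewrite /J [X in _ - X](_ : _ = 0); last first.
  rewrite (eq_Iab (g2 := fun=> 0)) ?Iab_cst ?mul0r//.
  by move=> x _; rewrite /P ept2pi subrr.
rewrite subr0 IabB; [|apply: intQ; lra..].
by move=> /eqP; rewrite subr_eq0 => /eqP.
Qed.

(** The circle mean does not depend on the radius, and it tends to the value at
the centre as the radius tends to 0. *)
Lemma mean_value_Re (t : R) : 0 <= t -> t < rho ->
  cmean (fun s => complex.Re (f (a + t%:C * ept s))) = complex.Re (f a).
Proof.
move=> t0 tr; have pp := twopi_gt0 R.
suff H : Iab (Q t) 0 (2 * pi) = complex.Re (f a) * (2 * pi).
  by rewrite /cmean -/(Q t) H mulrCA mulVf ?mulr1// gt_eqF.
move: t0; rewrite le_eqVlt => /predU1P[<-|t0].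
  rewrite (eq_Iab (g2 := fun=> complex.Re (f a))) ?Iab_cst ?subr0 ?ltW//.
  by move=> s _; rewrite /Q mul0r addr0.
apply/eqP; rewrite -subr_eq0 -normr_le0; apply/ler_addgt0Pr => e e0; rewrite add0r.
have ep0 : 0 < e / (2 * pi) by rewrite divr_gt0.
have [|d d0 dH] := derivable_dist (f := f) (z := a) _ ep0.
  by apply: df; rewrite subrr normc0; lra.
pose t1 := Num.min t (d / 2).
have t10 : 0 < t1 by rewrite lt_min t0 divr_gt0.
have t1t : t1 <= t by rewrite ge_min lexx.
rewrite -(circle_integral_cst t10 t1t tr).
have t1r := le_lt_trans t1t tr.
have := @Iab_near _ (Q t1) 0 (2 * pi) (complex.Re (f a)) (e / (2 * pi)).
rewrite subr0 divfK ?gt_eqF//; apply; [exact: ltW|apply: intQ; lra|].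
move=> s _; rewrite /Q.
have := dH (a + t1%:C * ept s); rewrite normc_circle; last lra.
have t1d : t1 < d by rewrite gt_min [X in _ || X]ltr_pdivrMr// ltr_pMr// ltr1n orbT.
move=> /(_ t1d)/ltW; apply: le_trans; apply: le_trans (ler_Re_normc _).
by case: (f _) => ? ?; case: (f a).
Qed.

End Disc.
End MeanValue.

(** * Circle means and the maximum principle *)

Section CircleMean.
Variable R : realType.
Implicit Types g : R -> R.

Definition cint g := intab g 0 (2 * pi).

Lemma cint_continuous g : continuous g -> cint g.
Proof. exact: intab_continuous. Qed.

Lemma cmeanD g1 g2 : cint g1 -> cint g2 ->
  cmean (fun t => g1 t + g2 t) = cmean g1 + cmean g2.
Proof. by move=> i1 i2; rewrite /cmean IabD// mulrDr. Qed.

Lemma cmeanB g1 g2 : cint g1 -> cint g2 ->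
  cmean (fun t => g1 t - g2 t) = cmean g1 - cmean g2.
Proof. by move=> i1 i2; rewrite /cmean IabB// mulrBr. Qed.

Lemma cmeanZ k g : cint g -> cmean (fun t => k * g t) = k * cmean g.
Proof. by move=> i1; rewrite /cmean IabZ// mulrCA. Qed.

Lemma cmean_cst k : cmean (fun=> k : R) = k.
Proof.
have pp := twopi_gt0 R.
by rewrite /cmean Iab_cst ?ltW// subr0 mulrCA mulVf ?mulr1// gt_eqF.
Qed.

Lemma le_cmean g1 g2 : cint g1 -> cint g2 -> (forall t, g1 t <= g2 t) ->
  cmean g1 <= cmean g2.
Proof.
move=> i1 i2 H; apply: ler_wpM2l; first by rewrite invr_ge0 ltW// twopi_gt0.
by apply: (le_Iab i1 i2) => t _; exact: H.
Qed.

Lemma eq_cmean g1 g2 : g1 =1 g2 -> cmean g1 = cmean g2.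
Proof. by move=> /funext ->. Qed.

Lemma cint_cst k : cint (fun=> k). Proof. exact: intab_cst. Qed.

Lemma ler_norm_cmean g B : cint g -> (forall t, `|g t| <= B) -> `|cmean g| <= B.
Proof.
move=> ig H; rewrite ler_norml -(cmean_cst (- B)) -{2}(cmean_cst B).
by apply/andP; split; apply: le_cmean => //; try exact: cint_cst;
  move=> t; have := H t; rewrite ler_norml => /andP[].
Qed.

End CircleMean.

Section MaxModulus.
Variable R : realType.
Implicit Types (z w : R[i]) (F : R[i] -> R[i]).

Lemma compact_disc (s : R) : compact ([set z | normc z <= s] : set R[i]^o).
Proof.
pose g (q : R * R) : R[i]^o := q.1 +i* q.2.
have cg : continuous g.
  move=> q; apply: cvg_ReIm; [exact: cvg_fst|exact: cvg_snd].
have cB : compact (g @` (`[- s, s] `*` `[- s, s])).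
  apply: continuous_compact; first exact: continuous_subspaceT.
  by apply: compact_setX; exact: segment_compact.
apply: subclosed_compact cB _.
  have -> : [set z | normc z <= s] = (@normc R : R[i]^o -> R) @^-1` [set x | x <= s] by [].
  by apply: preimage_closed => // z _; exact: continuous_normc.
move=> z zs; exists (complex.Re z, complex.Im z); last by rewrite /g; case: (z).
split; rewrite /= in_itv /=; rewrite -ler_norml.
- exact: le_trans (ler_Re_normc z) zs.
- exact: le_trans (ler_Im_normc z) zs.
Qed.

Lemma sqr_normcB z w : normc (z - w) ^+ 2 =
  normc z ^+ 2 - 2 * complex.Re (conjc w * z) + normc w ^+ 2.
Proof. by rewrite !sqr_normcE; case: z w => [? ?] [? ?] /=; ring. Qed.

(** Adding a small multiple of the strictly subharmonic function |z|^2 to the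
subharmonic function |F|^2 forbids an interior maximum. *)
Lemma maximum_modulus F (rho s M : R) : 0 < s -> s < rho -> 0 <= M ->
  (forall z, normc z < rho -> derivable (F : R[i]^o -> R[i]^o) z 1) ->
  (forall z, normc z = s -> normc (F z) <= M) ->
  forall z, normc z <= s -> normc (F z) <= M.
Proof.
move=> s0 sr M0 dF HM z zs.
rewrite -ler_sqr ?nnegrE ?normc_ge0//; apply/ler_addgt0Pr => e' e'0.
pose e := e' / s ^+ 2; have e0 : 0 < e by rewrite divr_gt0// exprn_gt0.
pose V w := normc (F w) ^+ 2 + e * normc w ^+ 2.
have cF w : normc w <= s -> {for w, continuous (F : R[i]^o -> R[i]^o)}.
  by move=> ws; apply: derivable_continuous_at; apply: dF; exact: le_lt_trans sr.
have cV : {within [set z | normc z <= s] : set R[i]^o, continuous (V : R[i]^o -> R)}.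
  apply: continuous_in_subspaceT => w; rewrite inE /= => ws.
  have -> : V = (fun w => normc (F w) * normc (F w) + e * (normc w * normc w)).
    by apply/funext => v; rewrite /V !expr2.
  have n1 : ctsat (fun w => normc (F w)) w.
    by apply: ctsat_circ; [exact: cF|exact: ctsat_normc].
  have n2 : ctsat (@normc R) w by exact: ctsat_normc.
  have H := ctsatD (ctsatM n1 n1) (ctsatM (@ctsat_cst R e w) (ctsatM n2 n2)).
  exact: H.
have [|z0 z0s z0max] := compact_EVT_max _ (@compact_disc s) cV.
  by exists (0 : R[i]); rewrite /mkset (@normc0 R) ltW.
move: z0s; rewrite inE /= => z0s.
have {}z0max w : normc w <= s -> V w <= V z0 by move=> ws; apply: z0max; rewrite inE.
apply: (@le_trans _ _ (V z0)).
  by apply: le_trans (z0max z zs); rewrite /V lerDl mulr_ge0 ?sqr_ge0// ltW.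
have [z0s'|z0s'] := eqVneq (normc z0) s.
  rewrite /V z0s' /e divfK ?lerD2r ?expf_neq0 ?gt_eqF//.
  by rewrite ler_sqr ?nnegrE ?normc_ge0// HM.
exfalso.
have lt_z0s : normc z0 < s by rewrite lt_neqAle z0s'.
pose d := (s - normc z0) / 2; have d0 : 0 < d by rewrite divr_gt0// subr_gt0.
have ball_s w : normc (w - z0) < s - normc z0 -> normc w < s.
  move=> wz; rewrite -(subrK z0 w) (le_lt_trans (normcD _ _))//; lra.
have dFG c w : normc (w - z0) < s - normc z0 ->
    derivable ((fun w => c * F w) : R[i]^o -> R[i]^o) w 1.
  move=> /ball_s ws; exact: (cderM (@cder_cst R c w) (dF w (lt_trans ws sr))).
have dw c w : derivable ((fun w => c * w) : R[i]^o -> R[i]^o) w 1.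
  exact: (cderM (@cder_cst R c w) (@cder_id R w)).
have dsm : d < s - normc z0 by rewrite /d; lra.
have m1 := mean_value_Re (dFG (conjc (F z0))) (ltW d0) dsm.
have m2 := mean_value_Re (fun w _ => dw (conjc z0) w) (ltW d0) dsm.
pose h1 t := complex.Re (conjc (F z0) * F (z0 + d%:C * ept t)).
pose h2 t := complex.Re (conjc z0 * (z0 + d%:C * ept t)).
have i1 : cint h1 by apply: cint_continuous; exact: (Q_cts (dFG (conjc (F z0))) (ltW d0) dsm).
have i2 : cint h2 by apply: cint_continuous; exact: (Q_cts (fun w _ => dw (conjc z0) w) (ltW d0) dsm).
(* By 2 Re (conj b * a) = |a|^2 + |b|^2 - |a - b|^2, applied to F and to the
   identity, lo stays below 2 V(z0) - e d^2, whereas its circle mean is 2 V(z0). *)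
pose lo t := 2 * h1 t + (2 * e) * h2 t.
have ilo : cint lo by apply: intabD; exact: intabZ.
have lo_le t : lo t <= V z0 + normc (F z0) ^+ 2 + e * (normc z0 ^+ 2 - d ^+ 2).
  have wz : normc (z0 + d%:C * ept t) <= s.
    by apply/ltW/ball_s; rewrite normc_circle// ltW.
  have := z0max _ wz; rewrite {1}/V.
  have q1 := sqr_ge0 (normc (F (z0 + d%:C * ept t) - F z0)).
  have q2 : normc (z0 + d%:C * ept t - z0) ^+ 2 = d ^+ 2 by rewrite normc_circle// ltW.
  move: q1 q2; rewrite !sqr_normcB -/(h1 t) -/(h2 t) => q1 q2 q3.
  have : e * (normc (z0 + d%:C * ept t) ^+ 2 - 2 * h2 t + normc z0 ^+ 2) = e * d ^+ 2 by rewrite q2.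
  by rewrite /lo; lra.
have := le_cmean ilo (cint_cst _) lo_le.
rewrite cmean_cst /lo cmeanD; [|exact: intabZ..].
rewrite !cmeanZ// m1 m2.
have sq w : complex.Re (conjc w * w) = normc w ^+ 2.
  by rewrite sqr_normcE; case: w => ? ? /=; ring.
rewrite !sq /V; have : 0 < e * d ^+ 2 by rewrite mulr_gt0// exprn_gt0.
lra.
Qed.

End MaxModulus.

(** * Exponential, Poisson and Herglotz integrals *)

Section ComplexExponential.
Variable R : realType.
Implicit Types (z w h : R[i]).

Definition cexp z : R[i] := (expR (complex.Re z))%:C * ept (complex.Im z).

Lemma normc_cexp z : normc (cexp z) = expR (complex.Re z).
Proof. by rewrite /cexp normcM normc_ept mulr1 normcR ger0_norm// expR_ge0. Qed.

Lemma eptD (x y : R) : ept (x + y) = ept x * ept y.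
Proof. by rewrite /ept sinD cosD; simpc; congr (_ +i* _); rewrite addrC mulrC [X in _ + X]mulrC. Qed.

Lemma cexpD z w : cexp (z + w) = cexp z * cexp w.
Proof.
rewrite /cexp; case: z w => [a b] [c d] /=.
by rewrite expRD eptD rmorphM /=; ring.
Qed.

Lemma derivable_cexp z : derivable (cexp : R[i]^o -> R[i]^o) z 1.
Proof.
apply/derivable_normcP; exists (cexp z) => e e0.
pose C := normc (cexp z) + 1.
have C0 : 0 < C by rewrite ltr_wpDl// normc_ge0.
pose e1 := Num.min 1 (e / C / 5); have e10 : 0 < e1 by rewrite lt_min ltr01 !divr_gt0.
have e11 : e1 <= 1 by rewrite ge_min lexx.
have [d1 d10 H1] := is_derive_dist (is_derive_expR 0) e10.
have [d2 d20 H2] := normc_ept_deriv 0 e10.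
exists (Num.min (e1 / 2) (Num.min d1 d2)).
  by rewrite !lt_min d10 d20 divr_gt0.
move=> h; rewrite !lt_min => /and3P[he h1 h2].
have hx := ler_Re_normc h; have hy := ler_Im_normc h.
pose x := complex.Re h; pose y := complex.Im h.
have -> : cexp (z + h) - cexp z - cexp z * h = cexp z * (cexp h - 1 - h).
  by rewrite cexpD; ring.
have hE : h = x%:C + 'i * y%:C by rewrite /x /y; exact: complexE.
have {}H1 : `|expR x - 1 - x| <= e1 * `|x|.
  have := H1 x; rewrite subr0 => /(_ (le_lt_trans hx h1)).
  by rewrite expR0 mul1r.
have {}H2 : normc (ept y - 1 - 'i * y%:C) <= e1 * `|y|.
  have := H2 y; rewrite subr0 => /(_ (le_lt_trans hy h2)).
  by rewrite /ept cos0 sin0 mulr1.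
have H3 : `|expR x - 1| <= 2 * `|x|.
  rewrite -(subrK x (expR x - 1)) (le_trans (ler_normD _ _))//.
  have : e1 * `|x| <= `|x| by rewrite ler_piMl.
  lra.
have H4 : expR x <= 3.
  have := ler_norm (expR x - 1); have : `|x| <= 1 by apply: le_trans hx _; lra.
  lra.
have E : cexp h - 1 - h = (expR x)%:C * (ept y - 1 - 'i * y%:C) +
    ((expR x - 1 - x)%:C + 'i * y%:C * (expR x - 1)%:C).
  have -> : cexp h - 1 - h = cexp h - 1 - (x%:C + 'i * y%:C) by rewrite -hE.
  by rewrite /cexp -/x -/y !rmorphB /=; ring.
rewrite normcM.
have B : normc (cexp h - 1 - h) <= 5 * e1 * normc h.
  rewrite E; apply: le_trans (normcD _ _) _.
  have -> : 5 * e1 * normc h = 3 * (e1 * normc h) + (e1 * normc h + e1 * normc h) by ring.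
  apply: lerD.
    rewrite normcM normcR ger0_norm ?expR_ge0// ler_pM ?expR_ge0 ?normc_ge0//.
    by apply: le_trans H2 _; rewrite ler_pM2l.
  apply: le_trans (normcD _ _) _; apply: lerD.
    by rewrite normcR; apply: le_trans H1 _; rewrite ler_pM2l.
  rewrite !normcM !normcR (_ : normc 'i = 1); last by rewrite /= expr0n expr1n add0r sqrtr1.
  rewrite mul1r mulrC ler_pM//; apply: le_trans H3 _.
  by rewrite -/x in hx; lra.
have : normc (cexp z) * normc (cexp h - 1 - h) <= C * (5 * e1 * normc h).
  by rewrite ler_pM ?normc_ge0// /C lerDl.
move=> /le_trans; apply; rewrite mulrA ler_wpM2r ?normc_ge0//.
rewrite mulrCA mulrA -ler_pdivlMl ?mulr_gt0//.
have : e1 <= e / C / 5 by rewrite ge_min lexx orbT.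
by rewrite invfM => /le_trans; apply; rewrite [_ * e]mulrC mulrA mulrAC.
Qed.

End ComplexExponential.

Section PoissonKernel.
Variable R : realType.
Implicit Types (x z w : R[i]).

(** The Cayley transform maps the unit disc onto the right half-plane, and its
real part pk is the Poisson kernel: at x = z e^{-it} it is the density at e^{it}
of the harmonic measure of z. *)
Definition cayley x : R[i] := (1 + x) / (1 - x).

Definition pk x : R := complex.Re (cayley x).

Lemma subr1_neq0 x : normc x < 1 -> 1 - x != 0.
Proof.
move=> x1; rewrite subr_eq0; apply/eqP => E; move: x1; rewrite -E.
by rewrite (@normc1 R) ltxx.
Qed.

Lemma pkE x : normc x < 1 -> pk x = (1 - normc x ^+ 2) / normc (1 - x) ^+ 2.
Proof.
move=> /subr1_neq0 nz.
have H : normc (1 - x) ^+ 2 != 0 by rewrite expf_neq0// normc_eq0.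
move: H; clear nz; rewrite !sqr_normcE /pk /cayley; case: x => a b /=; rewrite !sub0r => H.
by field.
Qed.

Lemma ler1B_normc x : 1 - normc x <= normc (1 - x).
Proof.
have := normcD (1 - x) x; rewrite subrK (@normc1 R); lra.
Qed.

Lemma ler1D_normc x : normc (1 - x) <= 1 + normc x.
Proof. by have := normcD 1 (- x); rewrite normcN (@normc1 R). Qed.

Lemma pk_ge x : normc x < 1 -> (1 - normc x) / (1 + normc x) <= pk x.
Proof.
move=> x1; have x0 := normc_ge0 x; rewrite pkE//.
have H1 := ler1B_normc x; have H2 := ler1D_normc x.
have n0 : 0 < normc (1 - x) by lra.
rewrite ler_pdivrMr; last by lra.
rewrite mulrAC ler_pdivlMr ?exprn_gt0//.
have : normc (1 - x) ^+ 2 <= (1 + normc x) ^+ 2 by rewrite ler_sqr ?nnegrE; lra.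
move: (normc (1 - x) ^+ 2) => S HS.
rewrite (_ : (1 - normc x ^+ 2) * _ = (1 - normc x) * (1 + normc x) ^+ 2); last by ring.
by rewrite ler_pM2l// subr_gt0.
Qed.

Lemma pk_ge0 x : normc x < 1 -> 0 <= pk x.
Proof.
move=> x1; apply: le_trans (pk_ge x1); have x0 := normc_ge0 x.
by rewrite divr_ge0//; lra.
Qed.

Lemma pk_far x (eta : R) : normc x < 1 -> 0 < eta -> eta <= normc (1 - x) ->
  pk x <= (1 - normc x ^+ 2) / eta ^+ 2.
Proof.
move=> x1 e0 ex; have x0 := normc_ge0 x; rewrite pkE//.
rewrite ler_wpM2l//.
  by rewrite subr_ge0 expr_le1// ltW.
rewrite lef_pV2 ?posrE ?exprn_gt0//; last exact: lt_le_trans ex.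
by rewrite ler_sqr ?nnegrE// ?normc_ge0// ltW.
Qed.

Lemma pk_le x : normc x < 1 -> pk x <= (1 + normc x) / (1 - normc x).
Proof.
move=> x1; have x0 := normc_ge0 x.
apply: le_trans (pk_far x1 _ (ler1B_normc x)) _; first lra.
rewrite (_ : 1 - normc x ^+ 2 = (1 - normc x) * (1 + normc x)); last by ring.
by rewrite le_eqVlt; apply/orP; left; apply/eqP; field; lra.
Qed.

Lemma cayleyJ x : cayley (conjc x) = conjc (cayley x).
Proof.
have H1 y : conjc (1 + y) = 1 + conjc y :> R[i].
  rewrite (rmorphD (@conjc R)); congr (_ + _).
  by apply/eqP; rewrite eq_complex /= oppr0 !eqxx.
by rewrite /cayley rmorphM /= conjc_inv !H1 rmorphN.
Qed.

Lemma pkJ x : pk (conjc x) = pk x.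
Proof. by rewrite /pk cayleyJ; case: (cayley x). Qed.

Lemma derivable_cayley (F : R[i] -> R[i]) z : normc (F z) < 1 ->
  derivable (F : R[i]^o -> R[i]^o) z 1 ->
  derivable ((fun z => cayley (F z)) : R[i]^o -> R[i]^o) z 1.
Proof.
move=> F1 dF; have c1 := @cder_cst R 1 z.
rewrite /cayley.
exact: (@cderM R (fun w => 1 + F w) (fun w => (1 - F w)^-1) z (cderD c1 dF)
  (@cderV R (fun w => 1 - F w) z (subr1_neq0 F1) (cderB c1 dF))).
Qed.

Lemma pk_mean (F : R[i] -> R[i]) (a : R[i]) (rho t : R) : 0 <= t -> t < rho ->
  (forall z, normc (z - a) < rho ->
     derivable (F : R[i]^o -> R[i]^o) z 1 /\ normc (F z) < 1) ->
  cmean (fun s => pk (F (a + t%:C * ept s))) = pk (F a).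
Proof.
move=> t0 tr H; apply: (@mean_value_Re R (fun z => cayley (F z)) a rho) => // z /H[dF F1].
exact: derivable_cayley.
Qed.

(** [unrot r t * w] is w / (r e^{it}), so that [pk (unrot r t * w)] is the
Poisson kernel of the circle of radius r. *)
Definition unrot (r t : R) : R[i] := (r^-1)%:C * ept (- t).

Lemma normc_unrot (r t : R) : 0 < r -> normc (unrot r t) = r^-1.
Proof. by move=> r0; rewrite normcM normc_ept mulr1 normcR_ge0// invr_ge0 ltW. Qed.

Lemma normc_unrotM (r t : R) w : 0 < r -> normc (unrot r t * w) = normc w / r.
Proof. by move=> r0; rewrite normcM normc_unrot// mulrC. Qed.

Lemma unrotM_lt1 (r t : R) w : 0 < r -> normc w < r -> normc (unrot r t * w) < 1.
Proof. by move=> r0 wr; rewrite normc_unrotM// ltr_pdivrMr// mul1r. Qed.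

Lemma unrotK (r t : R) : 0 < r -> unrot r t * (r%:C * ept t) = 1.
Proof.
move=> r0; rewrite /unrot mulrACA -rmorphM /= mulVf ?gt_eqF// mul1r -eptD addNr.
by rewrite /ept cos0 sin0.
Qed.

Lemma ccat_unrot (r t : R) : ccat (unrot r) t.
Proof.
apply: ccatM; first exact: ccat_cst.
apply: ccat_ReIm => /=.
  have -> : (fun s : R => cos (- s)) = cos by apply/funext => s; rewrite cosN.
  exact: continuous_cos.
have -> : (fun s : R => sin (- s)) = (fun s => - sin s) by apply/funext => s; rewrite sinN.
exact: (cvgN (@continuous_sin R t)).
Qed.

Lemma ccat_subr1_unrot (r : R) w t : ccat (fun t => 1 - unrot r t * w) t.
Proof. exact: (ccatB (@ccat_cst R 1 t) (ccatM (@ccat_unrot r t) (@ccat_cst R w t))). Qed.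

Lemma ccat_cayley_unrot (r : R) w t : 0 < r -> normc w < r ->
  ccat (fun t => cayley (unrot r t * w)) t.
Proof.
move=> r0 wr; rewrite /cayley.
exact: (@ccatM R (fun t => 1 + unrot r t * w) (fun t => (1 - unrot r t * w)^-1) t
  (ccatD (@ccat_cst R 1 t) (ccatM (@ccat_unrot r t) (@ccat_cst R w t)))
  (ccatV (subr1_neq0 (unrotM_lt1 t r0 wr)) (@ccat_subr1_unrot r w t))).
Qed.

Lemma continuous_pk_unrot (r : R) w : 0 < r -> normc w < r ->
  continuous (fun t => pk (unrot r t * w)).
Proof.
by move=> r0 wr t; exact: (ccat_Re (@ccat_cayley_unrot r w t r0 wr)).
Qed.

Definition poisson (r : R) (u : R -> R) w : R :=
  cmean (fun t => pk (unrot r t * w) * u t).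

Lemma cint_poisson (r : R) (u : R -> R) w : 0 < r -> normc w < r ->
  continuous u -> cint (fun t => pk (unrot r t * w) * u t).
Proof.
move=> r0 wr cu; apply: cint_continuous => t.
by apply: cvgM; [exact: continuous_pk_unrot|exact: cu].
Qed.

(** The kernel at w, as a function of the point of the circle, is itself of the
form pk o F with F(0) = 0, so its mean is pk 0 = 1. *)
Lemma cmean_pk (r : R) w : 0 < r -> normc w < r ->
  cmean (fun t => pk (unrot r t * w)) = 1.
Proof.
move=> r0 wr; pose c : R[i] := (r^-1)%:C * conjc w.
have c1 : normc c < 1.
  by rewrite normcM normcJ normcR_ge0 ?invr_ge0 ?ltW// mulrC ltr_pdivrMr// mul1r.
have c0 := normc_ge0 c.
have -> : (fun t => pk (unrot r t * w)) = (fun s => pk (c * (0 + 1%:C * ept s))).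
  apply/funext => t; rewrite -pkJ; congr pk.
  have cM x y : conjc (x * y) = conjc x * conjc y :> R[i] by exact: rmorphM.
  rewrite /unrot /c add0r mul1r !cM (conjc_real (r^-1)).
  have -> : conjc (ept (- t)) = ept t by rewrite /ept cosN sinN /= opprK.
  by rewrite mulrAC.
rewrite (@pk_mean (fun z => c * z) 0 (2 / (1 + normc c)) 1)//.
- by rewrite /pk /cayley mulr0 addr0 subr0 divr1.
- by rewrite ltr_pdivlMr; lra.
- move=> z; rewrite subr0 => zr; split.
    exact: (cderM (@cder_cst R c z) (@cder_id R z)).
  rewrite normcM; apply: (@le_lt_trans _ _ (normc c * (2 / (1 + normc c)))).
    by rewrite ler_wpM2l// ltW.
  by rewrite mulrA ltr_pdivrMr; lra.
Qed.

Lemma poisson_cst (r k : R) w : 0 < r -> normc w < r -> poisson r (fun=> k) w = k.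
Proof.
move=> r0 wr; rewrite /poisson; under eq_cmean do rewrite mulrC.
rewrite cmeanZ ?cmean_pk ?mulr1//.
by apply: cint_continuous; exact: continuous_pk_unrot.
Qed.

Lemma poissonB (r : R) u v w : 0 < r -> normc w < r -> continuous u -> continuous v ->
  poisson r (fun t => u t - v t) w = poisson r u w - poisson r v w.
Proof.
move=> r0 wr cu cv; rewrite /poisson -cmeanB; [|exact: cint_poisson..].
by under eq_cmean do rewrite mulrBr.
Qed.

Lemma le_poisson (r : R) u v w : 0 < r -> normc w < r -> continuous u -> continuous v ->
  (forall t, u t <= v t) -> poisson r u w <= poisson r v w.
Proof.
move=> r0 wr cu cv uv; apply: le_cmean; [exact: cint_poisson..|].
by move=> t; rewrite ler_wpM2l// pk_ge0//; exact: unrotM_lt1.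
Qed.

(** The kernel has mean 1, and pk_far bounds it on the part of the circle where
only the bound B is available. *)
Lemma poisson_near (r : R) u w (delta eta B : R) : 0 < r -> normc w < r ->
  0 < eta -> 0 <= delta -> 0 <= B -> continuous u ->
  (forall t, normc (1 - unrot r t * w) < eta -> u t <= delta) ->
  (forall t, u t <= B) ->
  poisson r u w <= delta + B * ((1 - (normc w / r) ^+ 2) / eta ^+ 2).
Proof.
move=> r0 wr e0 d0 B0 cu Hn Hb.
set c : R := (1 - (normc w / r) ^+ 2) / eta ^+ 2.
have c0 : 0 <= c.
  apply: divr_ge0; last exact: sqr_ge0.
  rewrite subr_ge0 expr_le1//; first by rewrite ler_pdivrMr// mul1r ltW.
  by rewrite divr_ge0 ?normc_ge0// ltW.
have cpk : cint (fun t => pk (unrot r t * w)).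
  by apply: cint_continuous; exact: continuous_pk_unrot.
have -> : delta + B * c = cmean (fun t => delta * pk (unrot r t * w) + B * c).
  rewrite cmeanD; [|exact: intabZ|exact: cint_cst].
  by rewrite cmeanZ// cmean_pk// mulr1 cmean_cst.
apply: le_cmean; first exact: cint_poisson.
  by apply: intabD; [exact: intabZ|exact: cint_cst].
move=> t; have x1 := unrotM_lt1 t r0 wr; have p0 := pk_ge0 x1.
have [nt|ft] := ltP (normc (1 - unrot r t * w)) eta.
  apply: (@le_trans _ _ (delta * pk (unrot r t * w))).
    by rewrite mulrC ler_wpM2r// Hn.
  by rewrite lerDl mulr_ge0.
apply: (@le_trans _ _ (B * c)); last by rewrite lerDr mulr_ge0.
rewrite mulrC; apply: (@le_trans _ _ (B * pk (unrot r t * w))).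
  by rewrite ler_wpM2r.
by rewrite ler_wpM2l// /c -(normc_unrotM t)// pk_far.
Qed.

End PoissonKernel.

Section ComplexMean.
Variable R : realType.
Implicit Types (g : R -> R[i]) (c : R[i]).

Definition Cmean g : R[i] :=
  cmean (fun t => complex.Re (g t)) +i* cmean (fun t => complex.Im (g t)).

Definition Cint g := cint (fun t => complex.Re (g t)) /\ cint (fun t => complex.Im (g t)).

Lemma Cint_ccat g : (forall t, ccat g t) -> Cint g.
Proof.
move=> cg; split; apply: cint_continuous => t.
- exact: (ccat_Re (cg t)).
- exact: (ccat_Im (cg t)).
Qed.

Lemma CmeanB g1 g2 : Cint g1 -> Cint g2 ->
  Cmean (fun t => g1 t - g2 t) = Cmean g1 - Cmean g2.
Proof.
move=> [r1 i1] [r2 i2]; rewrite /Cmean; simpc; rewrite -!cmeanB//.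
by congr (_ +i* _); apply: eq_cmean => t; case: (g1 t) (g2 t) => ? ? [].
Qed.

Lemma CmeanZ g c : Cint g -> Cmean (fun t => c * g t) = c * Cmean g.
Proof.
move=> [r1 i1]; case: c => a b; rewrite /Cmean.
have -> : (fun t => complex.Re ((a +i* b) * g t)) =
    (fun t => a * complex.Re (g t) - b * complex.Im (g t)).
  by apply/funext => t; case: (g t).
have -> : (fun t => complex.Im ((a +i* b) * g t)) =
    (fun t => a * complex.Im (g t) + b * complex.Re (g t)).
  by apply/funext => t; case: (g t).
by rewrite cmeanB ?cmeanD ?cmeanZ//; exact: intabZ.
Qed.

Lemma normc_Cmean_le g (B : R) : Cint g -> (forall t, normc (g t) <= B) ->
  normc (Cmean g) <= 2 * B.
Proof.
move=> [r1 i1] H; apply: le_trans (normc_le_ReIm _) _.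
rewrite mulr2n mulrDl mul1r lerD//=.
- by apply: ler_norm_cmean => // t; exact: le_trans (ler_Re_normc _) (H t).
- by apply: ler_norm_cmean => // t; exact: le_trans (ler_Im_normc _) (H t).
Qed.

(** The Herglotz integral of u: an analytic function in the disc of radius r
whose real part is the Poisson integral of u. *)
Definition herglotz (r : R) (u : R -> R) (z : R[i]) : R[i] :=
  Cmean (fun t => cayley (unrot r t * z) * (u t)%:C).

Lemma Re_herglotz r u z : complex.Re (herglotz r u z) = poisson r u z.
Proof.
rewrite /herglotz /poisson /=; apply: eq_cmean => t.
by rewrite /pk; case: (cayley _) => ? ? /=; ring.
Qed.

Lemma cayley_expansion (x y : R[i]) : 1 - x != 0 -> 1 - x - y != 0 ->
  cayley (x + y) - cayley x - y * (2 / (1 - x) ^+ 2) =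
  2 * y ^+ 2 / ((1 - x) ^+ 2 * (1 - x - y)).
Proof.
move=> x1 xy1; rewrite /cayley opprD addrA; field.
by rewrite x1 xy1.
Qed.

(** Differentiation under the integral sign: by cayley_expansion the kernel
differs from its first-order expansion by O(|h|^2), uniformly on the circle. *)
Lemma derivable_herglotz (r B : R) (u : R -> R) z : 0 < r -> normc z < r ->
  continuous u -> (forall t, `|u t| <= B) ->
  derivable (herglotz r u : R[i]^o -> R[i]^o) z 1.
Proof.
move=> r0 zr cu uB.
have B0 : 0 <= B by apply: le_trans (uB 0).
pose L := Cmean (fun t => unrot r t * (2 / (1 - unrot r t * z) ^+ 2) * (u t)%:C).
pose d := 1 - normc z / r.
have d0 : 0 < d by rewrite subr_gt0 ltr_pdivrMr// mul1r.
pose C := 2 * (2 * (r^-1) ^+ 2 / (d ^+ 2 * (d / 2)) * B) + 1.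
have C0 : 0 < C.
  apply: ltr_wpDl => //; apply: mulr_ge0 => //; apply: mulr_ge0 => //; apply: divr_ge0.
    by apply: mulr_ge0 => //; exact: sqr_ge0.
  by apply: mulr_ge0; [exact: sqr_ge0|rewrite divr_ge0// ltW].
apply/derivable_normcP; exists L => e e0.
exists (Num.min (r * d / 2) (e / C)).
  by rewrite lt_min !divr_gt0// mulr_gt0.
move=> h; rewrite lt_min => /andP[hd he].
have hr : normc h / r < d / 2 by rewrite ltr_pdivrMr// mulrAC [d * _]mulrC.
have zhr : normc (z + h) < r.
  have rd : r * d = r - normc z.
    by rewrite /d mulrBr mulr1 mulrCA mulfV ?gt_eqF// mulr1.
  have := normcD z h; have := mulr_gt0 r0 d0; move: hd; rewrite rd.
  by move: zr; clear; lra.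
have x1 w t : normc w < r -> 1 - unrot r t * w != 0.
  by move=> wr; apply: subr1_neq0; exact: unrotM_lt1.
have cu' t : ccat (fun t => (u t)%:C) t by exact: (ccat_real (cu t)).
pose K w t := cayley (unrot r t * w) * (u t)%:C.
have cK w : normc w < r -> Cint (K w).
  by move=> wr; apply: Cint_ccat => t; exact: (ccatM (@ccat_cayley_unrot R r w t r0 wr) (cu' t)).
pose l t := unrot r t * (2 / (1 - unrot r t * z) ^+ 2) * (u t)%:C.
have cl t : ccat l t.
  have c1 := @ccat_subr1_unrot R r z t.
  have lE : l = fun t => unrot r t * (2 * ((1 - unrot r t * z) * (1 - unrot r t * z))^-1) * (u t)%:C.
    by apply/funext => s; rewrite /l expr2.
  have nz : (1 - unrot r t * z) * (1 - unrot r t * z) != 0 by rewrite mulf_neq0// x1.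
  rewrite lE.
  exact: (ccatM (ccatM (@ccat_unrot R r t) (ccatM (@ccat_cst R 2 t) (ccatV nz (ccatM c1 c1)))) (cu' t)).
pose D t := K (z + h) t - K z t - h * l t.
have DE t : D t = 2 * (unrot r t * h) ^+ 2 /
    ((1 - unrot r t * z) ^+ 2 * (1 - unrot r t * z - unrot r t * h)) * (u t)%:C.
  rewrite -cayley_expansion.
  - by rewrite /D /K /l mulrDr; ring.
  - exact: x1.
  - by rewrite -addrA -opprD -mulrDr; exact: x1.
have ihl : Cint (fun t => h * l t).
  by apply: Cint_ccat => t; exact: (ccatM (@ccat_cst R h t) (cl t)).
have iKK : Cint (fun t => K (z + h) t - K z t).
  have [a1 a2] := cK _ zhr; have [b1 b2] := cK _ zr.
  split.
    have -> : (fun t => complex.Re (K (z + h) t - K z t)) =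
        (fun t => complex.Re (K (z + h) t) - complex.Re (K z t)).
      by apply/funext => t; case: (K (z + h) t) (K z t) => ? ? [].
    exact: intabB.
  have -> : (fun t => complex.Im (K (z + h) t - K z t)) =
      (fun t => complex.Im (K (z + h) t) - complex.Im (K z t)).
    by apply/funext => t; case: (K (z + h) t) (K z t) => ? ? [].
  exact: intabB.
have iD : Cint D.
  have [a1 a2] := iKK; have [b1 b2] := ihl.
  split.
    have -> : (fun t => complex.Re (D t)) =
        (fun t => complex.Re (K (z + h) t - K z t) - complex.Re (h * l t)).
      by apply/funext => t; rewrite /D; case: (K (z + h) t - K z t) (h * l t) => ? ? [].
    exact: intabB.
  have -> : (fun t => complex.Im (D t)) =
      (fun t => complex.Im (K (z + h) t - K z t) - complex.Im (h * l t)).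
    by apply/funext => t; rewrite /D; case: (K (z + h) t - K z t) (h * l t) => ? ? [].
  exact: intabB.
have E : herglotz r u (z + h) - herglotz r u z - L * h = Cmean D.
  rewrite [L * h]mulrC -CmeanZ; last exact: Cint_ccat.
  by rewrite -CmeanB; [rewrite -CmeanB//|exact: cK..].
rewrite E.
apply: le_trans (normc_Cmean_le (B := 2 * (r^-1) ^+ 2 / (d ^+ 2 * (d / 2)) * B * normc h ^+ 2) iD _) _.
  move=> t; rewrite DE normcM normcR.
  have n1 : d <= normc (1 - unrot r t * z).
    by rewrite /d -(normc_unrotM t)// ler1B_normc.
  have n2 : d / 2 <= normc (1 - unrot r t * z - unrot r t * h).
    have := normcD (1 - unrot r t * z - unrot r t * h) (unrot r t * h).
    by rewrite subrK normc_unrotM//; lra.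
  have -> : 2 * (r^-1) ^+ 2 / (d ^+ 2 * (d / 2)) * B * normc h ^+ 2 =
    2 * (r^-1 * normc h) ^+ 2 / (d ^+ 2 * (d / 2)) * B by rewrite exprMn; ring.
  apply: ler_pM => //; rewrite ?normc_ge0//.
  have nx (x : R[i]) : normc (x ^+ 2) = normc x ^+ 2 by rewrite !expr2 normcM.
  have nu : normc (unrot r t * h) = r^-1 * normc h by rewrite normc_unrotM// mulrC.
  rewrite (normcM (2 * _)) (normcM 2) normcV (normcM ((1 - _) ^+ 2)) !nx nu.
  rewrite (_ : normc 2 = 2); last by rewrite -[2 in LHS](rmorph_nat (real_complex R)) normcR ger0_norm.
  apply: ler_wpM2l; first by rewrite mulr_ge0// sqr_ge0.
  rewrite lef_pV2 ?posrE.
  - apply: ler_pM => //; first exact: sqr_ge0; first by rewrite divr_ge0// ltW.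
    by rewrite ler_sqr ?nnegrE ?normc_ge0// ltW.
  - by rewrite mulr_gt0 ?exprn_gt0//; [exact: lt_le_trans n1|apply: lt_le_trans n2; rewrite divr_gt0].
  - by rewrite !mulr_gt0 ?exprn_gt0// divr_gt0.
have hC : C * normc h <= e by rewrite mulrC -ler_pdivlMr// ltW.
apply: (@le_trans _ _ (C * normc h * normc h)); last by rewrite ler_wpM2r ?normc_ge0.
have aux (Y : R) : 2 * (Y * normc h ^+ 2) <= (2 * Y + 1) * normc h * normc h.
  by have := sqr_ge0 (normc h); rewrite !expr2; clear; lra.
exact: aux.
Qed.

End ComplexMean.

(** * Harmonic majorants of log |f| *)

Section Majorization.
Variable R : realType.
Implicit Types (z w : R[i]) (f : R[i] -> R[i]) (U : R[i] -> R).

Lemma uniformly_ctsat U (r : R) : (forall z, normc z <= r -> ctsat U z) ->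
  forall e : R, 0 < e -> exists2 eta : R, 0 < eta & forall z w,
    normc z <= r -> normc w <= r -> normc (z - w) < eta -> `|U z - U w| < e.
Proof.
move=> cU e e0.
have e20 : 0 < e / 2 by rewrite divr_gt0.
have := (compact_near_coveringP _).1 (@compact_disc R r) R (0:R)^'+
  (fun (eta : R) z => forall w, normc w <= r -> normc (z - w) < eta -> `|U z - U w| < e) _.
case.
- move=> z zr; have [d d0 dH] := (ctsatP U z).1 (cU z zr) _ e20.
  have d20 : 0 < d / 2 by rewrite divr_gt0.
  exists ([set w | normc (w - z) < d / 2] : set R[i]^o, [set eta : R | eta < d / 2]) => /=.
    split; first by apply/nbhs_normcP; exists (d / 2).
    exact: nbhs_right_lt.
  move=> [x eta] /= [xz] etad w wr xw.
  rewrite -(subrKA (U z)) (le_lt_trans (ler_normD _ _))// (splitr e) ltrD//.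
    by apply: dH; apply: lt_le_trans xz _; rewrite ler_pdivrMr// ler_peMr ?ler1n// ltW.
  rewrite distrC; apply: dH; rewrite -(subrKA x) (le_lt_trans (normcD _ _))//.
  by rewrite (normcB w); move: xw xz etad; clear; lra.
- move=> eta0 /= eta0p H.
  exists (eta0 / 2); first by rewrite divr_gt0.
  move=> z w zr wr zw; apply: (H (eta0 / 2)) => //.
  - by rewrite /= sub0r normrN gtr0_norm ?divr_gt0// ltr_pdivrMr// ltr_pMr// ltr1n.
  - by rewrite divr_gt0.
Qed.

Lemma bounded_ctsat U (r : R) : 0 <= r -> (forall z, normc z <= r -> ctsat U z) ->
  exists2 B : R, 0 <= B & forall z, normc z <= r -> `|U z| <= B.
Proof.
move=> r0 cU.
have cV : {within [set z | normc z <= r] : set R[i]^o, continuous ((fun z => `|U z|) : R[i]^o -> R)}.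
  apply: continuous_in_subspaceT => w; rewrite inE /= => /cU cw.
  exact: (@ctsat_comp R U Num.norm w cw (@norm_continuous R R (U w))).
have [|c _ cmax] := compact_EVT_max _ (@compact_disc R r) cV.
  by exists (0 : R[i]); rewrite /mkset (@normc0 R).
by exists `|U c| => // z zr; apply: cmax; rewrite inE.
Qed.

Lemma continuous_on_circle U (r : R) : 0 <= r -> (forall z, normc z <= r -> ctsat U z) ->
  continuous (fun t => U (r%:C * ept t)).
Proof.
move=> r0 cU t.
have cp : ccat (fun t => r%:C * ept t) t.
  exact: (ccatM (@ccat_cst R r%:C t) (@continuous_ept R t)).
exact: (@ctsat_path R U (fun t => r%:C * ept t) t cp
  (cU _ (eq_ind_r (fun x => x <= r) (lexx r) (etrans (normcM _ _)
     (etrans (congr1 (fun x => _ * x) (normc_ept t)) (etrans (mulr1 _) (normcR_ge0 r0))))))).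
Qed.

(** On circles close to the boundary the Poisson integral of U is close to U,
so that f e^{-G}, with G the Herglotz integral of U, has modulus almost at most
1 there; the maximum principle extends the bound to the interior. *)
Lemma normc_le_exp_poisson f U (rho r : R) w : 0 < r -> r < rho ->
  (forall z, normc z < rho -> derivable (f : R[i]^o -> R[i]^o) z 1) ->
  (forall z, normc z <= r -> ctsat U z) ->
  (forall z, normc z <= r -> normc (f z) <= expR (U z)) ->
  normc w < r ->
  normc (f w) <= expR (poisson r (fun t => U (r%:C * ept t)) w).
Proof.
move=> r0 rrho df cU fU wr; set u := fun t => U (r%:C * ept t).
have cu : continuous u by apply: continuous_on_circle => //; exact: ltW.
have [B B0 UB] := bounded_ctsat (ltW r0) cU.
have nrept t : normc (r%:C * ept t) = r.
  by rewrite normcM normc_ept mulr1 normcR_ge0// ltW.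
have uB t : `|u t| <= B by apply: UB; rewrite nrept.
have [fw0|fw0] := eqVneq (f w) 0; first by rewrite fw0 normc0 expR_ge0.
have fw_gt0 : 0 < normc (f w) by rewrite normc_gt0.
rewrite -[X in X <= _]lnK ?posrE// ler_expR.
apply/ler_addgt0Pr => delta delta0.
have d20 : 0 < delta / 2 by rewrite divr_gt0.
have [eta eta0 Hu] := uniformly_ctsat cU d20.
pose eta' := eta / r; have eta'0 : 0 < eta' by rewrite divr_gt0.
(* The circle of radius s = r (1 - k) encloses w, and at its points the Poisson
   kernel has mass at most delta / (4 B) at relative distance more than eta'. *)
pose k := Num.min ((1 - normc w / r) / 2) (delta * eta' ^+ 2 / (8 * (B + 1))).
have wr1 : 0 < 1 - normc w / r by rewrite subr_gt0 ltr_pdivrMr// mul1r.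
have B10 : 0 < B + 1 by rewrite ltr_wpDl.
have k0 : 0 < k by rewrite lt_min !divr_gt0// mulr_gt0// exprn_gt0.
have kw : k < 1 - normc w / r.
  by rewrite gt_min; apply/orP; left; rewrite ltr_pdivrMr// ltr_pMr// ltr1n.
have kB : 2 * B * (2 * k) / eta' ^+ 2 <= delta / 2.
  rewrite ler_pdivrMr ?exprn_gt0//.
  have : k * (8 * (B + 1)) <= delta * eta' ^+ 2.
    by rewrite -ler_pdivlMr ?mulr_gt0// /k ge_min lexx orbT.
  by move: k0; clear; move: (eta' ^+ 2) => E; lra.
have w0 : 0 <= normc w / r by rewrite divr_ge0 ?normc_ge0// ltW.
pose s := r * (1 - k).
have k1 : k < 1 by move: kw w0; clear; lra.
have s0 : 0 < s by rewrite mulr_gt0// subr_gt0.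
have sr : s < r by rewrite /s gtr_pMr// ltrBlDr ltrDl.
have ws : normc w <= s.
  rewrite /s mulrC -ler_pdivrMr//; move: kw; clear; lra.
have near_circle z : normc z = s -> U z - poisson r u z <= delta.
  move=> zs; have zr : normc z < r by rewrite zs.
  have -> : U z - poisson r u z = poisson r (fun t => U z - u t) z.
    by rewrite poissonB// ?poisson_cst// => t; exact: cvg_cst.
  apply: (@le_trans _ _ (delta / 2 + 2 * B * ((1 - (normc z / r) ^+ 2) / eta' ^+ 2))).
    apply: poisson_near => //; rewrite ?mulr_ge0// ?ltW//.
    - by move=> t; apply: cvgB; [exact: cvg_cst|exact: cu].
    - move=> t tn; apply: le_trans (ler_norm _) _; apply: ltW; apply: Hu.
      + exact: ltW.
      + by rewrite nrept.
      + have -> : z - r%:C * ept t = - (r%:C * ept t * (1 - unrot r t * z)).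
          by rewrite mulrBr mulr1 mulrA [_ * unrot r t]mulrC unrotK// mul1r opprB.
        by rewrite normcN normcM nrept mulrC -ltr_pdivlMr.
    - move=> t; have := uB t; have := UB z (ltW zr).
      by rewrite !ler_norml => /andP[? ?] /andP[? ?]; lra.
  rewrite [X in _ <= X]splitr lerD2l; apply: le_trans kB; rewrite mulrA.
  rewrite ler_pM2r ?invr_gt0 ?exprn_gt0// ler_wpM2l ?mulr_ge0//.
  rewrite zs /s mulrC mulrA mulVf ?gt_eqF// mul1r sqrrB expr1n mul1r.
  by have := sqr_ge0 k; move: (k ^+ 2) => K; rewrite mulr2n; clear; lra.
pose F z := f z * cexp (- herglotz r u z).
have dF z : normc z < r -> derivable (F : R[i]^o -> R[i]^o) z 1.
  move=> zr; have dh := derivable_herglotz r0 zr cu uB.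
  have dnh := cderM (@cder_cst R (-1) z) dh.
  have ce := derivable_circ dnh (@derivable_cexp R _).
  have -> : F = (fun z => f z * (@cexp R \o (fun w => -1 * herglotz r u w)) z).
    by apply/funext => x; rewrite /F /= mulN1r.
  exact: (cderM (df z (lt_trans zr rrho)) ce).
have nF z : normc (F z) = normc (f z) * expR (- poisson r u z).
  have ReN (x : R[i]) : complex.Re (- x) = - complex.Re x by case: x.
  by rewrite normcM normc_cexp -Re_herglotz ReN.
have := maximum_modulus s0 sr (expR_ge0 delta) dF.
move=> H; have {}H := H _ w ws.
have : normc (F w) <= expR delta.
  apply: H => z zs; rewrite nF; apply: (@le_trans _ _ (expR (U z) * expR (- poisson r u z))).
    by rewrite ler_wpM2r ?expR_ge0// fU// zs ltW.
  by rewrite -expRD ler_expR near_circle.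
rewrite nF -ler_ln ?posrE ?expR_gt0 ?mulr_gt0 ?expR_gt0//.
rewrite lnM ?posrE ?expR_gt0// !expRK.
by rewrite lerBlDr addrC.
Qed.

End Majorization.

(** * Self-maps of the disc and variable-exponent Jensen inequality *)

Section SelfMaps.
Variable R : realType.
Implicit Types (z w : R[i]).

(** Harnack's inequality for the positive harmonic function
1 - Re (c phi), where c is the unit with c phi(z) = |phi(z)|. *)
Lemma self_map_distance (phi : R[i] -> R[i]) z : analytic_on_disc phi ->
  (forall z, disc z -> disc (phi z)) -> normc z < 1 ->
  (1 - normc (phi 0)) / 4 * (1 - normc z) <= 1 - normc (phi z).
Proof.
move=> aphi dphi z1.
have n0 : normc (0 : R[i]) < 1 by rewrite (@normc0 R).
have p01 : normc (phi 0) < 1 by exact: dphi.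
have pz1 : normc (phi z) < 1 by exact: dphi.
have zn := normc_ge0 z; have p0n := normc_ge0 (phi 0).
have [E|pz0] := eqVneq (phi z) 0.
  rewrite E (@normc0 R) subr0; apply: (@le_trans _ _ (1 * 1)); last by rewrite mulr1.
  by rewrite ler_pM//; move: p01 p0n z1 zn; clear; lra.
have npz : 0 < normc (phi z) by rewrite normc_gt0.
pose c : R[i] := conjc (phi z) * ((normc (phi z))^-1)%:C.
have nc : normc c = 1.
  by rewrite normcM normcJ normcR_ge0 ?invr_ge0 ?ltW// mulfV// gt_eqF.
have cphi : complex.Re (c * phi z) = normc (phi z).
  have -> : complex.Re (c * phi z) = normc (phi z) ^+ 2 * (normc (phi z))^-1.
    by rewrite sqr_normcE /c; case: (phi z) => ? ? /=; ring.
  by rewrite expr2 mulfK// gt_eqF.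
pose r := (1 + normc z) / 2.
have r0 : 0 < r by rewrite divr_gt0// ltr_wpDr.
have r1 : r < 1 by rewrite /r; move: z1; clear; lra.
have zr : normc z < r by rewrite /r; move: z1; clear; lra.
(* The harmonic function Re H is nonpositive, and it is the log-modulus of e^H:
   the majorization of e^H is the half of Poisson's formula that is needed. *)
pose H w := c * phi w - 1.
pose f w := cexp (H w).
pose U w := complex.Re (H w).
have dH w : normc w < 1 -> derivable (H : R[i]^o -> R[i]^o) w 1.
  by move=> w1; exact: (cderB (cderM (@cder_cst R c w) (aphi w w1)) (@cder_cst R 1 w)).
have UE w : U w = complex.Re (c * phi w) - 1 by rewrite /U /H; case: (c * phi w).
have Re_le w : complex.Re (c * phi w) <= normc (phi w).
  apply: le_trans (ler_norm _) _; apply: le_trans (ler_Re_normc _) _.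
  by rewrite normcM nc mul1r.
have U_le0 w : normc w < 1 -> U w <= 0.
  move=> w1; rewrite UE subr_le0; apply: le_trans (Re_le w) _.
  by apply: ltW; exact: dphi.
have cU w : normc w <= r -> ctsat U w.
  move=> wr; have ch := derivable_continuous_at (dH w (le_lt_trans wr r1)).
  exact: (ctsat_circ ch (@ctsat_Re R (H w))).
have df w : normc w < 1 -> derivable (f : R[i]^o -> R[i]^o) w 1.
  by move=> w1; exact: (derivable_circ (dH w w1) (@derivable_cexp R (H w))).
have fU w : normc w <= r -> normc (f w) <= expR (U w) by rewrite normc_cexp.
have := normc_le_exp_poisson r0 r1 df cU fU zr.
rewrite normc_cexp ler_expR -/(U z) UE cphi => HP.
pose x := normc z / r.
have x0 : 0 <= x by rewrite divr_ge0// ltW.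
have x1 : x < 1 by rewrite ltr_pdivrMr// mul1r.
have cu := continuous_on_circle (ltW r0) cU.
have nrept t : normc (r%:C * ept t) = r.
  by rewrite normcM normc_ept mulr1 normcR_ge0// ltW.
have HM : cmean (fun t => U (r%:C * ept t)) = U 0.
  have dH0 w : normc (w - 0) < 1 -> derivable (H : R[i]^o -> R[i]^o) w 1.
    by rewrite subr0 => /dH.
  have := mean_value_Re dH0 (ltW r0) r1.
  by under eq_cmean do rewrite add0r.
have : poisson r (fun t => U (r%:C * ept t)) z <= (1 - x) / (1 + x) * U 0.
  rewrite -HM -cmeanZ; last exact: cint_continuous.
  apply: le_cmean.
  - exact: cint_poisson.
  - by apply: intabZ; exact: cint_continuous.
  - move=> t; rewrite mulrC [X in _ <= X]mulrC; apply: ler_wnM2l.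
      by apply: U_le0; rewrite nrept.
    by have := pk_ge (unrotM_lt1 t r0 zr); rewrite normc_unrotM.
move=> H1; have {HP}H2 := le_trans HP H1.
have H3 : U 0 <= normc (phi 0) - 1 by rewrite UE lerD2r.
have H4 : (1 - normc z) / 4 <= (1 - x) / (1 + x).
  have q : 1 - x = (1 - normc z) / 2 / r.
    by rewrite /x /r; field; move: zn; clear; lra.
  rewrite q ler_pdivlMr; last by move: x0; clear; lra.
  rewrite ler_pdivlMr//.
  have : (1 + x) * r <= 2 * 1 by apply: ler_pM; move: x0 x1 r0 r1; clear; lra.
  rewrite -mulrA => h.
  have : (1 - normc z) / 4 * ((1 + x) * r) <= (1 - normc z) / 4 * 2.
    by apply: ler_wpM2l; [move: z1|move: h]; clear; lra.
  by clear; lra.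
have H5 : (1 - x) / (1 + x) * U 0 <= (1 - normc z) / 4 * (normc (phi 0) - 1).
  have h1 : (1 - x) / (1 + x) * U 0 <= (1 - normc z) / 4 * U 0.
    by rewrite mulrC [X in _ <= X]mulrC ler_wnM2l// U_le0.
  apply: le_trans h1 _; apply: ler_wpM2l => //.
  by move: z1; clear; lra.
have -> : (1 - normc (phi 0)) / 4 * (1 - normc z) = - ((1 - normc z) / 4 * (normc (phi 0) - 1)) by ring.
by move: H2 H5; clear; lra.
Qed.

End SelfMaps.

Section Jensen.
Variable R : realType.

Lemma ln_le_tangent (x h : R) : 0 < x -> 0 < h -> ln x <= ln h + x / h.
Proof.
move=> x0 h0; have xh : 0 < x / h by rewrite divr_gt0.
have -> : ln x = ln h + ln (x / h) by rewrite lnM ?posrE ?invr_gt0// lnV ?posrE// subrKC.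
by rewrite lerD2l ltW// ln_sublinear.
Qed.

(** The tangent line of the logarithm at h: this is where Jensen's inequality is
used, in a form that tolerates the varying factor q. *)
Lemma weighted_ln_le (q Q E h : R) : 0 <= q -> q <= Q -> 0 < E -> 0 < h ->
  q * ln E <= ln h * q + Q / h * E.
Proof.
move=> q0 qQ E0 h0; have := ler_wpM2l q0 (ln_le_tangent E0 h0).
move=> /le_trans; apply; rewrite mulrDr [q * ln h]mulrC lerD2l.
have -> : Q / h * E = Q * (E / h) by rewrite mulrAC mulrA.
by apply: ler_wpM2r => //; rewrite divr_ge0// ltW.
Qed.

(** An average H of the values e^{p l} controls e^{pw l} at the point where
1/pw differs from the average of 1/p by at most om, provided om ln H is
bounded. *)
Lemma exponent_transfer (pw qbar l H om Q M c : R) : 0 < pw -> pw <= M -> 1 <= H ->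
  0 <= Q -> qbar <= pw^-1 + om -> om * ln H <= c -> 0 <= c ->
  l <= ln H * qbar + Q -> expR (pw * l) <= expR (M * (c + Q)) * H.
Proof.
move=> p0 pM H1 Q0 qb omc c0 lH.
have lnH : 0 <= ln H by rewrite ln_ge0.
rewrite -[X in _ <= _ * X]lnK ?posrE ?(lt_le_trans ltr01)// -expRD ler_expR.
apply: (@le_trans _ _ (pw * (ln H * (pw^-1 + om) + Q))).
  rewrite ler_wpM2l ?(ltW p0)//; apply: le_trans lH _; rewrite lerD2r.
  by rewrite ler_wpM2l.
have -> : pw * (ln H * (pw^-1 + om) + Q) = pw * (om * ln H + Q) + ln H.
  by field; rewrite gt_eqF.
rewrite lerD2r; apply: (@le_trans _ _ (pw * (c + Q))).
  by rewrite ler_wpM2l ?(ltW p0)// lerD2r.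
by rewrite ler_wpM2r// addr_ge0.
Qed.

End Jensen.

(** * Exponents with a logarithmic modulus of continuity *)

Section Exponent.
Variable R : realType.
Implicit Types (z w : R[i]) (p : R[i] -> R) (g : R[i] -> R[i]).

(** The distance enters through an upper bound eta, which is never 0, so the
logarithm in the denominator is positive. *)
Definition log_modulus p (C : R) : Prop :=
  forall z w (eta : R), normc z < 1 -> normc w < 1 -> 0 < eta -> eta < 1 ->
    normc (z - w) <= eta -> `|p z - p w| <= C / ln (eta^-1).

Definition regular_exponent p (m M C : R) : Prop :=
  [/\ 0 < m, (forall z, normc z < 1 -> m <= p z <= M), 0 <= C & log_modulus p C].

Lemma log_modulus_ctsat p (C : R) z : 0 <= C -> log_modulus p C -> normc z < 1 -> ctsat p z.
Proof.
move=> C0 H z1; apply/ctsatP => e e0.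
pose eta : R := expR (- ((C + 1) / e)).
have eta0 : 0 < eta by exact: expR_gt0.
have C1 : 0 < C + 1 by rewrite ltr_wpDl.
have eta1 : eta < 1 by rewrite expR_lt1 oppr_lt0 divr_gt0.
exists (Num.min eta (1 - normc z)); first by rewrite lt_min eta0 subr_gt0.
move=> w; rewrite lt_min => /andP[wz wz1].
have w1 : normc w < 1.
  by rewrite -(subrK z w) (le_lt_trans (normcD _ _))// -ltrBrDr.
apply: le_lt_trans (H _ _ _ w1 z1 eta0 eta1 (ltW wz)) _.
rewrite /eta -expRN opprK expRK invf_div mulrCA gtr_pMr// ltr_pdivrMr// mul1r.
by rewrite ltrDl.
Qed.

Lemma lnV_gt0 (eta : R) : 0 < eta -> eta < 1 -> 0 < ln (eta^-1).
Proof. by move=> e0 e1; rewrite ln_gt0// invf_gt1. Qed.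

Section Fixed.
Variables (p : R[i] -> R) (m M C : R).
Hypothesis regp : regular_exponent p m M C.

Let m0 : 0 < m. Proof. by case: regp. Qed.
Let pm z : normc z < 1 -> m <= p z. Proof. by case: regp => _ H _ _ /H/andP[]. Qed.
Let pM z : normc z < 1 -> p z <= M. Proof. by case: regp => _ H _ _ /H/andP[]. Qed.
Let p0 z : normc z < 1 -> 0 < p z. Proof. by move=> /pm; exact: lt_le_trans. Qed.
Let C0 : 0 <= C. Proof. by case: regp. Qed.

Lemma exponent_ctsat z : normc z < 1 -> ctsat p z.
Proof. by case: regp => _ _ c0 H; exact: log_modulus_ctsat c0 H. Qed.

Lemma inv_exponent_ctsat z : normc z < 1 -> ctsat (fun z => (p z)^-1) z.
Proof.
move=> z1; apply: (@ctsat_comp R p (fun x => x^-1) z (exponent_ctsat z1)).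
by apply: (@cvgV _ _ _ _ id) => //; rewrite gt_eqF// p0.
Qed.

Lemma inv_exponent_ge0 z : normc z < 1 -> 0 <= (p z)^-1.
Proof. by move=> z1; rewrite invr_ge0 ltW// p0. Qed.

Lemma inv_exponent_le z : normc z < 1 -> (p z)^-1 <= m^-1.
Proof. by move=> z1; rewrite lef_pV2 ?posrE ?p0// pm. Qed.

Lemma inv_exponent_dist z w (eta : R) : normc z < 1 -> normc w < 1 ->
  0 < eta -> eta < 1 -> normc (z - w) <= eta ->
  `|(p z)^-1 - (p w)^-1| <= m ^- 2 * (C / ln (eta^-1)).
Proof.
move=> z1 w1 e0 e1 zw; have [_ _ _ H] := regp.
have pz := p0 z1; have pw := p0 w1.
have -> : (p z)^-1 - (p w)^-1 = (p z)^-1 * (p w)^-1 * (p w - p z).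
  by field; rewrite !gt_eqF.
rewrite normrM ger0_norm; last by rewrite mulr_ge0// inv_exponent_ge0.
apply: ler_pM => //.
- by rewrite mulr_ge0// inv_exponent_ge0.
- by rewrite expr2 invfM ler_pM ?inv_exponent_ge0 ?inv_exponent_le.
- by rewrite distrC H.
Qed.

(** log^+ |g|: unlike log |g| it is continuous at the zeros of g, and it still lies
below its Poisson integrals. *)
Definition logp g z : R := ln (Num.max 1 (normc (g z))).

(** max (1, |g|)^p: between |g|^p and 1 + |g|^p, and at least 1. *)
Definition modp g z : R := expR (p z * logp g z).

Lemma max1_gt0 (x : R) : 0 < Num.max 1 x.
Proof. by rewrite lt_max ltr01. Qed.

Lemma logp_ge0 g z : 0 <= logp g z.
Proof. by rewrite ln_ge0// le_max lexx. Qed.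

Lemma modp_ge1 g z : normc z < 1 -> 1 <= modp g z.
Proof. by move=> z1; rewrite -expR0 ler_expR mulr_ge0 ?logp_ge0// ltW// p0. Qed.

Lemma modp_gt0 g z : 0 < modp g z. Proof. exact: expR_gt0. Qed.

Lemma normc_le_expR_logp g z : normc (g z) <= expR (logp g z).
Proof. by rewrite lnK ?posrE ?max1_gt0// le_max lexx orbT. Qed.

Lemma logp_modp g z : normc z < 1 -> logp g z = (p z)^-1 * ln (modp g z).
Proof. by move=> z1; rewrite /modp expRK mulKf// gt_eqF// p0. Qed.

Lemma powR_le_modp g z : normc z < 1 -> normc (g z) `^ p z <= modp g z.
Proof.
move=> z1; have [g1|g1] := leP (normc (g z)) 1.
  apply: le_trans (modp_ge1 g z1).
  have := @ge0_ler_powR R (p z) (ltW (p0 z1)) (normc (g z)) 1.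
  by rewrite !nnegrE normc_ge0 ler01 powR1 => ->.
rewrite /modp /logp max_r ?(ltW g1)// /powR (gt_eqF (lt_trans ltr01 g1)).
exact: lexx.
Qed.

Lemma modp_le_powR g z : normc z < 1 -> modp g z <= 1 + normc (g z) `^ p z.
Proof.
move=> z1; rewrite /modp /logp; have [g1|g1] := leP (normc (g z)) 1.
  by rewrite ln1 mulr0 expR0 lerDl powR_ge0.
by rewrite /powR (gt_eqF (lt_trans ltr01 g1)) lerDr.
Qed.

Lemma logp_ctsat g z : derivable (g : R[i]^o -> R[i]^o) z 1 -> ctsat (logp g) z.
Proof.
move=> dg; have cn : ctsat (fun w => normc (g w)) z.
  exact: (ctsat_circ (derivable_continuous_at dg) (@ctsat_normc R (g z))).
have ck : {for normc (g z), continuous (fun x : R => ln (Num.max 1 x))}.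
  apply: (@continuous_comp R R R (fun x => Num.max 1 x) (@ln R)).
    apply: (@continuous_max R R (fun=> 1) id); [exact: cvg_cst|exact: cvg_id].
  by apply: continuous_ln; exact: max1_gt0.
exact: (ctsat_comp cn ck).
Qed.

Lemma modp_ctsat g z : normc z < 1 -> derivable (g : R[i]^o -> R[i]^o) z 1 ->
  ctsat (modp g) z.
Proof.
move=> z1 dg.
exact: (ctsat_comp (ctsatM (exponent_ctsat z1) (logp_ctsat dg)) (@continuous_expR R _)).
Qed.

End Fixed.
End Exponent.

Section Subharmonic.
Variable R : realType.
Implicit Types (z w : R[i]) (g : R[i] -> R[i]).

(** Both log |g| and 0 have their values inside the disc below the Poisson
integral of log^+ |g|. *)
Lemma logp_le_poisson g (r : R) w : analytic_on_disc g -> 0 < r -> r < 1 ->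
  normc w < r -> logp g w <= poisson r (fun t => logp g (r%:C * ept t)) w.
Proof.
move=> ag r0 r1 wr.
have cL z : normc z <= r -> ctsat (logp g) z.
  by move=> zr; apply: logp_ctsat; apply: ag; exact: le_lt_trans r1.
have gL z : normc z <= r -> normc (g z) <= expR (logp g z).
  by move=> _; exact: normc_le_expR_logp.
have H := normc_le_exp_poisson r0 r1 ag cL gL wr.
have cu := continuous_on_circle (ltW r0) cL.
have P0 : 0 <= poisson r (fun t => logp g (r%:C * ept t)) w.
  rewrite -(poisson_cst 0 r0 wr); apply: le_poisson => //.
    by move=> t; exact: cvg_cst.
  by move=> t; exact: logp_ge0.
rewrite /logp -[X in _ <= X]expRK ler_ln ?posrE ?expR_gt0 ?max1_gt0//.
by rewrite ge_max H andbT -[X in X <= _]expR0 ler_expR.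
Qed.

Lemma poissonD (r : R) (u v : R -> R) w : 0 < r -> normc w < r -> continuous u -> continuous v ->
  poisson r (fun t => u t + v t) w = poisson r u w + poisson r v w.
Proof.
move=> r0 wr cu cv; rewrite /poisson -cmeanD; [|exact: cint_poisson..].
by under eq_cmean do rewrite mulrDr.
Qed.

Lemma poissonZ (r k : R) (u : R -> R) w : 0 < r -> normc w < r -> continuous u ->
  poisson r (fun t => k * u t) w = k * poisson r u w.
Proof.
move=> r0 wr cu; rewrite /poisson -cmeanZ; last exact: cint_poisson.
by under eq_cmean do rewrite mulrCA.
Qed.

Lemma poisson_le_mean (r : R) (u : R -> R) w : 0 < r -> normc w < r -> continuous u ->
  (forall t, 0 <= u t) ->
  poisson r u w <= (1 + normc w / r) / (1 - normc w / r) * cmean u.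
Proof.
move=> r0 wr cu u0; rewrite -cmeanZ; last exact: cint_continuous.
apply: le_cmean; first exact: cint_poisson.
  by apply: intabZ; exact: cint_continuous.
move=> t; apply: ler_wpM2r => //.
by have := pk_le (unrotM_lt1 t r0 wr); rewrite normc_unrotM.
Qed.

End Subharmonic.

(** * Pointwise estimate on circles *)

Section HardyPointwise.
Variable R : realType.
Implicit Types (z w : R[i]) (g : R[i] -> R[i]).
Implicit Types (p : R[i] -> R) (m M C : R).

Lemma normc_ept_scale (r t : R) : 0 <= r -> normc (r%:C * ept t) = r.
Proof. by move=> r0; rewrite normcM normc_ept mulr1 normcR_ge0. Qed.

Lemma ln_inv_le (x : R) : 0 < x -> ln (x^-1) <= x^-1.
Proof. by move=> x0; rewrite ltW// ln_sublinear// invr_gt0. Qed.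

Lemma inv_exponent_circle_cts p m M C (r : R) : regular_exponent p m M C ->
  0 < r -> r < 1 -> continuous (fun t => (p (r%:C * ept t))^-1).
Proof.
move=> regp r0 r1; apply: (@continuous_on_circle R (fun z => (p z)^-1)); first exact: ltW.
by move=> z zr; apply: (inv_exponent_ctsat regp); exact: le_lt_trans r1.
Qed.

(** The Poisson average of 1/p deviates from the value at w by O(1/ln(1/d)),
where d is the distance to the circle. *)
Lemma poisson_inv_exponent p m M C (r : R) w (eta : R) :
  regular_exponent p m M C -> 0 < r -> r < 1 -> normc w < r ->
  0 < eta -> eta < 1 -> 1 - normc w / r = eta ^+ 4 ->
  poisson r (fun t => (p (r%:C * ept t))^-1) w <=
    (p w)^-1 + (m ^- 2 * (C / ln (eta^-1)) + m^-1 * (2 * eta ^+ 2)).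
Proof.
move=> regp r0 r1 wr e0 e1 de; pose q z := (p z)^-1.
rewrite -/(q w).
have [m0 _ C0 _] := regp; have w1 := lt_trans wr r1.
have cq := inv_exponent_circle_cts regp r0 r1.
have ln0 := lnV_gt0 e0 e1.
rewrite -lerBlDl -[X in _ - X](poisson_cst (q w) r0 wr) -poissonB//; last first.
  by move=> t; exact: cvg_cst.
have x0 : 0 <= normc w / r by rewrite divr_ge0 ?normc_ge0// ltW.
apply: (@le_trans _ _ (m ^- 2 * (C / ln (eta^-1)) +
    m^-1 * ((1 - (normc w / r) ^+ 2) / eta ^+ 2))).
  apply: poisson_near => //.
  - by rewrite mulr_ge0 ?divr_ge0 ?invr_ge0 ?sqr_ge0// ltW.
  - by rewrite invr_ge0 ltW.
  - by move=> t; exact: (cvgB (cq t) (@cvg_cst R _ R (nbhs t) _)).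
  - move=> t tn; apply: le_trans (ler_norm _) _.
    have nr := normc_ept_scale t (ltW r0).
    apply: (inv_exponent_dist regp) => //; first by rewrite nr.
    have -> : r%:C * ept t - w = r%:C * ept t * (1 - unrot r t * w).
      by rewrite mulrBr mulr1 mulrA [_ * unrot r t]mulrC unrotK// mul1r.
    rewrite normcM nr; apply: (@le_trans _ _ (1 * eta)); last by rewrite mul1r.
    by apply: ler_pM; rewrite ?normc_ge0// ltW.
  - move=> t; have nr := normc_ept_scale t (ltW r0).
    have h1 : normc (r%:C * ept t) < 1 by rewrite nr.
    have h2 := inv_exponent_le regp h1; have h3 := inv_exponent_ge0 regp w1.
    by move: h2 h3; rewrite /q; clear; lra.
rewrite lerD2l ler_pM2l ?invr_gt0// ler_pdivrMr ?exprn_gt0//.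
have -> : 1 - (normc w / r) ^+ 2 = eta ^+ 4 * (2 - eta ^+ 4).
  by rewrite -de; move: (normc w / r); clear => x; ring.
have -> : 2 * eta ^+ 2 * eta ^+ 2 = eta ^+ 4 * 2 by ring.
by rewrite ler_pM2l ?exprn_gt0// lerBlDr lerDl exprn_ge0// ltW.
Qed.

(** In the exponent, 8 m^-2 C pays for the modulus of continuity of 1/p, 22 / m
for the tail of the Poisson kernel (or for the whole oscillation of 1/p at points
far from the circle), and m^-1 for the tangent line in weighted_ln_le. *)
Definition hardy_const m M C : R := expR (M * (8 * m ^- 2 * C + 22 / m + m^-1)).

Lemma ln_2_le1 : ln (2 : R) <= 1.
Proof.
rewrite -[X in _ <= X](@expRK R) ler_ln ?posrE ?expR_gt0//.
by have := @expR_ge1Dx R 1.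
Qed.

(** With E = modp p g, the majorant of log^+ |g| = (1/p) ln E is, by Jensen, at
most ln h times the Poisson average of 1/p plus a constant, where h is the
Poisson average of E. Replacing the average of 1/p by 1/p(w) multiplies the bound
by a power of h with exponent O(1 / ln (1/d)), d being the relative distance of w
to the circle; this factor is bounded since h = O(1/d). *)
Lemma modp_le_poisson p m M C g (r : R) w : regular_exponent p m M C ->
  analytic_on_disc g -> 0 < r -> r < 1 ->
  cmean (fun t => modp p g (r%:C * ept t)) <= 2 -> normc w < r ->
  modp p g w <= hardy_const m M C * poisson r (fun t => modp p g (r%:C * ept t)) w.
Proof.
move=> regp ag r0 r1 mE wr.
have [m0 pmM C0 _] := regp; have w1 := lt_trans wr r1.
set E := fun t => modp p g (r%:C * ept t).
have nr t : normc (r%:C * ept t) < 1 by rewrite normc_ept_scale// ltW.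
have cE : continuous E.
  apply: continuous_on_circle; first exact: ltW.
  move=> z zr; have z1 := le_lt_trans zr r1.
  by apply: (modp_ctsat regp) => //; exact: ag.
have cL : continuous (fun t => logp g (r%:C * ept t)).
  apply: continuous_on_circle; first exact: ltW.
  by move=> z zr; apply: logp_ctsat; apply: ag; exact: le_lt_trans r1.
have cq := inv_exponent_circle_cts regp r0 r1.
set h := poisson r E w.
have h1 : 1 <= h.
  rewrite -(poisson_cst 1 r0 wr); apply: le_poisson => //.
    by move=> t; exact: cvg_cst.
  by move=> t; exact: (modp_ge1 regp).
have h0 : 0 < h := lt_le_trans ltr01 h1.
set x := normc w / r.
have x0 : 0 <= x by rewrite divr_ge0 ?normc_ge0// ltW.
have x1 : x < 1 by rewrite ltr_pdivrMr// mul1r.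
pose d := 1 - x.
have d0 : 0 < d by rewrite subr_gt0.
have d1 : d <= 1 by rewrite /d gerBl.
have hd : h <= 4 / d.
  have E0 t : 0 <= E t by exact/ltW/modp_gt0.
  apply: le_trans (poisson_le_mean r0 wr cE E0) _; rewrite -/x -/d.
  have -> : 4 / d = 2 / d * 2 by ring.
  apply: ler_pM => //.
  - by apply: divr_ge0; [exact: addr_ge0|exact: (ltW d0)].
  - by rewrite -[X in X <= _](cmean_cst 0); apply: le_cmean => //;
      [exact: cint_cst|exact: cint_continuous].
  - by rewrite ler_pM2r ?invr_gt0// (_ : 2 = 1 + 1)// lerD2l ltW.
have lnh0 : 0 <= ln h by rewrite ln_ge0.
have lnh : ln h <= 2 + ln (d^-1).
  apply: (@le_trans _ _ (ln (4 / d))); first by rewrite ler_ln ?posrE ?divr_gt0.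
  rewrite lnM ?posrE ?invr_gt0// lerD2r.
  rewrite (_ : 4 = 2 * 2); last by clear; lra.
  by rewrite lnM ?posrE//; have := ln_2_le1; clear; lra.
have lnd0 : 0 <= ln (d^-1) by rewrite ln_ge0// invf_ge1.
set qb := poisson r (fun t => (p (r%:C * ept t))^-1) w.
have LE : logp g w <= ln h * qb + m^-1.
  apply: le_trans (logp_le_poisson ag r0 r1 wr) _.
  apply: (@le_trans _ _ (poisson r (fun t => ln h * (p (r%:C * ept t))^-1 + m^-1 / h * E t) w)).
    apply: le_poisson => //.
      by move=> t; apply: cvgD; apply: cvgM; [exact: cvg_cst|exact: cq|exact: cvg_cst|exact: cE].
    move=> t; rewrite (logp_modp regp)//; apply: weighted_ln_le => //.
    - exact: (inv_exponent_ge0 regp).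
    - exact: (inv_exponent_le regp).
    - exact: modp_gt0.
  rewrite poissonD//; last 2 first.
  - by move=> t; apply: cvgM; [exact: cvg_cst|exact: cq].
  - by move=> t; apply: cvgM; [exact: cvg_cst|exact: cE].
  by rewrite !poissonZ// -/h -/qb divfK// gt_eqF.
have mi0 : 0 < m^-1 by rewrite invr_gt0.
have m20 : 0 <= m ^- 2 by rewrite invr_ge0 sqr_ge0.
have pw0 : 0 < p w by apply: lt_le_trans m0 _; have /andP[] := pmM w w1.
have pwM : p w <= M by have /andP[] := pmM w w1.
have qw0 : 0 <= (p w)^-1 by exact: (inv_exponent_ge0 regp).
(* Far from the circle h is bounded, and 1/p <= 1/m is enough. *)
have [d16|d16] := leP (16^-1) d.
  have qb_le : qb <= (p w)^-1 + m^-1.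
    apply: (@le_trans _ _ m^-1); last by rewrite lerDr.
    rewrite -(poisson_cst m^-1 r0 wr); apply: le_poisson => //.
      by move=> t; exact: cvg_cst.
    by move=> t; exact: (inv_exponent_le regp).
  have omc : m^-1 * ln h <= 8 * m ^- 2 * C + 22 / m.
    have lnd : ln (d^-1) <= 4.
      apply: (@le_trans _ _ (ln ((2 * 2) * (2 * 2)))).
        rewrite ler_ln ?posrE ?invr_gt0 ?mulr_gt0//.
        rewrite -[X in _ <= X]invrK lef_pV2 ?posrE ?invr_gt0 ?mulr_gt0//.
        by apply: le_trans d16; rewrite lef_pV2 ?posrE ?mulr_gt0//; clear; lra.
      by rewrite !lnM ?posrE ?mulr_gt0//; have := ln_2_le1; clear; lra.
    apply: (@le_trans _ _ (m^-1 * 22)).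
      by rewrite ler_pM2l//; move: lnd lnh; clear; lra.
    by rewrite [22 / m]mulrC lerDr mulr_ge0// mulr_ge0.
  apply: (exponent_transfer pw0 pwM h1 (ltW mi0) qb_le omc _ LE).
  by rewrite addr_ge0 ?mulr_ge0// ltW.
(* The points of the circle at distance more than d^{1/4} carry a mass O(d^{1/2})
   of the kernel, and the logarithms of d and of d^{1/4} are comparable. *)
pose eta := Num.sqrt (Num.sqrt d).
have eta0 : 0 < eta by rewrite !sqrtr_gt0.
have eta4 : d = eta ^+ 4.
  by rewrite /eta (exprM _ 2 2) !sqr_sqrtr ?sqrtr_ge0// ltW.
have eta1 : eta < 2^-1.
  rewrite -(@ltr_pXn2r _ 4) ?nnegrE ?invr_ge0 ?(ltW eta0)// -eta4.
  by apply: lt_le_trans d16 _; rewrite exprVn lef_pV2 ?posrE ?exprn_gt0// !exprS expr0; clear; lra.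
have eta1' : eta < 1 by move: eta1; clear; lra.
have ln0 := lnV_gt0 eta0 eta1'.
have := poisson_inv_exponent regp r0 r1 wr eta0 eta1' eta4.
rewrite -/qb => qb_le.
apply: (exponent_transfer pw0 pwM h1 (ltW mi0) qb_le _ _ LE); last first.
  by rewrite addr_ge0 ?mulr_ge0// ltW.
set lam := ln (eta^-1) in ln0 qb_le *.
have lnd : ln (d^-1) = 4 * lam by rewrite eta4 -exprVn lnXn ?invr_gt0// mulr_natl.
have lam_ge : 1 / 2 <= lam.
  have : 2 <= eta^-1 by rewrite -[X in X <= _]invrK lef_pV2 ?posrE ?invr_gt0// ltW.
  move=> e2; have e2' : ln 2 <= lam by rewrite ler_ln ?posrE ?invr_gt0.
  apply: le_trans e2'.
  have : ln (1 + - 2^-1) <= - 2^-1 :> R by apply: le_ln1Dx; clear; lra.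
  rewrite (_ : 1 + - 2^-1 = 2^-1 :> R); last by clear; lra.
  by rewrite lnV ?posrE// lerN2 div1r.
have lnh8 : ln h <= 8 * lam by move: lnh; rewrite lnd; move: lam_ge; clear; lra.
have lame : eta ^+ 2 * lam <= 1.
  have := ln_inv_le eta0; rewrite -/lam => le.
  apply: (@le_trans _ _ (eta ^+ 2 * eta^-1)).
    by rewrite ler_wpM2l// sqr_ge0.
  by rewrite expr2 mulfK ?gt_eqF// ltW.
apply: (@le_trans _ _ ((m ^- 2 * (C / lam) + m^-1 * (2 * eta ^+ 2)) * (8 * lam))).
  apply: ler_wpM2l => //.
  by rewrite addr_ge0// mulr_ge0 ?divr_ge0 ?mulr_ge0 ?sqr_ge0// ltW.
rewrite mulrDl; apply: lerD.
  by rewrite le_eqVlt; apply/orP; left; apply/eqP; field; rewrite !gt_eqF.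
have -> : m^-1 * (2 * eta ^+ 2) * (8 * lam) = 16 * (eta ^+ 2 * lam) / m by ring.
rewrite ler_pM2r ?invr_gt0//; move: lame; clear; lra.
Qed.

End HardyPointwise.

(** * Modulars and Luxemburg norms *)

Section PowerModular.
Variable R : realType.
Local Open Scope ereal_scope.

Lemma measurable_powR2 d (T : measurableType d) (D : set T) (u v : T -> R) :
  measurable D -> measurable_fun D u -> measurable_fun D v ->
  measurable_fun D (fun x => (u x `^ v x)%R).
Proof.
move=> mD mu mv; rewrite /powR; apply: measurable_fun_if => //.
- exact: measurable_fun_eqr.
- apply: (measurable_funS (E := D)) => //.
  apply: (@measurableT_comp _ _ _ _ _ _ (fun b : bool => (b%:R : R))) => //.
  by apply: measurable_fun_eqr.
- apply: (measurable_funS (E := D)) => //.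
  apply: measurableT_comp => //; apply: measurable_funM => //.
  exact: measurableT_comp.
Qed.

Section Scaling.
Context d (T : measurableType d) (mu : {measure set T -> \bar R}).
Variables (D : set T) (W u s : T -> R).
Hypotheses (mD : measurable D) (mW : measurable_fun D W)
  (mu_ : measurable_fun D u) (ms : measurable_fun D s)
  (W0 : forall x, D x -> (0 <= W x)%R) (u0 : forall x, D x -> (0 <= u x)%R).

Lemma powR_scale_le (x k y m : R) : (0 <= x -> 1 <= k -> m <= y ->
  (x / k) `^ y <= k `^ (- m) * x `^ y)%R.
Proof.
move=> x0 k1 my; have k0 : (0 < k)%R by exact: lt_le_trans k1.
rewrite powRM ?invr_ge0 ?(ltW k0)// mulrC; apply: ler_wpM2r; first exact: powR_ge0.
by rewrite -powR_inv1 ?(ltW k0)// -powRrM mulN1r ler_powR// lerN2.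
Qed.

Lemma modular_scale_le (k m : R) : (1 <= k)%R -> (forall x, D x -> (m <= s x)%R) ->
  \int[mu]_(x in D) (W x * (u x / k) `^ s x)%:E <=
  (k `^ (- m))%:E * \int[mu]_(x in D) (W x * u x `^ s x)%:E.
Proof.
move=> k1 ms0.
have mWu : measurable_fun D (fun x => (W x * u x `^ s x)%:E).
  apply/measurable_EFinP; apply: measurable_funM => //; exact: measurable_powR2.
rewrite -ge0_integralZl//; last 2 first.
- by move=> x Dx; rewrite lee_fin mulr_ge0 ?powR_ge0// W0.
- by rewrite lee_fin powR_ge0.
apply: ge0_le_integral => //.
- by move=> x Dx; rewrite lee_fin mulr_ge0 ?powR_ge0// W0.
- apply/measurable_EFinP; apply: measurable_funM => //; apply: measurable_powR2 => //.
  by apply: measurable_funM => //; exact: measurable_cst.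
- by apply: measurable_funeM.
- move=> x Dx; rewrite -EFinM lee_fin mulrCA; apply: ler_wpM2l; first exact: W0.
  by apply: powR_scale_le; rewrite ?u0// ms0.
Qed.

End Scaling.

Lemma luxemburg_le (rho : R -> \bar R) (l : R) : (0 < l)%R -> rho l < 1 ->
  luxemburg rho <= l%:E.
Proof. by move=> l0 rl; apply: ereal_inf_lbound; exists l. Qed.

Lemma luxemburg_lt (rho : R -> \bar R) (l : R) : luxemburg rho < l%:E ->
  exists l', [/\ (0 < l')%R, (l' < l)%R & rho l' < 1].
Proof.
move=> /ereal_inf_lt[_ [l' [l'0 rl'] <-]]; rewrite lte_fin => ll'.
by exists l'.
Qed.

Lemma luxemburg_ge0 (rho : R -> \bar R) : 0 <= luxemburg rho.
Proof. by apply: le_ereal_inf_tmp => _ [l [l0 _] <-]; rewrite lee_fin ltW. Qed.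

Lemma homogeneous_bound (N N' : \bar R) (k : R) : (0 < k)%R -> 0 <= N ->
  (forall l : R, (0 < l)%R -> N < l%:E -> N' <= (k * l)%:E) -> N' <= k%:E * N.
Proof.
move=> k0 N0 H; move: N N0 H => [x| |]//; last first.
  by move=> _ _; rewrite gt0_muley ?lte_fin// leey.
rewrite lee_fin => x0 H; rewrite -EFinM; apply/lee_addgt0Pr => e e0.
have xe : (x < x + e / k)%R by rewrite ltrDl divr_gt0.
have := H _ (le_lt_trans x0 xe); rewrite lte_fin => /(_ xe) /le_trans; apply.
by rewrite -EFinD lee_fin mulrDr mulrCA mulfV ?gt_eqF// mulr1.
Qed.

Lemma homogeneous_lty (N N' : \bar R) (k : R) : N < +oo -> 0 <= N ->
  (forall l : R, (0 < l)%R -> N < l%:E -> N' <= (k * l)%:E) -> N' < +oo.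
Proof.
move=> + + H; move: N H => [x| |]// H _; rewrite lee_fin => x0.
apply: le_lt_trans (H (x + 1)%R (ltr_wpDl x0 ltr01) _) (ltry _).
by rewrite lte_fin ltrDl.
Qed.

End PowerModular.

(** * Composition on Hardy spaces *)

Section Hardy.
Variable R : realType.
Implicit Types (z w : R[i]) (f g phi : R[i] -> R[i]) (p s : R[i] -> R).
Notation leb := (@lebesgue_measure R).

Definition circle_modular s (r : R) f : \bar R :=
  (((2 * pi)^-1)%:E * \int[leb]_(t in `[0%R, (2 * pi)%R])
      (normc (f (circle_pt r t)) `^ s (circle_pt r t))%:E)%E.

Lemma circle_modularE s (r : R) f : circle_modular s r f =
  (((2 * pi)^-1)%:E * \int[leb]_(t in `[0%R, (2 * pi)%R])
      (normc (f (r%:C * ept t)) `^ s (r%:C * ept t))%:E)%E.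
Proof. by congr (_ * _)%E; apply: eq_integral => t _; rewrite circle_ptE. Qed.

Lemma EFin_cmean (u : R -> R) : continuous u ->
  (cmean u)%:E = (((2 * pi)^-1)%:E * \int[leb]_(t in `[0%R, (2 * pi)%R]) (u t)%:E)%E.
Proof.
move=> cu; rewrite /cmean EFinM; congr (_ * _)%E.
rewrite /Iab /Rintegral fineK//.
exact: (integrable_fin_num _ (intab_continuous 0 (2 * pi) cu)).
Qed.

Lemma two_pi_inv_ge0 : 0 <= (2 * pi)^-1 :> R.
Proof. by rewrite invr_ge0 ltW// twopi_gt0. Qed.

Section Circle.
Variables (s : R[i] -> R) (r : R) (g : R[i] -> R[i]) (m : R).
Hypotheses (m0 : 0 < m) (ms : forall t : R, m <= s (r%:C * ept t))
  (cs : continuous (fun t => s (r%:C * ept t)))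
  (cg : continuous (fun t => normc (g (r%:C * ept t)))).

Let mI : measurable (`[0%R, (2 * pi)%R] : set R).
Proof. exact: measurable_itv. Qed.

Let mc (u : R -> R) : continuous u -> measurable_fun `[0%R, (2 * pi)%R] u.
Proof. by move=> cu; apply: measurable_funTS; exact: continuous_measurable_fun. Qed.

Let mpow : measurable_fun `[0%R, (2 * pi)%R]
  (fun t => (normc (g (r%:C * ept t)) `^ s (r%:C * ept t))%:E).
Proof. by apply/measurable_EFinP; apply: measurable_powR2 => //; exact: mc. Qed.

(** Comparison with a continuous function replaces the extended integral of the
modular by a circle mean. *)
Lemma circle_modular_le (E : R -> R) : continuous E ->
  (forall t, normc (g (r%:C * ept t)) `^ s (r%:C * ept t) <= E t) ->
  (circle_modular s r g <= (cmean E)%:E)%E.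
Proof.
move=> cE H; rewrite EFin_cmean// circle_modularE; apply: lee_wpmul2l.
  by rewrite lee_fin two_pi_inv_ge0.
apply: ge0_le_integral => //.
- by move=> t _; rewrite lee_fin powR_ge0.
- by apply/measurable_EFinP; exact: mc.
- by move=> t _; rewrite lee_fin.
Qed.

Lemma circle_modular_ge (E : R -> R) : continuous E ->
  (forall t, E t <= 1 + normc (g (r%:C * ept t)) `^ s (r%:C * ept t)) ->
  (forall t, 0 <= E t) ->
  ((cmean E)%:E <= 1 + circle_modular s r g)%E.
Proof.
move=> cE H E0; have c1 : continuous (fun _ : R => 1 : R) by move=> t; exact: (@cvg_cst R 1 R (nbhs t) _).
rewrite -[X in (_ <= X + _)%E](_ : (cmean (fun=> 1 : R))%:E = _); last by rewrite cmean_cst.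
rewrite !EFin_cmean// circle_modularE -ge0_muleDr; last 2 first.
- by apply: integral_ge0 => t _; rewrite lee_fin.
- by apply: integral_ge0 => t _; rewrite lee_fin powR_ge0.
rewrite -ge0_integralD//; last by move=> t _; rewrite lee_fin powR_ge0.
apply: lee_wpmul2l; first by rewrite lee_fin two_pi_inv_ge0.
apply: ge0_le_integral => //.
- by move=> t _; rewrite lee_fin E0.
- by apply/measurable_EFinP; exact: mc.
- exact: emeasurable_funD.
- by move=> t _; rewrite -EFinD lee_fin.
Qed.

Lemma circle_modular_scale (k : R) : 1 <= k ->
  (circle_modular s r (fun z => (g z / k%:C)%R) <= (k `^ (- m))%:E * circle_modular s r g)%E.
Proof.
move=> k1; have k0 : 0 < k by exact: lt_le_trans k1.
rewrite !circle_modularE muleCA; apply: lee_wpmul2l; first by rewrite lee_fin two_pi_inv_ge0.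
have := @modular_scale_le R _ _ leb `[0%R, (2 * pi)%R] (fun=> 1)
  (fun t => normc (g (r%:C * ept t))) (fun t => s (r%:C * ept t)) mI
  (@measurable_cst _ _ _ _ _ _) (mc cg) (mc cs) (fun _ _ => ler01)
  (fun t _ => normc_ge0 _) k m k1 (fun t _ => ms t).
congr (_ <= _ * _)%E; apply: eq_integral => t _; rewrite mul1r//.
by rewrite normcM normcV normcR gtr0_norm.
Qed.

End Circle.

(** Littlewood subordination for the harmonic majorant: along the circle of
radius sg the function poisson r E o phi has mean poisson r E (phi 0), since it
is the real part of an analytic function. *)
Lemma circle_modular_composition p m M C phi :
  regular_exponent p m M C -> analytic_on_disc phi ->
  (forall z, disc z -> disc (phi z)) ->
  exists2 A : R, 1 <= A & forall g, analytic_on_disc g ->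
    (forall r : R, 0 < r -> r < 1 -> (circle_modular p r g < 1)%E) ->
    forall sg : R, 0 <= sg -> sg < 1 ->
      (circle_modular (fun z => p (phi z)) sg (fun z => g (phi z)) <= A%:E)%E.
Proof.
move=> regp aphi dphi; have [m0 pmM C0 _] := regp.
set a := normc (phi 0).
have n0 : normc (0 : R[i]) < 1 by rewrite (@normc0 R).
have a1 : a < 1 by exact: dphi.
have a0 : 0 <= a by exact: normc_ge0.
pose K := hardy_const m M C.
pose A := Num.max 1 (K * (4 / ((1 - a) / 2) * 2)).
exists A; first by rewrite le_max lexx.
move=> g ag Hg sg sg0 sg1.
pose s1 := (1 + sg) / 2.
have s1sg : sg < s1 by rewrite /s1; lra.
have s11 : s1 < 1 by rewrite /s1; lra.
pose ka := (1 - a) / 4 * (1 - s1).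
have ka0 : 0 < ka by rewrite mulr_gt0// ?divr_gt0// subr_gt0.
(* phi maps the disc of radius s1 into the disc of radius r, and r is also at
   least (1 + |phi 0|) / 2, which makes the Harnack constant at phi 0 independent
   of sg. *)
pose r := Num.max (1 - ka / 2) ((1 + a) / 2).
have r1 : r < 1 by rewrite gt_max; apply/andP; split; lra.
have r0 : 0 < r by rewrite lt_max; apply/orP; right; lra.
have ar : (1 + a) / 2 <= r by rewrite le_max lexx orbT.
have ar' : a < r by lra.
have phir z : normc z <= s1 -> normc (phi z) < r.
  move=> zs; have z1 := le_lt_trans zs s11.
  have := self_map_distance aphi dphi z1; rewrite -/a => H.
  have : ka <= (1 - a) / 4 * (1 - normc z).
    by rewrite ler_wpM2l ?divr_ge0//; lra.
  rewrite lt_max => kaz; apply/orP; left; lra.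
have nr t : normc (r%:C * ept t) < 1 by rewrite normc_ept_scale// ltW.
pose E t := modp p g (r%:C * ept t).
have ccirc (v : R[i] -> R) (q : R) : 0 <= q -> q < 1 -> (forall z, normc z < 1 -> ctsat v z) ->
    continuous (fun t => v (q%:C * ept t)).
  by move=> q0 q1 cv; apply: continuous_on_circle => // z zq; apply: cv; exact: le_lt_trans q1.
have cE : continuous E.
  by apply: ccirc => //; [exact: ltW|move=> z z1; exact: (modp_ctsat regp z1 (ag z z1))].
have E2 : cmean E <= 2.
  rewrite -lee_fin (_ : 2 = 1 + 1)// EFinD.
  apply: (@le_trans _ _ (1 + circle_modular p r g)%E); last first.
    by rewrite leeD2l// ltW// Hg.
  apply: circle_modular_ge => //.
  - by apply: ccirc => //; [exact: ltW|move=> z z1; exact: (exponent_ctsat regp z1)].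
  - apply: (@ccirc (fun z => normc (g z))) => //; first exact: ltW.
    move=> z z1; exact: (ctsat_circ (derivable_continuous_at (ag z z1)) (@ctsat_normc R _)).
  - by move=> t; exact: modp_le_powR.
  - by move=> t; exact/ltW/modp_gt0.
have phi1 z : normc z < 1 -> normc (phi z) < 1 by move=> z1; exact: dphi.
have cF : continuous (fun t => modp p g (phi (sg%:C * ept t))).
  apply: (@ccirc (fun z => modp p g (phi z))) => // z z1.
  exact: (ctsat_circ (derivable_continuous_at (aphi z z1)) (modp_ctsat regp (phi1 z z1) (ag _ (phi1 z z1)))).
have [B B0 EB] : exists2 B : R, 0 <= B & forall t, `|E t| <= B.
  have [B B0 HB] := @bounded_ctsat R (modp p g) r (ltW r0)
    (fun z zr => modp_ctsat regp (le_lt_trans zr r1) (ag z (le_lt_trans zr r1))).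
  by exists B => // t; apply: HB; rewrite normc_ept_scale// ltW.
pose Hz z := herglotz r E (phi z).
have dHz z : normc (z - 0) < s1 -> derivable (Hz : R[i]^o -> R[i]^o) z 1.
  rewrite subr0 => zs; have z1 := lt_trans zs s11.
  exact: (derivable_circ (aphi z z1) (derivable_herglotz r0 (phir z (ltW zs)) cE EB)).
have mHz := mean_value_Re dHz sg0 s1sg.
have cP : continuous (fun t => poisson r E (phi (sg%:C * ept t))).
  have -> : (fun t => poisson r E (phi (sg%:C * ept t))) =
      (fun t => complex.Re (Hz (0 + sg%:C * ept t))).
    by apply/funext => t; rewrite add0r /Hz Re_herglotz.
  exact: (Q_cts dHz sg0 s1sg).
have nsg t : normc (sg%:C * ept t) = sg by rewrite normc_ept_scale.
apply: (@le_trans _ _ (cmean (fun t => modp p g (phi (sg%:C * ept t))))%:E).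
  apply: (@circle_modular_le (fun z => p (phi z)) sg (fun z => g (phi z))) => //.
  - apply: (@ccirc (fun z => p (phi z))) => // z z1.
    exact: (ctsat_circ (derivable_continuous_at (aphi z z1)) (exponent_ctsat regp (phi1 z z1))).
  - apply: (@ccirc (fun z => normc (g (phi z)))) => // z z1.
    have dgp := derivable_circ (aphi z z1) (ag _ (phi1 z z1)).
    exact: (ctsat_circ (derivable_continuous_at dgp) (@ctsat_normc R _)).
  - by move=> t; apply: (powR_le_modp regp); apply: phi1; rewrite nsg.
rewrite lee_fin; apply: (@le_trans _ _ (cmean (fun t => K * poisson r E (phi (sg%:C * ept t))))).
  apply: le_cmean; first exact: cint_continuous.
    by apply: intabZ; exact: cint_continuous.
  move=> t; apply: (modp_le_poisson regp) => //; apply: phir; rewrite nsg; exact: ltW.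
rewrite cmeanZ; last exact: cint_continuous.
have -> : cmean (fun t => poisson r E (phi (sg%:C * ept t))) = poisson r E (phi 0).
  by rewrite -Re_herglotz -mHz; apply: eq_cmean => t; rewrite add0r /Hz Re_herglotz.
apply: (@le_trans _ _ (K * (4 / ((1 - a) / 2) * 2))); last by rewrite le_max lexx orbT.
apply: ler_wpM2l; first exact: expR_ge0.
apply: le_trans (poisson_le_mean r0 ar' cE (fun t => ltW (modp_gt0 _ _ _))) _.
rewrite -/a.
have arx : a / r < 1 by rewrite ltr_pdivrMr// mul1r.
have arx0 : 0 <= a / r by rewrite divr_ge0// ltW.
have E0 : 0 <= cmean E.
  rewrite -[X in X <= _](cmean_cst 0); apply: le_cmean => //; [exact: cint_cst|exact: cint_continuous|].
  by move=> t; exact/ltW/modp_gt0.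
apply: ler_pM => //; first by rewrite divr_ge0//; lra.
apply: ler_pM => //; rewrite ?addr_ge0 ?invr_ge0//; [lra|lra|].
have q : (1 - a) / 2 <= 1 - a / r.
  have : a / r <= a / ((1 + a) / 2).
    by apply: ler_wpM2l => //; rewrite lef_pV2 ?posrE//; lra.
  have : a / ((1 + a) / 2) <= (1 + a) / 2.
    by rewrite ler_pdivrMr; [have := sqr_ge0 (1 - a); rewrite expr2; lra|lra].
  lra.
by rewrite lef_pV2 ?posrE//; lra.
Qed.

End Hardy.

Section LuxemburgTransfer.
Variable R : realType.
Local Open Scope ereal_scope.

Definition dilation (A m : R) : R := ((2 * A) `^ m^-1)%R.

Lemma dilation_ge1 (A m : R) : (1 <= A)%R -> (0 < m)%R -> (1 <= dilation A m)%R.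
Proof.
move=> A1 m0; apply: (@le_trans _ _ (1 `^ m^-1)%R); first by rewrite powR1.
apply: ge0_ler_powR; rewrite ?invr_ge0 ?nnegrE ?(ltW m0)//; lra.
Qed.

Lemma dilation_powR (A m : R) : (1 <= A)%R -> (0 < m)%R ->
  (dilation A m `^ (- m) * A = 2^-1)%R.
Proof.
move=> A1 m0; have A0 : (0 < A)%R by exact: lt_le_trans A1.
rewrite /dilation -powRrM mulrN mulVf ?gt_eqF// powR_inv1; last by rewrite mulr_ge0// ltW.
by field; rewrite gt_eqF.
Qed.

(** [Phi i l] and [Psi i l] are the modulars of f / l and of its image; the
level l of the domain norm is dilated by the factor that halves the bound A. *)
Lemma luxemburg_sup_transfer (I : Type) (J : set I) (Phi Psi : I -> R -> \bar R)
    (m A : R) : (0 < m)%R -> (1 <= A)%R -> J !=set0 ->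
  (forall i (l k : R), J i -> (0 < l)%R -> (1 <= k)%R ->
     Phi i (k * l)%R <= (k `^ (- m))%:E * Phi i l) ->
  (forall i (l k : R), J i -> (0 < l)%R -> (1 <= k)%R ->
     Psi i (k * l)%R <= (k `^ (- m))%:E * Psi i l) ->
  (forall i (l : R), J i -> 0 <= Phi i l) ->
  (forall l : R, (0 < l)%R -> (forall i, J i -> Phi i l < 1) ->
     forall i, J i -> Psi i l <= A%:E) ->
  let N := ereal_sup [set luxemburg (Phi i) | i in J] in
  let N' := ereal_sup [set luxemburg (Psi i) | i in J] in
  (0 <= N) /\ forall l : R, (0 < l)%R -> N < l%:E -> N' <= (dilation A m * l)%:E.
Proof.
move=> m0 A1 [i0 J0] HPhi HPsi Phi0 HA N N'.
have d1 := dilation_ge1 A1 m0; have d0 : (0 < dilation A m)%R by exact: lt_le_trans d1.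
split.
  apply: (@le_trans _ _ (luxemburg (Phi i0))); first exact: luxemburg_ge0.
  by apply: ereal_sup_ubound; exists i0.
move=> l l0 Nl; apply: ge_ereal_sup => _ [i Ji <-].
apply: luxemburg_le; first by rewrite mulr_gt0.
apply: (@le_lt_trans _ _ ((dilation A m `^ (- m))%:E * A%:E)); last first.
  by rewrite -EFinM dilation_powR// lte_fin invf_lt1// ltr1n.
apply: le_trans (HPsi i l _ Ji l0 d1) _.
apply: lee_wpmul2l; first by rewrite lee_fin powR_ge0.
apply: (HA _ l0) => // j Jj.
have : luxemburg (Phi j) < l%:E.
  by apply: le_lt_trans Nl; apply: ereal_sup_ubound; exists j.
move=> /luxemburg_lt[l' [l'0 l'l Phil']].
have k1 : (1 <= l / l')%R by rewrite ler_pdivlMr// mul1r ltW.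
apply: le_lt_trans Phil'.
have := HPhi j l' _ Jj l'0 k1; rewrite divfK ?gt_eqF// => /le_trans; apply.
rewrite -[X in _ <= X]mul1e; apply: lee_wpmul2r; first exact: Phi0.
rewrite lee_fin powRN invf_le1 ?powR_gt0 ?(lt_le_trans ltr01)//.
apply: (@le_trans _ _ (1 `^ m)%R); first by rewrite powR1.
by apply: ge0_ler_powR; rewrite ?nnegrE ?(ltW m0)// (le_trans ler01).
Qed.

Lemma luxemburg_transfer (Phi Psi : R -> \bar R) (m A : R) : (0 < m)%R -> (1 <= A)%R ->
  (forall l k : R, (0 < l)%R -> (1 <= k)%R -> Phi (k * l)%R <= (k `^ (- m))%:E * Phi l) ->
  (forall l k : R, (0 < l)%R -> (1 <= k)%R -> Psi (k * l)%R <= (k `^ (- m))%:E * Psi l) ->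
  (forall l : R, 0 <= Phi l) ->
  (forall l : R, (0 < l)%R -> Phi l < 1 -> Psi l <= A%:E) ->
  luxemburg Psi <= (dilation A m)%:E * luxemburg Phi.
Proof.
move=> m0 A1 h1 h2 h3 h4.
have sup1 (Q : R -> \bar R) : ereal_sup [set luxemburg Q | _ in [set tt]] = luxemburg Q.
  by rewrite image_set1 ereal_sup1.
have J0 : [set tt] !=set0 by exists tt.
have [N0 H] := @luxemburg_sup_transfer unit [set tt] (fun=> Phi) (fun=> Psi) m A m0 A1 J0
  (fun _ l k _ => h1 l k) (fun _ l k _ => h2 l k) (fun _ l _ => h3 l)
  (fun l l0 HP _ _ => h4 l l0 (HP tt erefl)).
rewrite !sup1 in N0 H; apply: homogeneous_bound N0 H.
exact: lt_le_trans (dilation_ge1 A1 m0).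
Qed.

End LuxemburgTransfer.

Section HardyOperator.
Variable R : realType.
Implicit Types (f phi : R[i] -> R[i]) (p : R[i] -> R).

Lemma divr_realM f (k l : R) : (fun z => f z / (k * l)%:C) = (fun z => f z / l%:C / k%:C).
Proof. by apply/funext => z; rewrite rmorphM /= invfM mulrA mulrAC. Qed.

Lemma analytic_div f (l : R) : analytic_on_disc f ->
  analytic_on_disc (fun z => f z / l%:C).
Proof. by move=> af z z1; exact: (cderM (af z z1) (@cder_cst R _ z)). Qed.

Lemma analytic_comp f phi : analytic_on_disc f -> analytic_on_disc phi ->
  (forall z, disc z -> disc (phi z)) -> analytic_on_disc (fun z => f (phi z)).
Proof.
by move=> af ap dp z z1; exact: (derivable_circ (ap z z1) (af _ (dp z z1))).
Qed.

Lemma circle_continuous (v : R[i] -> R) (r : R) : 0 <= r -> r < 1 ->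
  (forall z, normc z < 1 -> ctsat v z) -> continuous (fun t => v (r%:C * ept t)).
Proof.
move=> r0 r1 cv; apply: continuous_on_circle => // z zr.
by apply: cv; exact: le_lt_trans r1.
Qed.

Lemma circle_modular_dilate (s : R[i] -> R) (m r : R) f : 0 <= r -> r < 1 ->
  (forall z, normc z < 1 -> m <= s z) -> (forall z, normc z < 1 -> ctsat s z) ->
  analytic_on_disc f -> forall k l : R, 1 <= k ->
  (circle_modular s r (fun z => (f z / (k * l)%:C)%R) <=
     (k `^ (- m))%:E * circle_modular s r (fun z => (f z / l%:C)%R))%E.
Proof.
move=> r0 r1 ms cs af k l k1; rewrite divr_realM.
apply: circle_modular_scale => //.
- by move=> t; apply: ms; rewrite normc_ept_scale.
- exact: circle_continuous.
- apply: (@circle_continuous (fun z => normc (f z / l%:C))) => // z z1.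
  apply: (@ctsat_circ R (@normc R) (fun z => f z / l%:C)); last exact: ctsat_normc.
  by apply: derivable_continuous_at; have H := @analytic_div f l af; exact: (H z z1).
Qed.

Lemma circle_modular_ge0 (s : R[i] -> R) (r : R) f : (0 <= circle_modular s r f)%E.
Proof.
apply: mule_ge0; first by rewrite lee_fin two_pi_inv_ge0.
by apply: integral_ge0 => t _; rewrite lee_fin powR_ge0.
Qed.

Lemma hardy_composition_bounded p m M C phi : regular_exponent p m M C ->
  analytic_on_disc phi -> (forall z, disc z -> disc (phi z)) ->
  bounded_operator (-1) p (fun z => p (phi z)) (composition_operator phi).
Proof.
move=> regp aphi dphi; have [m0 pmM C0 _] := regp.
have [A A1 HA] := circle_modular_composition regp aphi dphi.
have d0 : 0 < dilation A m by exact: lt_le_trans (dilation_ge1 A1 m0).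
have core f : analytic_on_disc f ->
   (0 <= hardy_norm p f)%E /\ forall l : R, 0 < l -> (hardy_norm p f < l%:E)%E ->
     (hardy_norm (fun z => p (phi z)) (composition_operator phi f) <= (dilation A m * l)%:E)%E.
  move=> af.
  apply: (@luxemburg_sup_transfer R R [set r : R | 0 <= r < 1]
    (fun r l => circle_modular p r (fun z => f z / l%:C))
    (fun r l => circle_modular (fun z => p (phi z)) r (fun z => f (phi z) / l%:C)) m A) => //.
  - by exists 0; rewrite /= lexx ltr01.
  - move=> r l k /= /andP[r0 r1] l0 k1; apply: circle_modular_dilate => //.
      by move=> z /pmM/andP[].
    by move=> z z1; exact: (exponent_ctsat regp z1).
  - move=> r l k /= /andP[r0 r1] l0 k1.
    have H1 z : normc z < 1 -> m <= p (phi z) by move=> /dphi/pmM/andP[].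
    have H2 z : normc z < 1 -> ctsat (fun z => p (phi z)) z.
      by move=> z1; exact: (ctsat_circ (derivable_continuous_at (aphi z z1)) (exponent_ctsat regp (dphi z z1))).
    have H3 := analytic_comp af aphi dphi.
    exact: (@circle_modular_dilate (fun z => p (phi z)) m r (fun z => f (phi z)) r0 r1 H1 H2 H3 k l k1).
  - by move=> r l _; exact: circle_modular_ge0.
  - move=> l l0 H r /= /andP[r0 r1].
    have H1 := @analytic_div f l af.
    have H2 r' (r'0 : 0 < r') (r'1 : r' < 1) : (circle_modular p r' (fun z => f z / l%:C)%R < 1)%E.
      by apply: H; rewrite /= (ltW r'0).
    exact: (HA (fun z => f z / l%:C) H1 H2 r r0 r1).
split.
  move=> f; rewrite /A_space /= eqxx => -[af Nf]; split; first exact: analytic_comp.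
  have [N0 H] := core f af; exact: homogeneous_lty Nf N0 H.
exists (dilation A m) => f; rewrite /A_space /A_norm /= !eqxx => -[af _].
by have [N0 H] := core f af; exact: homogeneous_bound d0 N0 H.
Qed.

End HardyOperator.

(** * Area measure and rotations *)

Section AreaMeasure.
Variable R : realType.
Local Open Scope ereal_scope.
Notation leb := (@lebesgue_measure R).
Notation Rm := (measurableTypeR R).
Notation plane := (measurableTypeR R * measurableTypeR R)%type.
Notation area := (@lebesgue_measure R \x @lebesgue_measure R).

Lemma measurable_affine (a k : R) :
  measurable_fun setT ((fun x => a + k * x)%R : Rm -> Rm).
Proof. by apply: measurable_funD => //; exact: mulrl_measurable. Qed.

Lemma affine_image_measure (a k : R) : exists nu : {measure set Rm -> \bar R},
  (nu : set Rm -> \bar R) = pushforward leb ((fun x => a + k * x)%R : Rm -> Rm).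
Proof.
have mf := measurable_affine a k.
by unshelve eexists [the {measure set Rm -> \bar R} of
  pushforward leb ((fun x => a + k * x)%R : Rm -> Rm)].
Qed.

Lemma integral_affine (a k : R) (g : Rm -> \bar R) : (0 < k)%R ->
  measurable_fun setT g -> (forall x, 0 <= g x) ->
  \int[leb]_x g x = k%:E * \int[leb]_x g (a + k * x)%R.
Proof.
move=> k0 mg g0; have mf := measurable_affine a k.
have [nu nuE] := affine_image_measure a k.
have lebE (A : set Rm) : measurable A -> leb A = mscale (NngNum (ltW k0)) nu A.
  move=> mA; apply: lebesgue_measure_unique => // _ [[x y] _ <-].
  rewrite /= /mscale /= nuE /pushforward /=.
  have -> : (fun x => a + k * x)%R @^-1` `]x, y]%classic = `]((x - a) / k)%R, ((y - a) / k)%R]%classic.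
    apply/seteqP; split=> z /=; rewrite !in_itv /= ltr_pdivrMr// ler_pdivlMr// ![(z * k)%R]mulrC;
      by rewrite ltrBlDl lerBrDl.
  rewrite !lebesgue_measure_itv /= !lte_fin ltr_pM2r ?invr_gt0// ltrD2r.
  case: ifPn => _; last by rewrite mule0.
  by rewrite -!EFinB -EFinM; congr EFin; field; rewrite gt_eqF.
rewrite (eq_measure_integral (mscale (NngNum (ltW k0)) nu)); last first.
  by move=> A mA _; exact: lebE.
rewrite ge0_integral_mscale//=; congr (_ * _).
by rewrite nuE ge0_integral_pushforward.
Qed.

Lemma area_iterated (g : plane -> \bar R) : measurable_fun setT g -> (forall x, 0 <= g x) ->
  \int[area]_q g q = \int[leb]_x \int[leb]_y g (x, y).
Proof. by move=> mg g0; rewrite fubini_tonelli1. Qed.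

Lemma area_iterated' (g : plane -> \bar R) : measurable_fun setT g -> (forall x, 0 <= g x) ->
  \int[area]_q g q = \int[leb]_y \int[leb]_x g (x, y).
Proof. by move=> mg g0; rewrite fubini_tonelli2. Qed.

Lemma measurable_pairing d (T : measurableType d) (u v : T -> Rm) :
  measurable_fun setT u -> measurable_fun setT v ->
  measurable_fun setT (fun t => (u t, v t) : plane).
Proof. by move=> mu mv; exact: measurable_fun_pair. Qed.

Lemma area_shear1 (t : R) (g : plane -> \bar R) : measurable_fun setT g ->
  (forall x, 0 <= g x) ->
  \int[area]_q g (q.1 + t * q.2, q.2)%R = \int[area]_q g q.
Proof.
move=> mg g0; rewrite !area_iterated'//; last first.
  apply: (measurableT_comp mg); apply: measurable_pairing => //.
  by apply: measurable_funD => //; apply: measurable_funM => //.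
apply: eq_integral => y _ /=.
rewrite [RHS](integral_affine (t * y) ltr01)//; last exact: (measurableT_comp mg).
by rewrite mul1e; apply: eq_integral => x _; rewrite mul1r addrC.
Qed.

Lemma area_shear2 (t : R) (g : plane -> \bar R) : measurable_fun setT g ->
  (forall x, 0 <= g x) ->
  \int[area]_q g (q.1, q.2 + t * q.1)%R = \int[area]_q g q.
Proof.
move=> mg g0; rewrite !area_iterated//; last first.
  apply: (measurableT_comp mg); apply: measurable_pairing => //.
  by apply: measurable_funD => //; apply: measurable_funM => //.
apply: eq_integral => x _ /=.
rewrite [RHS](integral_affine (t * x) ltr01)//; last exact: (measurableT_comp mg).
by rewrite mul1e; apply: eq_integral => y _; rewrite mul1r addrC.
Qed.

Lemma area_translate_scale (a b k : R) (g : plane -> \bar R) : (0 < k)%R ->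
  measurable_fun setT g -> (forall x, 0 <= g x) ->
  \int[area]_q g q = (k ^+ 2)%:E * \int[area]_q g (a + k * q.1, b + k * q.2)%R.
Proof.
move=> k0 mg g0.
have mg1 y : measurable_fun setT (fun x => g (x, y)) by exact: (measurableT_comp mg).
have mg2 : measurable_fun setT (fun q : plane => g (q.1, b + k * q.2)%R).
  apply: (measurableT_comp mg); apply: measurable_pairing => //.
  by apply: measurable_funD => //; apply: measurable_funM => //.
have mg3 : measurable_fun setT (fun q : plane => g (a + k * q.1, b + k * q.2)%R).
  apply: (measurableT_comp mg); apply: measurable_pairing => //.
    by apply: measurable_funD => //; apply: measurable_funM => //.
  by apply: measurable_funD => //; apply: measurable_funM => //.
transitivity (k%:E * \int[area]_q g (q.1, b + k * q.2)%R).
  rewrite !area_iterated// -ge0_integralZl//; last 3 first.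
  - exact: (measurable_fun_fubini_tonelli_F _ mg2).
  - by move=> x _; exact: integral_ge0.
  - by rewrite lee_fin ltW.
  apply: eq_integral => x _ /=.
  by rewrite [LHS](integral_affine b k0)//; exact: (measurableT_comp mg).
rewrite expr2 EFinM -muleA; congr (_ * _).
rewrite !area_iterated'// -ge0_integralZl//; last 3 first.
- exact: (measurable_fun_fubini_tonelli_G _ mg3).
- by move=> x _; exact: integral_ge0.
- by rewrite lee_fin ltW.
apply: eq_integral => y _ /=.
by rewrite [LHS](integral_affine a k0)//; exact: (measurableT_comp mg).
Qed.

Definition rot (c s : R) (q : plane) : plane := (c * q.1 - s * q.2, s * q.1 + c * q.2)%R.

Lemma measurable_rot (c s : R) : measurable_fun setT (rot c s).
Proof.
apply: measurable_pairing.
  by apply: measurable_funB; apply: measurable_funM.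
by apply: measurable_funD; apply: measurable_funM.
Qed.

(** A rotation other than the half turn is a product of three shears. *)
Lemma area_rot (c s : R) (g : plane -> \bar R) : (c ^+ 2 + s ^+ 2 = 1)%R ->
  measurable_fun setT g -> (forall x, 0 <= g x) ->
  \int[area]_q g (rot c s q) = \int[area]_q g q.
Proof.
have main (c' s' : R) (h : plane -> \bar R) : (c' ^+ 2 + s' ^+ 2 = 1)%R -> (c' != -1)%R ->
    measurable_fun setT h -> (forall x, 0 <= h x) ->
    \int[area]_q h (rot c' s' q) = \int[area]_q h q.
  move=> cs c1 mh h0; have c1' : (1 + c' != 0)%R by rewrite addrC -[1%R]opprK subr_eq0.
  pose t := (- s' / (1 + c'))%R.
  have st : (s' * t = c' - 1)%R.
    rewrite /t mulrA mulrN -expr2.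
    have -> : (s' ^+ 2 = 1 - c' ^+ 2)%R by rewrite -cs addrAC subrr add0r.
    by field.
  have ms1 (u : R) : measurable_fun setT (fun q : plane => (q.1 + u * q.2, q.2)%R : plane).
    by apply: measurable_pairing => //; apply: measurable_funD => //; apply: measurable_funM.
  have ms2 (u : R) : measurable_fun setT (fun q : plane => (q.1, q.2 + u * q.1)%R : plane).
    by apply: measurable_pairing => //; apply: measurable_funD => //; apply: measurable_funM.
  rewrite -(area_shear1 t mh h0).
  have mh1 := measurableT_comp mh (ms1 t).
  rewrite -(area_shear2 s' mh1)//=.
  have mh2 := measurableT_comp mh1 (ms2 s').
  rewrite -(area_shear1 t mh2)//=.
  apply: eq_integral => -[x y] _; rewrite /rot /=; congr (h (_, _)).
    have tc : (t * (1 + c') = - s')%R by rewrite /t divfK.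
    rewrite (_ : x + t * y + t * (y + s' * (x + t * y)) =
       x + (s' * t) * x + t * (2 + s' * t) * y)%R; last by ring.
    rewrite st (_ : t * (2 + (c' - 1)) = - s')%R; last by rewrite -tc; ring.
    by ring.
  rewrite (_ : y + s' * (x + t * y) = s' * x + y + (s' * t) * y)%R; last by ring.
  by rewrite st; ring.
move=> cs mg g0; have [c1|c1] := eqVneq c (-1)%R; last exact: main.
have s0 : s = 0%R.
  by move: cs; rewrite c1 sqrrN expr1n => /eqP; rewrite addrC -subr_eq0 addrK sqrf_eq0 => /eqP.
have c01 : (0 ^+ 2 + 1 ^+ 2 = 1 :> R)%R by rewrite expr0n expr1n add0r.
have n01 : (0 != -1 :> R)%R by rewrite eq_sym oppr_eq0 oner_neq0.
have mgr := measurableT_comp mg (measurable_rot 0%R 1%R).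
rewrite -(main 0%R 1%R g)// -(main 0%R 1%R _ c01 n01 mgr)//.
  by apply: eq_integral => -[x y] _; rewrite /rot c1 s0 /=; congr (g (_, _)); ring.
by move=> q; exact: g0.
Qed.

End AreaMeasure.

Section PlanarMeasure.
Variable R : realType.
Local Open Scope ereal_scope.
Notation leb := (@lebesgue_measure R).
Notation plane := (measurableTypeR R * measurableTypeR R)%type.
Notation area := (@lebesgue_measure R \x @lebesgue_measure R).

(** A copy of the area measure that carries its sigma-finite structure, which
Tonelli's theorem asks for. *)
Definition planar : set plane -> \bar R := area.

HB.instance Definition _ := Measure.copy planar area.

Lemma planar_sigma_finite : sigma_finite setT planar.
Proof.
have /sigma_finiteP[F [TF ndF Foo]] := sigma_finiteT leb.
exists (fun n => F n `*` F n).
  apply/esym/seteqP; split=> // -[x y] _.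
  have : setT x by []. rewrite TF => -[n _ Fx].
  have : setT y by []. rewrite TF => -[k _ Fy].
  exists (maxn n k) => //; split.
    by move: x Fx; exact/subsetPset/ndF/leq_maxl.
  by move: y Fy; exact/subsetPset/ndF/leq_maxr.
move=> k; have [mF Fk] := Foo k; split; first exact: measurableX.
by rewrite /planar product_measure1E// lte_mul_pinfty// ge0_fin_numE.
Qed.

HB.instance Definition _ := Measure_isSigmaFinite.Build _ _ _ planar planar_sigma_finite.

Lemma area_tonelli_line (H : plane * measurableTypeR R -> \bar R) : measurable_fun setT H ->
  (forall x, 0 <= H x) ->
  \int[area]_q \int[leb]_t H (q, t) = \int[leb]_t \int[area]_q H (q, t).
Proof. move=> mH H0. exact: (@fubini_tonelli _ _ plane (measurableTypeR R) R planar leb H mH H0). Qed.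

Lemma area_tonelli (H : plane * plane -> \bar R) : measurable_fun setT H ->
  (forall x, 0 <= H x) ->
  \int[area]_q \int[area]_t H (q, t) = \int[area]_t \int[area]_q H (q, t).
Proof. move=> mH H0. exact: (@fubini_tonelli _ _ plane plane R planar planar H mH H0). Qed.

Lemma area_tonelli_measurable (H : plane * plane -> \bar R) : measurable_fun setT H ->
  (forall x, 0 <= H x) -> measurable_fun setT (fun q => \int[area]_t H (q, t)).
Proof. move=> mH H0. exact: (@measurable_fun_fubini_tonelli_F _ _ plane plane R planar H mH H0). Qed.

End PlanarMeasure.

Section PlaneMeasurability.
Variable R : realType.
Notation plane := (measurableTypeR R * measurableTypeR R)%type.
Implicit Types (u : R[i] -> R) (f : R[i] -> R[i]).

(** An open set of the plane is a countable union of rational boxes. *)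
Lemma measurable_toC_open (O : set R[i]) :
  (forall z, O z -> exists2 e : R, 0 < e & forall w, normc (w - z) < e -> O w) ->
  measurable (@toC R @^-1` O : set plane).
Proof.
move=> oO.
pose box (k : rat * rat * rat) : set plane :=
  (ball (ratr k.1.1 : R) (ratr k.2)) `*` (ball (ratr k.1.2 : R) (ratr k.2)).
pose F k : set plane := if `[< box k `<=` @toC R @^-1` O >] then box k else set0.
have -> : @toC R @^-1` O = \bigcup_k F k.
  apply/seteqP; split=> [q Oq|q [k _]]; last first.
    by rewrite /F; case: ifPn => // /asboolP; apply.
  have [e e0 He] := oO _ Oq.
  have e4 : 0 < e / 4 by rewrite divr_gt0.
  have [c] := rat_in_itvoo e4; rewrite in_itv /= => /andP[c0 ce].
  have [a] := @rat_in_itvoo R (q.1 - ratr c) (q.1 + ratr c) (ltac:(lra)).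
  rewrite in_itv /= => /andP[a1 a2].
  have [b] := @rat_in_itvoo R (q.2 - ratr c) (q.2 + ratr c) (ltac:(lra)).
  rewrite in_itv /= => /andP[b1 b2].
  exists (a, b, c) => //; rewrite /F.
  have qb : box (a, b, c) q.
    by split; rewrite /ball /= ltr_norml; apply/andP; split; lra.
  case: ifPn => // /asboolPn; case=> q' [/=]; rewrite /ball /= => h1 h2.
  apply: He; apply: le_lt_trans (normc_le_ReIm _) _; rewrite /toC /=.
  have : `|q'.1 - q.1| < 2 * ratr c.
    by move: h1; rewrite !ltr_norml => /andP[? ?]; apply/andP; split; lra.
  have : `|q'.2 - q.2| < 2 * ratr c.
    by move: h2; rewrite !ltr_norml => /andP[? ?]; apply/andP; split; lra.
  lra.
apply: countable_bigcupT_measurable; first exact: countableP.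
move=> k; rewrite /F; case: ifPn => // _.
by apply: measurableX; exact: measurable_ball.
Qed.

Lemma measurable_ctsat u (r : R) : (forall z, normc z < r -> ctsat u z) ->
  measurable_fun (@toC R @^-1` [set z | normc z < r] : set plane) (fun q => u (toC q)).
Proof.
move=> cu; apply: (measurability _ (RGenOInfty.measurableE R)) => _ [_ [a ->] <-].
rewrite -[X in measurable X]/(@toC R @^-1` ([set z | normc z < r] `&` [set z | u z \in `]a, +oo[])).
apply: measurable_toC_open => z [/= zr]; rewrite in_itv /= andbT => az.
have [d d0 Hd] := (ctsatP u z).1 (cu z zr) (u z - a) (ltac:(by rewrite subr_gt0)).
exists (Num.min d (r - normc z)); first by rewrite lt_min d0 subr_gt0.
move=> w; rewrite lt_min => /andP[/Hd wd wr]; split => /=.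
  by rewrite -(subrK z w) (le_lt_trans (normcD _ _))// -ltrBrDr.
by rewrite in_itv /= andbT; move: wd; rewrite ltr_norml => /andP[+ _]; lra.
Qed.

Lemma measurable_toC_ball (w : R[i]) (r : R) :
  measurable (@toC R @^-1` [set z | normc (z - w) < r] : set plane).
Proof.
apply: measurable_toC_open => z /= zr; exists (r - normc (z - w)); first by rewrite subr_gt0.
by move=> v vz; rewrite -(subrKA z) (le_lt_trans (normcD _ _))// -ltrBrDr.
Qed.

(** Extension by 0 from the disc, so that all integrals run over the plane. *)
Definition ext u (q : plane) : R := if normc (toC q) < 1 then u (toC q) else 0.

Lemma measurable_normc_toC : measurable_fun setT (fun q : plane => normc (toC q)).
Proof.
have -> : (fun q : plane => normc (toC q)) = (fun q : plane => Num.sqrt (q.1 ^+ 2 + q.2 ^+ 2)) by [].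
apply: measurableT_comp; first by apply: continuous_measurable_fun; exact: sqrt_continuous.
by apply: measurable_funD; apply: measurable_funX.
Qed.

Lemma measurable_ext u : (forall z, normc z < 1 -> ctsat u z) ->
  measurable_fun setT (ext u).
Proof.
move=> cu; apply: measurable_fun_if => //.
- by apply: measurable_fun_ltr => //; exact: measurable_normc_toC.
- rewrite setTI; have := measurable_ctsat cu.
  by congr (measurable_fun _ _); apply/seteqP; split=> q.
Qed.

Lemma ext_ge0 u q : (forall z, normc z < 1 -> 0 <= u z) -> 0 <= ext u q.
Proof. by move=> u0; rewrite /ext; case: ifPn => // /u0. Qed.

Lemma toC_rot (t : R) (q : plane) : toC (rot (cos t) (sin t) q) = toC q * ept t.
Proof.
case: q => x y; rewrite /toC /rot /ept /=; apply/eqP; rewrite eq_complex /=.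
by rewrite ![cos t * _]mulrC ![sin t * _]mulrC !eqxx.
Qed.

Lemma normc_toC_rot (t : R) (q : plane) : normc (toC (rot (cos t) (sin t) q)) = normc (toC q).
Proof. by rewrite toC_rot normcM normc_ept mulr1. Qed.

End PlaneMeasurability.

Section RotationAverage.
Variable R : realType.
Local Open Scope ereal_scope.
Notation leb := (@lebesgue_measure R).
Notation plane := (measurableTypeR R * measurableTypeR R)%type.
Notation area := (@lebesgue_measure R \x @lebesgue_measure R).

(** Rotations preserve both the area and the weight, so each rotated integral is
the same, and Tonelli's theorem moves their average inside. *)
Lemma rotation_average (om G : plane -> R) :
  measurable_fun setT om -> measurable_fun setT G ->
  (forall q, (0 <= om q)%R) -> (forall q, (0 <= G q)%R) ->
  (forall t q, om (rot (cos t) (sin t) q) = om q) ->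
  \int[area]_q (om q * G q)%:E =
  \int[area]_q (((2 * pi)^-1)%:E * \int[leb]_(t in `[0%R, (2 * pi)%R])
     (om q * G (rot (cos t) (sin t) q))%:E).
Proof.
move=> mom mG om0 G0 omrot.
pose I := `[0%R, (2 * pi)%R]%classic : set R.
pose H (x : plane * measurableTypeR R) : \bar R :=
  (\1_I x.2 * (om x.1 * G (rot (cos x.2) (sin x.2) x.1)))%:E.
have H0 x : 0 <= H x by rewrite lee_fin !mulr_ge0.
have mH : measurable_fun setT H.
  apply/measurable_EFinP; apply: measurable_funM.
    by apply: (measurableT_comp (@measurable_indic _ _ R setT I _)) => //; exact: measurable_itv.
  apply: measurable_funM; first exact: (measurableT_comp mom).
  apply: (measurableT_comp mG).
  have mc : measurable_fun setT (fun x : plane * measurableTypeR R => cos x.2).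
    by apply: measurableT_comp => //; apply: continuous_measurable_fun; exact: continuous_cos.
  have ms : measurable_fun setT (fun x : plane * measurableTypeR R => sin x.2).
    by apply: measurableT_comp => //; apply: continuous_measurable_fun; exact: continuous_sin.
  have m1 : measurable_fun setT (fun x : plane * measurableTypeR R => x.1.1).
    exact: (measurableT_comp measurable_fst measurable_fst).
  have m2 : measurable_fun setT (fun x : plane * measurableTypeR R => x.1.2).
    exact: (measurableT_comp measurable_snd measurable_fst).
  apply: measurable_pairing.
    by apply: measurable_funB; apply: measurable_funM.
  by apply: measurable_funD; apply: measurable_funM.
have omG t : measurable_fun setT (fun q : plane => (om q * G (rot (cos t) (sin t) q))%:E).
  apply/measurable_EFinP; apply: measurable_funM => //.
  exact: (measurableT_comp mG (measurable_rot _ _)).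
have inI (h : R -> \bar R) : \int[leb]_(t in I) h t = \int[leb]_t ((\1_I t)%:E * h t).
  rewrite integral_mkcond; apply: eq_integral => t _.
  by rewrite patchE indicE; case: ifPn => _; rewrite ?mul1e ?mul0e.
have c0 : (0 <= (2 * pi)^-1 :> R)%R by exact: two_pi_inv_ge0.
rewrite ge0_integralZl//; last 2 first.
- have := measurable_fun_fubini_tonelli_F (m2 := leb) _ mH H0; congr (measurable_fun _ _).
  apply/funext => q; rewrite /fubini_F inI; apply: eq_integral => t _.
  by rewrite /H EFinM.
- by move=> q _; apply: integral_ge0 => t _; rewrite lee_fin mulr_ge0.
have -> : \int[area]_q \int[leb]_(t in I) (om q * G (rot (cos t) (sin t) q))%:E =
    \int[area]_q \int[leb]_t H (q, t).
  by apply: eq_integral => q _; rewrite inI; apply: eq_integral => t _; rewrite /H EFinM.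
rewrite area_tonelli_line//.
have -> : \int[leb]_t \int[area]_q H (q, t) =
    \int[leb]_t ((\1_I t)%:E * \int[area]_q (om q * G q)%:E).
  apply: eq_integral => t _; rewrite /H /=.
  under eq_integral do rewrite EFinM.
  rewrite ge0_integralZl//; last by move=> q _; rewrite lee_fin mulr_ge0.
  congr (_ * _).
  rewrite -(@area_rot R (cos t) (sin t) (fun q => (om q * G q)%:E)).
  - by apply: eq_integral => q _; rewrite omrot.
  - exact: cos2Dsin2.
  - by apply/measurable_EFinP; exact: measurable_funM.
  - by move=> q; rewrite lee_fin mulr_ge0.
rewrite -inI integral_cst; last exact: measurable_itv.
rewrite /= lebesgue_measure_itv /= lte_fin twopi_gt0 sube0 muleC -muleA -EFinM.
by rewrite mulfV ?mule1// gt_eqF// twopi_gt0.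
Qed.

End RotationAverage.

Section Monotone.
Variable R : realType.
Local Open Scope ereal_scope.

(** The integral of a nonnegative function is a supremum over the simple
functions below it, so monotonicity asks for no measurability. *)
Lemma ge0_le_integralT d (T : measurableType d) (mu : {measure set T -> \bar R})
    (g h : T -> \bar R) :
  (forall x, 0 <= g x) -> (forall x, g x <= h x) -> \int[mu]_x g x <= \int[mu]_x h x.
Proof.
move=> g0 gh; have h0 x : 0 <= h x by exact: le_trans (gh x).
rewrite !ge0_integralTE//; apply: le_ereal_sup => _ [k kg <-].
by exists k => // x; exact: le_trans (gh x).
Qed.

End Monotone.

Section Balls.
Variable R : realType.
Local Open Scope ereal_scope.
Notation leb := (@lebesgue_measure R).
Notation plane := (measurableTypeR R * measurableTypeR R)%type.
Notation area := (@lebesgue_measure R \x @lebesgue_measure R).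

Definition dball (w : R[i]) (r : R) : set plane :=
  @toC R @^-1` [set z | (normc (z - w) < r)%R].

Arguments dball (w r)%_ring_scope.

Lemma measurable_dball w r : measurable (dball w r).
Proof. exact: measurable_toC_ball. Qed.

Definition disc_area : R := fine (area (dball 0 1)).

Lemma dball01 (q : plane) : dball 0 1 q = (normc (toC q) < 1)%R :> Prop.
Proof. by rewrite /dball /preimage /mkset subr0. Qed.

Lemma dball_bounds : 0 < area (dball 0 1) /\ area (dball 0 1) < +oo.
Proof.
pose I (a : R) : set (measurableTypeR R) := `](- a)%R, a[%classic.
have mI a : measurable (I a) by exact: measurable_itv.
have areaI a : (0 < a)%R -> area (I a `*` I a) = ((2 * a) * (2 * a))%:E.
  move=> a0; have L : leb (I a) = (2 * a)%:E.
    rewrite /I lebesgue_measure_itv /= lte_fin ifT ?gtrN// -EFinD opprK.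
    by congr EFin; ring.
  have -> : area (I a `*` I a) = leb (I a) * leb (I a) by exact: product_measure1E.
  by rewrite L.
have mB := measurable_dball 0%R 1%R.
split.
  apply: (@lt_le_trans _ _ (area (I (2^-1)%R `*` I (2^-1)%R))).
    by rewrite areaI ?invr_gt0// lte_fin; lra.
  apply: le_measure; rewrite ?inE//; first exact: measurableX.
  move=> [x y] [/=]; rewrite /I /= !in_itv /= => /andP[x1 x2] /andP[y1 y2].
  rewrite dball01; apply: le_lt_trans (normc_le_ReIm _) _ => /=.
  have : (`|x| < 2^-1)%R by rewrite ltr_norml x1.
  have : (`|y| < 2^-1)%R by rewrite ltr_norml y1.
  lra.
apply: (@le_lt_trans _ _ (area (I 1%R `*` I 1%R))); last by rewrite areaI// ltry.
apply: le_measure; rewrite ?inE//; first exact: measurableX.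
move=> [x y]; rewrite dball01 => xy; rewrite /I; split; rewrite /= in_itv /= -ltr_norml.
  exact: le_lt_trans (ler_Re_normc (toC (x, y))) xy.
exact: le_lt_trans (ler_Im_normc (toC (x, y))) xy.
Qed.

Lemma disc_area_gt0 : (0 < disc_area)%R.
Proof. by have [a b] := dball_bounds; apply: fine_gt0; rewrite a b. Qed.

Lemma disc_areaE : area (dball 0 1) = disc_area%:E.
Proof.
by have [a b] := dball_bounds; rewrite fineK// ge0_fin_numE// ltW.
Qed.

Lemma area_indic (A : set plane) : measurable A -> area A = \int[area]_q (\1_A q)%:E.
Proof. by move=> mA; rewrite integral_indic// setIT. Qed.

Lemma toC_affine (w : R[i]) (r : R) (q : plane) :
  toC (complex.Re w + r * q.1, complex.Im w + r * q.2)%R = (w + r%:C * toC q)%R.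
Proof.
case: w q => a b [x y]; apply/eqP; rewrite eq_complex /=.
by rewrite !mul0r subr0 addr0 !eqxx.
Qed.

Lemma area_dball w r : (0 < r)%R -> area (dball w r) = (r ^+ 2 * disc_area)%:E.
Proof.
move=> r0; have mB := measurable_dball w r.
rewrite (area_indic mB).
have m1 : measurable_fun setT (fun q : plane => (\1_(dball w r) q)%:E : \bar R).
  by apply/measurable_EFinP; exact: measurable_indic.
rewrite (@area_translate_scale R (complex.Re w) (complex.Im w) r)//.
rewrite [RHS]EFinM; congr (_ * _).
rewrite -disc_areaE area_indic; last exact: measurable_dball.
apply: eq_integral => q _; congr (_%:E); rewrite !indicE; congr ((nat_of_bool _)%:R).
apply/idP/idP; rewrite !inE dball01 /dball /preimage /mkset toC_affine [(w + _)%R]addrC addrK;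
  by rewrite normcM normcR_ge0 ?(ltW r0)// -ltr_pdivlMl// mulVf ?gt_eqF.
Qed.

(** Against a radial weight a function counts only through its circle means. *)
Lemma rotation_mean (om G : plane -> R) (u : plane -> R -> R) :
  measurable_fun setT om -> measurable_fun setT G ->
  (forall q, (0 <= om q)%R) -> (forall q, (0 <= G q)%R) ->
  (forall t q, om (rot (cos t) (sin t) q) = om q) ->
  (forall q, (0 < om q)%R -> continuous (u q) /\
     forall t, G (rot (cos t) (sin t) q) = u q t) ->
  \int[area]_q (om q * G q)%:E = \int[area]_q (om q * cmean (u q))%:E.
Proof.
move=> mom mG om0 G0 omr Hu; rewrite rotation_average//.
apply: eq_integral => q _.
have [omq0|omq] := eqVneq (om q) 0%R.
  rewrite omq0 mul0r; under eq_integral do rewrite mul0r.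
  by rewrite integral0 mule0.
have {}omq : (0 < om q)%R by rewrite lt_neqAle eq_sym omq om0.
have [cu Gu] := Hu q omq.
under eq_integral do rewrite Gu.
rewrite -EFin_cmean; first by rewrite cmeanZ//; exact: cint_continuous.
by move=> t; apply: cvgM; [exact: cvg_cst|exact: cu].
Qed.

End Balls.
Arguments dball {R} (w r)%_ring_scope.

(** * Pointwise estimate on balls *)

Section AreaMean.
Variable R : realType.
Implicit Types (f : R[i] -> R[i]) (w zeta : R[i]).
Notation leb := (@lebesgue_measure R).
Notation plane := (measurableTypeR R * measurableTypeR R)%type.
Notation area := (@lebesgue_measure R \x @lebesgue_measure R)%E.

Lemma affine_disc w zeta z : normc w < 1 -> 2 * normc zeta <= 1 - normc w ->
  normc z < 1 -> normc (w + 2%:C * zeta * z) < 1.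
Proof.
move=> w1 zw z1; apply: le_lt_trans (normcD _ _) _.
rewrite !normcM normcR_ge0 ?ler0n//.
have H := ler_wpM2r (normc_ge0 z) zw.
have : (1 - normc w) * normc z < (1 - normc w) * 1 by rewrite ltr_pM2l// subr_gt0.
by lra.
Qed.

(** The circle in question is the image of the circle of radius 1/2 under
z -> w + 2 zeta z, which maps the unit disc into itself, and at the centre of a
circle the Poisson kernel is 1. *)
Lemma logp_le_cmean f w zeta : analytic_on_disc f -> normc w < 1 ->
  2 * normc zeta <= 1 - normc w ->
  logp f w <= cmean (fun t => logp f (w + zeta * ept t)).
Proof.
move=> af w1 zw.
pose h (z : R[i]) : R[i] := w + 2%:C * zeta * z.
have dh z : disc z -> disc (h z) by move=> z1; exact: affine_disc.
have ah : analytic_on_disc h.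
  move=> z _; exact: (cderD (@cder_cst R w z) (cderM (@cder_cst R (2%:C * zeta) z) (@cder_id R z))).
have ag := analytic_comp af ah dh.
have h0 : 0 < 2^-1 :> R by rewrite invr_gt0.
have h1 : 2^-1 < 1 :> R by rewrite invf_lt1// ltr1n.
have n0 : normc (0 : R[i]) < 2^-1 by rewrite (@normc0 R).
have := logp_le_poisson ag h0 h1 n0.
have -> : logp (fun z => f (h z)) 0 = logp f w by rewrite /logp /h mulr0 addr0.
move=> /le_trans; apply; rewrite /poisson le_eqVlt; apply/orP; left; apply/eqP.
apply: eq_cmean => t; rewrite mulr0 pkE ?(@normc0 R)//.
rewrite expr0n subr0 subr0 (@normc1 R) expr1n divr1 mul1r.
rewrite -[LHS]/(logp f (h ((2^-1)%:C * ept t))); congr (logp f _); rewrite /h; congr (_ + _).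
rewrite mulrA -[2%:C * zeta * _]mulrA [zeta * _]mulrC mulrA.
by rewrite (_ : 2%:C * (2^-1)%:C = 1) ?mul1r// -rmorphM mulfV ?rmorph1// pnatr_eq0.
Qed.

(** The estimate on circles is integrated over the radius in the form of a
rotation average. *)
Lemma logp_area_mean f w (rho : R) : analytic_on_disc f -> normc w < 1 -> 0 < rho ->
  2 * rho <= 1 - normc w ->
  ((logp f w * (rho ^+ 2 * disc_area R))%:E <=
    \int[area]_q (\1_(dball w rho) q * ext (logp f) q)%:E)%E.
Proof.
move=> af w1 r0 rw.
have cl z : normc z < 1 -> ctsat (logp f) z by move=> z1; exact: (logp_ctsat (af z z1)).
have me := measurable_ext cl.
have mi v : measurable_fun setT (\1_(dball v rho) : plane -> R).
  by apply: measurable_indic; exact: measurable_dball.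
have e0 q : 0 <= ext (logp f) q by apply: ext_ge0 => z _; exact: logp_ge0.
pose T (q : plane) : plane := (complex.Re w + 1 * q.1, complex.Im w + 1 * q.2).
have TE q : toC (T q) = w + toC q by rewrite toC_affine mul1r.
have mT : measurable_fun setT T.
  by apply: measurable_pairing; apply: measurable_funD => //; apply: measurable_funM.
have TB q : (\1_(dball w rho) (T q) : R) = \1_(dball 0 rho) q.
  rewrite !indicE; congr ((nat_of_bool _)%:R).
  by apply/idP/idP; rewrite !inE /dball /preimage /mkset TE [w + _]addrC addrK subr0.
have -> : (\int[area]_q (\1_(dball w rho) q * ext (logp f) q)%:E =
    \int[area]_q (\1_(dball 0 rho) q * ext (logp f) (T q))%:E)%E.
  rewrite (@area_translate_scale R (complex.Re w) (complex.Im w) 1)//.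
  - by rewrite expr1n mul1e; apply: eq_integral => q _; rewrite -[(_, _)]/(T q) TB.
  - by apply/measurable_EFinP; exact: measurable_funM.
  - by move=> q; rewrite lee_fin mulr_ge0.
have zr q : 0 < (\1_(dball 0 rho) q : R) -> normc (toC q) < rho.
  by rewrite indicE; case: (boolP (q \in _)) => [|_]; rewrite ?ltxx// inE /dball /preimage /mkset subr0.
have win v : normc v < rho -> normc (w + v) < 1.
  move=> vr; apply: le_lt_trans (normcD _ _) _.
  by apply: lt_le_trans (_ : normc w + 2 * rho <= 1); rewrite ?ltrD2l; lra.
rewrite (@rotation_mean R (\1_(dball 0 rho)) (fun q => ext (logp f) (T q))
  (fun q t => logp f (w + toC q * ept t)))//; last 3 first.
- exact: (measurableT_comp me mT).
- move=> t q; rewrite !indicE; congr ((nat_of_bool _)%:R).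
  by apply/idP/idP; rewrite !inE /dball /preimage /mkset !subr0 normc_toC_rot.
- move=> q /zr qr.
  have wt t : normc (w + toC q * ept t) < 1 by apply: win; rewrite normcM normc_ept mulr1.
  split=> t; last by rewrite /ext TE toC_rot wt.
  have cp : ccat (fun t => w + toC q * ept t) t.
    exact: (ccatD (@ccat_cst R w t) (ccatM (@ccat_cst R (toC q) t) (@continuous_ept R t))).
  exact: (ctsat_path cp (cl _ (wt t))).
rewrite EFinM -(@area_dball R 0 rho)// area_indic; last exact: measurable_dball.
have mi' : measurable_fun setT (fun q : plane => ((\1_(dball 0 rho) q)%:E : \bar R)).
  by apply/measurable_EFinP; exact: mi.
rewrite -(@ge0_integralZl _ _ R area setT measurableT _ mi'); last 2 first.
- by move=> q _; rewrite lee_fin.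
- by rewrite lee_fin logp_ge0.
apply: ge0_le_integralT => q.
  by rewrite -EFinM lee_fin mulr_ge0// logp_ge0.
rewrite -EFinM lee_fin mulrC.
  have [->|q0] := eqVneq (\1_(dball 0 rho) q : R) 0; first by rewrite !mul0r.
  apply: ler_wpM2l => //; apply: logp_le_cmean => //.
  apply: le_trans rw; rewrite ler_pM2l// ltW// zr// lt_neqAle eq_sym q0 /=.
  by rewrite indicE.
Qed.

End AreaMean.

Section BergmanPointwise.
Variable R : realType.
Implicit Types (f : R[i] -> R[i]) (w z : R[i]).
Notation leb := (@lebesgue_measure R).
Notation plane := (measurableTypeR R * measurableTypeR R)%type.
Notation area := (@lebesgue_measure R \x @lebesgue_measure R)%E.

(** Comparable numbers have comparable powers, for exponents of either sign. *)
Lemma powR_comparable (x y c al : R) : 0 < x -> 0 < y -> 0 < c ->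
  x <= c * y -> y <= c * x -> x `^ al <= c `^ `|al| * y `^ al.
Proof.
move=> x0 y0 c0 xy yx.
have lxy : ln x <= ln c + ln y by rewrite -lnM ?posrE// ler_ln ?posrE ?mulr_gt0.
have lyx : ln y <= ln c + ln x by rewrite -lnM ?posrE// ler_ln ?posrE ?mulr_gt0.
rewrite /powR !gt_eqF// -expRD ler_expR.
have [a0|a0] := leP 0 al.
  by rewrite ger0_norm// -mulrDr ler_wpM2l.
by rewrite ltr0_norm// mulNr addrC -mulrBr ler_wnM2l ?(ltW a0)// lerBlDl.
Qed.

Definition weight (al : R) z : R := (1 - normc z ^+ 2) `^ al.

Lemma measurable_weight (al : R) : measurable_fun setT (fun q : plane => weight al (toC q)).
Proof.
apply: (@measurableT_comp _ _ _ _ _ _ (fun x : R => x `^ al)); first exact: measurable_powR.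
by apply: measurable_funB => //; apply: measurable_funX; exact: measurable_normc_toC.
Qed.

Lemma measurable_ext_weight (al : R) : measurable_fun setT (ext (weight al) : plane -> R).
Proof.
apply: measurable_fun_if => //.
- by apply: measurable_fun_ltr => //; exact: measurable_normc_toC.
- apply: (measurable_funS (E := setT)) => //; exact: measurable_weight.
Qed.

Lemma weight_ge0 (al : R) z : 0 <= weight al z. Proof. exact: powR_ge0. Qed.

Lemma dball_disc w q : normc w < 1 -> dball w ((1 - normc w) / 2) q ->
  normc (toC q) < 1 /\ (1 - normc w) / 2 < 1 - normc (toC q).
Proof.
move=> w1; rewrite /dball /preimage /mkset => qw.
have : normc (toC q) <= normc (toC q - w) + normc w.
  by have := normcD (toC q - w) w; rewrite subrK.
by move: qw w1; split; lra.
Qed.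

Lemma weight_ball_ge (al : R) w q : normc w < 1 -> dball w ((1 - normc w) / 2) q ->
  1 <= ((1 - normc w) / 2)^-1 `^ `|al| * weight al (toC q).
Proof.
move=> w1 qw; have [q1 qd] := dball_disc w1 qw.
have w0 := normc_ge0 w; have q0 := normc_ge0 (toC q).
set rho := (1 - normc w) / 2 in qd *.
have r0 : 0 < rho by rewrite /rho divr_gt0// subr_gt0.
have v1 : 1 - normc (toC q) ^+ 2 <= 1 by rewrite gerBl sqr_ge0.
have vr : rho <= 1 - normc (toC q) ^+ 2.
  apply: le_trans (ltW qd) _; rewrite lerD2l lerN2 expr2.
  by rewrite ler_piMr// ltW.
have r1 : rho <= 1 by exact: le_trans vr v1.
have v0 := lt_le_trans r0 vr.
have E1 : 1 `^ al = 1 :> R by rewrite powR1.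
rewrite -[X in X <= _]E1; apply: powR_comparable => //.
- by rewrite invr_gt0.
- by rewrite ler_pdivlMl// mulr1.
- by rewrite mulr1; apply: le_trans v1 _; rewrite invf_ge1.
Qed.

(** ln H is O(ln (1/eta)) because H is at most a power of 1/eta, and this is what
the logarithmic modulus of continuity compensates. *)
Lemma log_average_le (C m c1 be eta H : R) : 0 < m -> 0 <= C -> 0 < c1 -> 0 <= be ->
  0 < eta -> eta <= 2^-1 -> 1 <= H -> H <= c1 * (eta^-1) `^ be ->
  m ^- 2 * (C / ln (eta^-1)) * ln H <= m ^- 2 * C * (`|ln c1| / ln 2 + be).
Proof.
move=> m0 C0 c10 be0 e0 e2 H1 Hle.
have ei : 2 <= eta^-1 by rewrite -[X in X <= _]invrK lef_pV2 ?posrE ?invr_gt0.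
have l2 : 0 < ln 2 :> R by rewrite ln_gt0// ltr1n.
have le2 : ln 2 <= ln (eta^-1) by rewrite ler_ln ?posrE ?invr_gt0.
have l0 := lt_le_trans l2 le2.
have lH : ln H <= `|ln c1| + be * ln (eta^-1).
  apply: (@le_trans _ _ (ln (c1 * (eta^-1) `^ be))).
    by rewrite ler_ln ?posrE ?mulr_gt0 ?powR_gt0 ?invr_gt0// (lt_le_trans ltr01).
  by rewrite lnM ?posrE ?powR_gt0 ?invr_gt0// ln_powR lerD2r ler_norm.
rewrite -!mulrA; apply: ler_wpM2l; first by rewrite invr_ge0 sqr_ge0.
apply: ler_wpM2l => //; rewrite mulrC ler_pdivrMr//.
apply: le_trans lH _; rewrite mulrDl lerD2r.
by rewrite mulrAC ler_pdivlMr// ler_wpM2l.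
Qed.

End BergmanPointwise.

Section BergmanEstimate.
Variable R : realType.
Implicit Types (f : R[i] -> R[i]) (w z : R[i]) (p : R[i] -> R).
Notation leb := (@lebesgue_measure R).
Notation plane := (measurableTypeR R * measurableTypeR R)%type.
Notation area := (@lebesgue_measure R \x @lebesgue_measure R)%E.

(** The argument of modp_le_poisson with the uniform average over the ball of
radius d/2 about w, where d is the distance to the unit circle: there 1/p
oscillates by O(1 / ln (1/d)), and the average of modp p f is at most a power of
1/d since the weight is at least (d/2)^|al|. *)
Lemma modp_le_area p m M C (al A0 : R) : regular_exponent p m M C -> 0 < A0 ->
  exists2 K : R, 0 <= K & forall f, analytic_on_disc f ->
    (\int[area]_q (ext (weight al) q * ext (modp p f) q)%:E <= A0%:E)%E ->
    forall w, normc w < 1 ->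
      ((modp p f w)%:E <= (K / (1 - normc w) ^+ 2)%:E *
         \int[area]_q (\1_(dball w ((1 - normc w) / 2)) q * ext (modp p f) q)%:E)%E.
Proof.
move=> regp A00; have [m0 pmM C0 pH] := regp.
have a1 := disc_area_gt0 R; set A1 := disc_area R in a1 *.
pose c := m ^- 2 * C * (`|ln (A0 / A1)| / ln 2 + (`|al| + 2)).
have c0 : 0 <= c.
  rewrite /c !mulr_ge0 ?invr_ge0 ?sqr_ge0// addr_ge0 ?addr_ge0// divr_ge0//.
  by rewrite ltW// ln_gt0// ltr1n.
have Q0 : 0 <= m^-1 by rewrite invr_ge0 ltW.
exists (expR (M * (c + m^-1)) * 4 / A1).
  by rewrite divr_ge0 ?(ltW a1)// mulr_ge0// expR_ge0.
move=> f af HA w w1; have w0 := normc_ge0 w.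
set d := 1 - normc w; set rho := d / 2; set B := dball w rho.
have d0 : 0 < d by rewrite subr_gt0.
have d1 : d <= 1 by rewrite gerBl.
have r0 : 0 < rho by rewrite divr_gt0.
have r2 : rho <= 2^-1 by rewrite /rho ler_piMl// invr_ge0.
have r1 : rho < 1 by apply: le_lt_trans r2 _; rewrite invf_lt1// ltr1n.
pose E := ext (modp p f) : plane -> R.
have cE z : normc z < 1 -> ctsat (modp p f) z.
  by move=> z1; exact: (modp_ctsat regp z1 (af z z1)).
have mE : measurable_fun setT E := measurable_ext cE.
have E0 q : 0 <= E q by apply: ext_ge0 => z _; rewrite ltW// modp_gt0.
have cL z : normc z < 1 -> ctsat (logp f) z by move=> z1; exact: (logp_ctsat (af z z1)).
have mL : measurable_fun setT (ext (logp f) : plane -> R) := measurable_ext cL.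
have mB : measurable_fun setT (\1_B : plane -> R).
  by apply: measurable_indic; exact: measurable_dball.
have mBE : measurable_fun setT (fun q : plane => \1_B q * E q) by exact: measurable_funM.
have B0 q : 0 <= (\1_B q : R) by [].
have inB q : (\1_B q : R) = 0 \/ (\1_B q : R) = 1 /\ B q.
  rewrite indicE; have [|_] := boolP (q \in B); last by left.
  by rewrite inE; right.
set I := (\int[area]_q (\1_B q * E q)%:E)%E.
have I0 : (0 <= I)%E by apply: integral_ge0 => q _; rewrite lee_fin mulr_ge0.
have W0 q : 0 <= ext (weight al) q :> R by apply: ext_ge0 => z _; exact: weight_ge0.
have IA : (I <= (rho^-1 `^ `|al| * A0)%:E)%E.
  rewrite EFinM; apply: (@le_trans _ _ ((rho^-1 `^ `|al|)%:E *
      \int[area]_q (ext (weight al) q * E q)%:E)%E); last first.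
    by apply: lee_wpmul2l => //; rewrite lee_fin powR_ge0.
  have mWE : measurable_fun setT (fun q : plane => (ext (weight al) q * E q)%:E : \bar R).
    by apply/measurable_EFinP; apply: measurable_funM => //; exact: measurable_ext_weight.
  rewrite -(@ge0_integralZl _ _ R area setT measurableT _ mWE); last 2 first.
  - by move=> q _; rewrite lee_fin mulr_ge0.
  - by rewrite lee_fin powR_ge0.
  apply: ge0_le_integralT => q; first by rewrite lee_fin mulr_ge0.
  rewrite -EFinM lee_fin mulrA; apply: ler_wpM2r; first exact: E0.
  have [->|[-> qB]] := inB q; first by rewrite mulr_ge0 ?powR_ge0.
  have [q1 _] := dball_disc w1 qB.
  by rewrite /ext q1; exact: weight_ball_ge.
have Ifin : (I < +oo)%E by apply: le_lt_trans IA _; exact: ltry.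
have IJ : I = (fine I)%:E by rewrite fineK// ge0_fin_numE.
set J := fine I in IJ.
have AB : 0 < rho ^+ 2 * A1 by rewrite mulr_gt0// exprn_gt0.
have areaB : (\int[area]_q (\1_B q)%:E = (rho ^+ 2 * A1)%:E)%E.
  by rewrite -(@area_dball R w)// area_indic//; exact: measurable_dball.
have mB' : measurable_fun setT (fun q : plane => (\1_B q)%:E : \bar R).
  by apply/measurable_EFinP; exact: mB.
have mBE' : measurable_fun setT (fun q : plane => (\1_B q * E q)%:E : \bar R).
  by apply/measurable_EFinP; exact: mBE.
have JB : rho ^+ 2 * A1 <= J.
  rewrite -lee_fin -IJ -areaB; apply: ge0_le_integralT => q; first by rewrite lee_fin.
  rewrite lee_fin; have [->|[-> qB]] := inB q; first by rewrite mul0r.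
  have [q1 _] := dball_disc w1 qB.
  by rewrite mul1r /E /ext q1; exact: (modp_ge1 regp).
pose H := J / (rho ^+ 2 * A1).
have H1 : 1 <= H by rewrite /H ler_pdivlMr// mul1r.
have H0 : 0 < H by exact: lt_le_trans H1.
have HJ : H * (rho ^+ 2 * A1) = J by rewrite /H divfK// gt_eqF.
have HA1 : H <= A0 / A1 * rho^-1 `^ (`|al| + 2).
  rewrite /H ler_pdivrMr//; move: IA; rewrite IJ lee_fin => /le_trans; apply.
  rewrite powRD; last by rewrite gt_eqF ?invr_gt0// implybT.
  rewrite (@powR_mulrn _ _ 2) ?invr_ge0 ?(ltW r0)//.
  by rewrite le_eqVlt; apply/orP; left; apply/eqP; field; rewrite !gt_eqF.
have om0 : 0 <= m ^- 2 * (C / ln (rho^-1)).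
  by rewrite mulr_ge0 ?invr_ge0 ?sqr_ge0// divr_ge0// ltW// lnV_gt0.
have [pw_ge pw_le] := andP (pmM w w1).
have pw0 : 0 < p w by exact: lt_le_trans pw_ge.
have lnH : 0 <= ln H by rewrite ln_ge0.
pose qb := (p w)^-1 + m ^- 2 * (C / ln (rho^-1)).
have qb0 : 0 <= qb by rewrite addr_ge0// invr_ge0 ltW.
have point q : (\1_B q * ext (logp f) q : R) <= ln H * qb * \1_B q + m^-1 / H * (\1_B q * E q).
  have [->|[-> qB]] := inB q; first by rewrite !mul0r !mulr0 addr0.
  have [q1 _] := dball_disc w1 qB.
  rewrite !mul1r mulr1 /E /ext q1 (logp_modp regp)//.
  apply: le_trans (weighted_ln_le (inv_exponent_ge0 regp q1) (inv_exponent_le regp q1) (modp_gt0 p f _) H0) _.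
  rewrite lerD2r; apply: ler_wpM2l => //.
  have := inv_exponent_dist regp q1 w1 r0 r1 (ltW qB).
  by move=> /(le_trans (ler_norm _)); rewrite lerBlDl.
have LE : logp f w <= ln H * qb + m^-1.
  have rw : 2 * rho <= 1 - normc w by rewrite /rho mulrCA mulfV// mulr1.
  have := logp_area_mean af w1 r0 rw; rewrite -/B => /le_trans.
  move=> /(_ ((ln H * qb + m^-1) * (rho ^+ 2 * A1))%:E).
  rewrite lee_fin ler_pM2r//; apply.
  apply: (@le_trans _ _ (\int[area]_q ((ln H * qb)%:E * (\1_B q)%:E + (m^-1 / H)%:E * (\1_B q * E q)%:E))%E).
    apply: ge0_le_integralT => q.
      by rewrite lee_fin mulr_ge0//; apply: ext_ge0 => z _; exact: logp_ge0.
    by rewrite -!EFinM -EFinD lee_fin.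
  have k1 : 0 <= ln H * qb by rewrite mulr_ge0.
  have k2 : 0 <= m^-1 / H by rewrite divr_ge0// ltW.
  have g1 (q : plane) : setT q -> (0 <= (ln H * qb)%:E * (\1_B q)%:E :> \bar R)%E.
    by move=> _; rewrite -EFinM lee_fin mulr_ge0.
  have g2 (q : plane) : setT q -> (0 <= (m^-1 / H)%:E * (\1_B q * E q)%:E :> \bar R)%E.
    by move=> _; rewrite -EFinM lee_fin; apply: mulr_ge0 => //; exact: mulr_ge0.
  have mg1 := measurable_funeM (ln H * qb)%:E mB'.
  have mg2 := measurable_funeM (m^-1 / H)%:E mBE'.
  rewrite (ge0_integralD _ measurableT g1 mg1 g2 mg2).
  rewrite (@ge0_integralZl _ _ R area setT measurableT _ mB'); last 2 first.
  - by move=> q _; rewrite lee_fin.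
  - by rewrite lee_fin.
  rewrite (@ge0_integralZl _ _ R area setT measurableT _ mBE'); last 2 first.
  - by move=> q _; rewrite lee_fin mulr_ge0.
  - by rewrite lee_fin.
  rewrite areaB -/I IJ -!EFinM -EFinD lee_fin -HJ mulrDl.
  by rewrite [m^-1 / H * _]mulrA divfK// gt_eqF.
have be0 : 0 <= `|al| + 2 by rewrite addr_ge0.
have A01 : 0 < A0 / A1 by rewrite divr_gt0.
have omc := log_average_le m0 C0 A01 be0 r0 r2 H1 HA1.
have := exponent_transfer pw0 pw_le H1 Q0 (lexx qb) omc c0 LE.
rewrite -/(modp p f w) -/I IJ -EFinM lee_fin => /le_trans; apply.
rewrite le_eqVlt; apply/orP; left; apply/eqP.
by rewrite /H /rho; field; rewrite !gt_eqF.
Qed.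

End BergmanEstimate.

(** * Pull-back of the weight *)

Section Shells.
Variable R : realType.
Notation leb := (@lebesgue_measure R).
Notation plane := (measurableTypeR R * measurableTypeR R)%type.
Notation area := (@lebesgue_measure R \x @lebesgue_measure R)%E.

Lemma integral_indicM d (T : measurableType d) (mu : {measure set T -> \bar R})
    (D : set T) (g : T -> R) :
  (\int[mu]_(x in D) (g x)%:E = \int[mu]_x (\1_D x * g x)%:E)%E.
Proof.
rewrite integral_mkcond; apply: eq_integral => x _.
by rewrite patchE indicE; case: (x \in D); rewrite ?mul1r ?mul0r.
Qed.

Definition depth (q : plane) : R := 1 - normc (toC q) ^+ 2.

Definition shell (a b : R) : set plane := [set q | a < depth q <= b].

Lemma measurable_depth : measurable_fun setT depth.
Proof.
by apply: measurable_funB => //; apply: measurable_funX; exact: measurable_normc_toC.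
Qed.

Lemma measurable_shell a b : measurable (shell a b).
Proof.
have -> : shell a b = setT `&` depth @^-1` `]a, b]%classic.
  by rewrite setTI; apply/seteqP; split=> q; rewrite /= in_itv.
by apply: measurable_depth => //; exact: measurable_itv.
Qed.

Lemma depth_gt0 q : (0 < depth q) = (normc (toC q) < 1).
Proof. by rewrite subr_gt0 expr_lt1// normc_ge0. Qed.

Lemma depth_le1 q : depth q <= 1.
Proof. by rewrite gerBl sqr_ge0. Qed.

Lemma ext_weight_ge0 (al : R) (q : plane) : (0 <= (ext (weight al) q)%:E)%E.
Proof. by rewrite lee_fin; apply: ext_ge0 => z _; exact: weight_ge0. Qed.

(** The shell lies in the unit disc and misses the concentric disc of area
(1 - b) times as large. *)
Lemma area_shell_le a b : 0 <= a -> 0 < b -> (area (shell a b) <= (b * disc_area R)%:E)%E.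
Proof.
move=> a0 b0; have A1 := ltW (disc_area_gt0 R).
have mD := measurable_dball (0 : R[i]) 1; have mS := measurable_shell a b.
have SD : shell a b `<=` dball 0 1.
  by move=> q /andP[aq _]; rewrite dball01 -depth_gt0; exact: le_lt_trans aq.
have [b1|b1] := leP 1 b.
  apply: (@le_trans _ _ (area (dball 0 1))); first by apply: le_measure; rewrite ?inE.
  by rewrite disc_areaE lee_fin ler_peMl.
have b10 : 0 <= 1 - b by rewrite subr_ge0 ltW.
pose r := Num.sqrt (1 - b).
have r0 : 0 < r by rewrite sqrtr_gt0 subr_gt0.
have mr := measurable_dball (0 : R[i]) r.
have dr q : dball 0 r q -> b < depth q.
  rewrite /dball /preimage /mkset subr0 => qr.
  have : normc (toC q) ^+ 2 < r ^+ 2 by rewrite ltr_pXn2r ?nnegrE ?normc_ge0// ltW.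
  by rewrite (sqr_sqrtr b10) /depth => H; lra.
have dis : shell a b `&` dball 0 r = set0.
  by apply/seteqP; split=> // q [/andP[_ qb] /dr]; rewrite ltNge qb.
have sub : shell a b `|` dball 0 r `<=` dball 0 1.
  by move=> q [/SD//|/dr qb]; rewrite dball01 -depth_gt0 (lt_trans b0 qb).
have : (area (shell a b `|` dball 0 r) <= area (dball 0 1))%E.
  by apply: le_measure => //; rewrite inE//; exact: measurableU.
have -> : area (shell a b `|` dball 0 r) = (area (shell a b) + area (dball 0 r))%E.
  exact: measureU.
rewrite disc_areaE area_dball// (sqr_sqrtr b10).
rewrite -leeBrDr// -EFinB => /le_trans; apply; rewrite lee_fin; lra.
Qed.

Definition shell_const (al : R) : R :=
  2 `^ `|al| * disc_area R / (1 - 2^-1 `^ (1 + al)).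

Lemma half_powR_lt1 (al : R) : -1 < al -> 2^-1 `^ (1 + al) < 1 :> R.
Proof.
move=> al1; have a0 : 0 < 1 + al by lra.
have E1 : 1 `^ (1 + al) = 1 :> R by rewrite powR1.
by rewrite -[X in _ < X]E1 gt0_ltr_powR// ?nnegrE ?invr_ge0// invf_lt1// ltr1n.
Qed.

Lemma shell_const_ge0 (al : R) : -1 < al -> 0 <= shell_const al.
Proof.
move=> al1; rewrite /shell_const divr_ge0//; last by rewrite subr_ge0 ltW// half_powR_lt1.
by rewrite mulr_ge0 ?powR_ge0// ltW// disc_area_gt0.
Qed.

Lemma powR_mulS (x al : R) : 0 < x -> x * x `^ al = x `^ (1 + al).
Proof.
move=> x0; rewrite powRD; last by rewrite (gt_eqF x0) implybT.
by rewrite powRr1// ltW.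
Qed.

Lemma shell_dyadic_le (al t : R) : 0 < t ->
  (\int[area]_q (\1_(shell (t / 2) t) q * ext (weight al) q)%:E <=
     (2 `^ `|al| * disc_area R * t `^ (1 + al))%:E)%E.
Proof.
move=> t0; have mS := measurable_shell (t / 2) t.
have t20 : 0 < t / 2 by rewrite divr_gt0.
have m1 : measurable_fun setT (fun q : plane => (\1_(shell (t / 2) t) q)%:E : \bar R).
  by apply/measurable_EFinP; exact: measurable_indic.
apply: (@le_trans _ _ (\int[area]_q ((2 `^ `|al| * t `^ al)%:E * (\1_(shell (t / 2) t) q)%:E))%E).
  apply: ge0_le_integralT => q.
    by rewrite lee_fin mulr_ge0//; apply: ext_ge0 => z _; exact: weight_ge0.
  rewrite -EFinM lee_fin mulrC indicE.
  have [|_] := boolP (q \in _); last by rewrite !mulr0.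
  rewrite inE => /andP[q1 q2]; have v0 := lt_trans t20 q1.
  rewrite !mulr1 /ext -depth_gt0 v0; apply: powR_comparable => //; rewrite -/(depth q); lra.
rewrite (@ge0_integralZl _ _ R area setT measurableT _ m1); last 2 first.
- by move=> q _; rewrite lee_fin.
- by rewrite lee_fin mulr_ge0// powR_ge0.
rewrite -(area_indic mS) -powR_mulS//.
have -> : (2 `^ `|al| * disc_area R * (t * t `^ al))%:E =
   ((2 `^ `|al| * t `^ al)%:E * (t * disc_area R)%:E)%E.
  by rewrite -EFinM; congr EFin; ring.
apply: lee_wpmul2l; first by rewrite lee_fin mulr_ge0// powR_ge0.
by apply: area_shell_le => //; exact: ltW.
Qed.

(** Halving the depth scales the bound by a factor less than 1, so the
dyadic shells add up to a geometric series; the constant is its sum. *)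
Lemma shell_partial_le (al : R) n (t : R) : -1 < al -> 0 < t ->
  (\int[area]_q (\1_(shell (2^-1 ^+ n * t) t) q * ext (weight al) q)%:E <=
     (shell_const al * t `^ (1 + al))%:E)%E.
Proof.
move=> al1; elim: n t => [|n IH] t t0.
  under eq_integral => q _.
    rewrite indicE memNset ?mul0r; last by rewrite /shell /= expr0 mul1r; move=> /andP[/lt_le_trans H /H]; rewrite ltxx.
    over.
  by rewrite integral0 lee_fin mulr_ge0 ?powR_ge0 ?shell_const_ge0.
have t20 : 0 < t / 2 by rewrite divr_gt0.
pose g (a b : R) (q : plane) : \bar R := (\1_(shell a b) q * ext (weight al) q)%:E.
have g0 a b q : (0 <= g a b q)%E.
  by rewrite lee_fin mulr_ge0//; apply: ext_ge0 => z _; exact: weight_ge0.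
have mg a b : measurable_fun setT (g a b).
  apply/measurable_EFinP; apply: measurable_funM; last exact: measurable_ext_weight.
  by apply: measurable_indic; exact: measurable_shell.
apply: (@le_trans _ _ (\int[area]_q (g (t / 2)%R t q + g (2^-1 ^+ n * (t / 2))%R (t / 2)%R q))%E).
  apply: ge0_le_integralT => q; first exact: (g0 _ _ q).
  rewrite /g -EFinD lee_fin -mulrDl; apply: ler_wpM2r.
    by apply: ext_ge0 => z _; exact: weight_ge0.
  rewrite !indicE -natrD ler_nat.
  have -> : 2^-1 ^+ n.+1 * t = 2^-1 ^+ n * (t / 2) by rewrite exprS; ring.
  have [|_//] := boolP (q \in shell _ t); rewrite inE => /andP[q1 q2].
  have [q3|q3] := ltP (t / 2) (depth q).
    by rewrite [q \in _]mem_set//= /shell /= q3.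
  have -> : q \in shell (2^-1 ^+ n * (t / 2)) (t / 2) by rewrite inE /shell /= q1.
  by rewrite addn1.
rewrite (ge0_integralD _ measurableT (fun q _ => g0 _ _ q) (mg _ _) (fun q _ => g0 _ _ q) (mg _ _)).
apply: le_trans (leeD (shell_dyadic_le al t0) (IH _ t20)) _.
rewrite -EFinD lee_fin (powRM _ (ltW t0)) ?invr_ge0//.
have k1 := half_powR_lt1 al1; rewrite /shell_const.
rewrite le_eqVlt; apply/orP; left; apply/eqP; field.
by rewrite subr_eq0 gt_eqF.
Qed.

Lemma shell_weight_le (al t : R) : -1 < al -> 0 < t ->
  (\int[area]_q (\1_(shell 0 t) q * ext (weight al) q)%:E <=
     (shell_const al * t `^ (1 + al))%:E)%E.
Proof.
move=> al1 t0; pose F n := shell (2^-1 ^+ n * t) t.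
have FU : \bigcup_n F n = shell 0 t.
  apply/seteqP; split=> q.
    by move=> [n _] /andP[q1 q2]; rewrite /shell /= q2 andbT (le_lt_trans _ q1)// mulr_ge0 ?exprn_ge0 ?invr_ge0// ltW.
  move=> /andP[q0 qt].
  have := @cvg_expr R 2^-1; rewrite ger0_norm ?invr_ge0// invf_lt1// ltr1n => /(_ isT).
  move=> /cvgrPdist_lt/(_ (depth q / t)); rewrite divr_gt0// => /(_ isT)[n _ /(_ n (leqnn n))] /=.
  rewrite sub0r normrN ger0_norm ?exprn_ge0 ?invr_ge0// ltr_pdivlMr// => qn.
  by exists n => //; rewrite /F /shell /= qn.
rewrite -integral_indicM -FU.
have mW : measurable_fun setT (fun q : plane => (ext (weight al) q)%:E : \bar R).
  by apply/measurable_EFinP; exact: measurable_ext_weight.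
have ndF : {homo F : n m / (n <= m)%N >-> (n <= m)%O}.
  move=> i j ij; apply/subsetPset => q /andP[q1 q2]; rewrite /F /shell /= q2 andbT.
  apply: le_lt_trans q1; apply: ler_wpM2r; first exact: ltW.
  by rewrite ler_wiXn2l// ?invr_ge0// invf_le1// ler1n.
have mF n : measurable (F n) by exact: measurable_shell.
have := @ge0_nondecreasing_set_cvg_integral _ plane R F (fun q => (ext (weight al) q)%:E) area ndF mF
  (fun n => measurable_funS measurableT (@subsetT _ _) mW)
  (fun n q _ => ext_weight_ge0 al q).
move=> /cvge_to_le; apply; apply: nearW => n.
by rewrite integral_indicM; exact: shell_partial_le.
Qed.

End Shells.

Section Kernel.
Variable R : realType.
Implicit Types (f phi : R[i] -> R[i]) (w z zeta b : R[i]).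
Notation leb := (@lebesgue_measure R).
Notation plane := (measurableTypeR R * measurableTypeR R)%type.
Notation area := (@lebesgue_measure R \x @lebesgue_measure R)%E.

(** Integration against kern phi z averages, up to a constant factor, over the
ball about phi z whose radius is half the distance to the unit circle. *)
Definition kern phi z zeta : R :=
  if normc (zeta - phi z) < (1 - normc (phi z)) / 2 then (1 - normc (phi z)) ^- 2 else 0.

Lemma kern_ge0 phi z zeta : 0 <= kern phi z zeta.
Proof. by rewrite /kern; case: ifPn => // _; rewrite invr_ge0 sqr_ge0. Qed.

Lemma normc_conjM zeta b : normc zeta < 1 -> normc b < 1 ->
  normc (conjc zeta * b) <= normc zeta /\ normc (conjc zeta * b) <= normc b.
Proof.
move=> z1 b1; rewrite normcM normcJ; split.
  by rewrite ler_piMr ?normc_ge0// ltW.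
by rewrite ler_piMl ?normc_ge0// ltW.
Qed.

Lemma depth_near zeta b : normc zeta < 1 -> normc (zeta - b) < (1 - normc b) / 2 ->
  1 - normc zeta < 3 / 2 * (1 - normc b) /\ 1 - normc b < 2 * (1 - normc zeta).
Proof.
move=> z1 zb.
have h1 : normc zeta <= normc (zeta - b) + normc b by have := normcD (zeta - b) b; rewrite subrK.
have h2 : normc b <= normc (zeta - b) + normc zeta.
  by have := normcD (b - zeta) zeta; rewrite subrK (normcB b).
by move: z1 zb h1 h2; clear; split; lra.
Qed.

(** If b is much closer to zeta than to the unit circle, the Poisson kernel of
the direction zeta is at b as large as it can be, up to a constant. *)
Lemma near_le_pk zeta b : normc zeta < 1 -> normc b < 1 ->
  normc (zeta - b) < (1 - normc b) / 2 ->
  (1 - normc b) ^- 2 <= 81 / (4 * (1 - normc zeta)) * pk (conjc zeta * b).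
Proof.
move=> z1 b1 zb; have [h1 h2] := depth_near z1 zb.
have z0 := normc_ge0 zeta; have b0 := normc_ge0 b.
have [xz xb] := normc_conjM z1 b1.
set x := conjc zeta * b in xz xb *.
have x1 : normc x < 1 by exact: le_lt_trans z1.
have x0 := normc_ge0 x.
set de := 1 - normc zeta in h1 h2 *; set d := 1 - normc b in h1 h2 zb *.
have de0 : 0 < de by rewrite subr_gt0.
have d0 : 0 < d by rewrite subr_gt0.
have n3 : normc (1 - x) <= 3 * de.
  have -> : 1 - x = (1 - normc zeta ^+ 2)%:C + conjc zeta * (zeta - b).
    rewrite mulrBr -/x addrA; congr (_ - _).
    rewrite sqr_normcE; case: (zeta) => u v; apply/eqP; rewrite eq_complex /=.
    by apply/andP; split; apply/eqP; ring.
  apply: le_trans (normcD _ _) _; rewrite normcM normcJ normcR_ge0; last first.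
    by rewrite subr_ge0 expr_le1// ltW.
  have : normc zeta * normc (zeta - b) <= de.
    have : normc zeta * normc (zeta - b) <= 1 * normc (zeta - b).
      by apply: ler_wpM2r; [exact: normc_ge0|exact: ltW].
    by move: zb h2; clear; lra.
  have : 1 - normc zeta ^+ 2 <= 2 * de by rewrite /de; move: z1 z0; clear; nra.
  by clear; lra.
have n0 : 0 < normc (1 - x) by apply: lt_le_trans (ler1B_normc x); rewrite subr_gt0.
have pk1 : (9 * de)^-1 <= pk x.
  rewrite pkE// ler_pdivlMr ?exprn_gt0// ler_pdivrMl ?mulr_gt0//.
  have n9 : normc (1 - x) ^+ 2 <= (3 * de) ^+ 2.
    by rewrite ler_pXn2r// nnegrE ltW// mulr_gt0.
  apply: le_trans n9 _; rewrite exprMn [de ^+ 2]expr2 mulrA.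
  have -> : 3 ^+ 2 * de * de = 9 * de * de :> R by ring.
  apply: ler_wpM2l; first by rewrite mulr_ge0// ltW.
  have : normc x ^+ 2 <= normc x by rewrite expr2 ler_piMl// ltW.
  by rewrite /de; move: xz; clear; lra.
apply: (@le_trans _ _ (81 / (4 * de) * (9 * de)^-1)); last first.
  by apply: ler_wpM2l => //; rewrite divr_ge0// mulr_ge0// ltW.
have -> : 81 / (4 * de) * (9 * de)^-1 = ((2 / 3 * de) ^+ 2)^-1.
  by field; rewrite gt_eqF.
rewrite lef_pV2 ?posrE ?exprn_gt0 ?mulr_gt0// ler_pXn2r ?nnegrE ?mulr_ge0 ?(ltW de0) ?(ltW d0)//.
by move: h1; clear; lra.
Qed.

Lemma derivable_conj_comp phi zeta z : analytic_on_disc phi -> normc z < 1 ->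
  derivable ((fun v => conjc zeta * phi v) : R[i]^o -> R[i]^o) z 1.
Proof. by move=> ap z1; exact: (cderM (@cder_cst R (conjc zeta) z) (ap z z1)). Qed.

Lemma pk_ctsat phi zeta z : analytic_on_disc phi -> (forall z, disc z -> disc (phi z)) ->
  normc zeta < 1 -> normc z < 1 -> ctsat (fun v => pk (conjc zeta * phi v)) z.
Proof.
move=> ap dp zt z1.
have x1 : normc (conjc zeta * phi z) < 1.
  by have [h _] := normc_conjM zt (dp z z1); exact: le_lt_trans zt.
have dF := @derivable_conj_comp phi zeta z ap z1.
have dc := @derivable_cayley R (fun v => conjc zeta * phi v) z x1 dF.
exact: (ctsat_circ (derivable_continuous_at dc) (@ctsat_Re R _)).
Qed.

Lemma pk_conj_mean phi zeta z : analytic_on_disc phi -> (forall z, disc z -> disc (phi z)) ->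
  normc zeta < 1 -> normc z < 1 ->
  cmean (fun t => pk (conjc zeta * phi (z * ept t))) = pk (conjc zeta * phi 0).
Proof.
move=> ap dp zt z1; have z0 := normc_ge0 z.
have z2 : 0 < 1 + normc z by rewrite ltr_wpDr.
pose F (v : R[i]) := conjc zeta * phi (z * v).
have := @pk_mean R F 0 (2 / (1 + normc z)) 1 ler01.
rewrite /F mulr0 => <-.
- by apply: eq_cmean => t; rewrite add0r mul1r.
- by rewrite ltr_pdivlMr//; move: z1; clear; lra.
move=> v; rewrite subr0 ltr_pdivlMr// => vr.
have zv : normc (z * v) < 1.
  rewrite normcM; have v0 := normc_ge0 v.
  by move: z0 z1 vr v0; move: (normc z) (normc v); clear; move=> x y; nra.
split.
  have dh : derivable ((fun v => z * v) : R[i]^o -> R[i]^o) v 1.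
    exact: (cderM (@cder_cst R z v) (@cder_id R v)).
  exact: (derivable_circ dh (@derivable_conj_comp phi zeta (z * v) ap zv)).
by have [h _] := normc_conjM zt (dp _ zv); exact: le_lt_trans zt.
Qed.

End Kernel.

Section KernelIntegral.
Variable R : realType.
Implicit Types (f phi : R[i] -> R[i]) (w z zeta b : R[i]).
Notation leb := (@lebesgue_measure R).
Notation plane := (measurableTypeR R * measurableTypeR R)%type.
Notation area := (@lebesgue_measure R \x @lebesgue_measure R)%E.

(** The Poisson kernel composed with phi is harmonic, so against a radial weight
it may be replaced by its value at 0. *)
Lemma shell_pk_le phi zeta (al t : R) : analytic_on_disc phi ->
  (forall z, disc z -> disc (phi z)) -> normc zeta < 1 -> -1 < al -> 0 < t ->
  (\int[area]_q (\1_(shell 0 t) q * ext (weight al) q *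
      ext (fun z => pk (conjc zeta * phi z)) q)%:E <=
    (pk (conjc zeta * phi 0) * (shell_const al * t `^ (1 + al)))%:E)%E.
Proof.
move=> ap dp zt al1 t0.
have x1 z : normc z < 1 -> normc (conjc zeta * phi z) < 1.
  by move=> z1; have [h _] := normc_conjM zt (dp z z1); exact: le_lt_trans zt.
have P0 z : normc z < 1 -> 0 <= pk (conjc zeta * phi z) by move=> /x1; exact: pk_ge0.
have n0 : normc (0 : R[i]) < 1 by rewrite (@normc0 R).
have W0 q : 0 <= ext (weight al) q :> R by rewrite -lee_fin ext_weight_ge0.
have mG : measurable_fun setT (ext (fun z => pk (conjc zeta * phi z)) : plane -> R).
  by apply: measurable_ext => z z1; exact: pk_ctsat.
have mS : measurable_fun setT (\1_(shell 0 t) : plane -> R).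
  by apply: measurable_indic; exact: measurable_shell.
have mom : measurable_fun setT (fun q : plane => \1_(shell 0 t) q * ext (weight al) q).
  by apply: measurable_funM => //; exact: measurable_ext_weight.
rewrite (@rotation_mean R (fun q => \1_(shell 0 t) q * ext (weight al) q)
  (ext (fun z => pk (conjc zeta * phi z)))
  (fun q s => pk (conjc zeta * phi (toC q * ept s))))//; last 4 first.
- by move=> q; rewrite mulr_ge0.
- by move=> q; exact: ext_ge0.
- move=> s q; rewrite !indicE /ext normc_toC_rot /weight normc_toC_rot.
  congr ((nat_of_bool _)%:R * _).
  by apply/idP/idP; rewrite !inE /shell /depth /mkset normc_toC_rot.
- move=> q; rewrite indicE /ext; case: ifPn => [q1 _|_]; last by rewrite mulr0 ltxx.
  have qt s : normc (toC q * ept s) < 1 by rewrite normcM normc_ept mulr1.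
  split=> s; last by rewrite toC_rot qt.
  have cp : ccat (fun t => toC q * ept t) s.
    exact: (ccatM (@ccat_cst R (toC q) s) (@continuous_ept R s)).
  exact: (ctsat_path cp (pk_ctsat ap dp zt (qt s))).
have mom' : measurable_fun setT (fun q : plane => (\1_(shell 0 t) q * ext (weight al) q)%:E : \bar R).
  by apply/measurable_EFinP.
apply: (@le_trans _ _ (\int[area]_q ((pk (conjc zeta * phi 0))%:E *
   (\1_(shell 0 t) q * ext (weight al) q)%:E))%E).
  apply: ge0_le_integralT => q.
    rewrite /ext; case: ifPn => [q1|_]; last by rewrite mulr0 mul0r.
    by rewrite pk_conj_mean// lee_fin !mulr_ge0// ?P0// weight_ge0.
  rewrite /ext; case: ifPn => [q1|_]; last by rewrite mulr0 mul0r mule0.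
  by rewrite pk_conj_mean// -EFinM mulrC.
rewrite (@ge0_integralZl _ _ R area setT measurableT _ mom'); last 2 first.
- by move=> q _; rewrite lee_fin mulr_ge0.
- by rewrite lee_fin P0.
rewrite EFinM; apply: lee_wpmul2l; first by rewrite lee_fin P0.
exact: shell_weight_le.
Qed.

(** The density at zeta of the transported weight is comparable to the weight:
the preimage of a neighbourhood of zeta lies in a shell of comparable depth,
and the Poisson kernel measures how much of that shell it can fill. *)
Lemma kernel_integral_le phi (al : R) : analytic_on_disc phi ->
  (forall z, disc z -> disc (phi z)) -> -1 < al ->
  exists2 K : R, 0 <= K & forall zeta, normc zeta < 1 ->
    (\int[area]_q (ext (weight al) q * kern phi (toC q) zeta)%:E <= (K * weight al zeta)%:E)%E.
Proof.
move=> ap dp al1.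
have n0 : normc (0 : R[i]) < 1 by rewrite (@normc0 R).
set a := normc (phi 0); have a0 : 0 <= a := normc_ge0 _; have a1 : a < 1 := dp 0 n0.
have ka : 0 < 1 - a by rewrite subr_gt0.
have sc0 := shell_const_ge0 al1.
pose K := 81 / 4 * (2 / (1 - a)) * shell_const al * (16 / (1 - a)) `^ (1 + al) * 2 `^ `|al|.
exists K.
  have ka' := ltW ka; rewrite /K; apply: mulr_ge0; last exact: powR_ge0.
  apply: mulr_ge0; last exact: powR_ge0.
  by apply: mulr_ge0 => //; rewrite !mulr_ge0 ?invr_ge0.
move=> zeta zt; have z0 := normc_ge0 zeta.
set de := 1 - normc zeta; have de0 : 0 < de by rewrite subr_gt0.
have de0' := ltW de0.
pose t := 16 / (1 - a) * de.
have c16 : 0 < 16 / (1 - a) by rewrite divr_gt0.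
have t0 : 0 < t by rewrite mulr_gt0.
have x1 z : normc z < 1 -> normc (conjc zeta * phi z) < 1.
  by move=> z1; have [h _] := normc_conjM zt (dp z z1); exact: le_lt_trans zt.
have P0 z : normc z < 1 -> 0 <= pk (conjc zeta * phi z) by move=> /x1; exact: pk_ge0.
have k0 : 0 <= 81 / (4 * de) by rewrite divr_ge0// mulr_ge0// ltW.
have W0 q : 0 <= ext (weight al) q :> R by rewrite -lee_fin ext_weight_ge0.
have mF : measurable_fun setT (fun q : plane => (\1_(shell 0 t) q * ext (weight al) q *
    ext (fun z => pk (conjc zeta * phi z)) q)%:E : \bar R).
  apply/measurable_EFinP; apply: measurable_funM.
    apply: measurable_funM; last exact: measurable_ext_weight.
    by apply: measurable_indic; exact: measurable_shell.
  by apply: measurable_ext => z z1; exact: pk_ctsat.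
apply: (@le_trans _ _ (\int[area]_q ((81 / (4 * de))%:E * (\1_(shell 0 t) q * ext (weight al) q *
      ext (fun z => pk (conjc zeta * phi z)) q)%:E))%E).
  apply: ge0_le_integralT => q; first by rewrite lee_fin mulr_ge0// kern_ge0.
  rewrite -EFinM lee_fin /ext; case: ifPn => [q1|_]; last by rewrite !(mulr0, mul0r).
  have pq := dp _ q1.
  rewrite /kern; case: ifPn => [near|_]; last first.
    by rewrite mulr0; apply: mulr_ge0 => //; rewrite !mulr_ge0 ?weight_ge0 ?P0.
  have [h1 h2] := depth_near zt near.
  have qS : q \in shell 0 t.
    rewrite inE /shell /mkset depth_gt0 q1 /=.
    have := self_map_distance ap dp q1; rewrite -/a => sd.
    have qn := normc_ge0 (toC q).
    have d2 : depth q <= 2 * (1 - normc (toC q)) by rewrite /depth; move: q1 qn; clear; nra.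
    apply: le_trans d2 _; rewrite /t mulrAC ler_pdivlMr//.
    by move: sd h2; rewrite /de; move: (normc _) (normc _) (normc _); clear; move=> x y u; nra.
  rewrite indicE qS mul1r mulrCA; apply: ler_wpM2l; first exact: weight_ge0.
  exact: near_le_pk.
rewrite (@ge0_integralZl _ _ R area setT measurableT _ mF); last 2 first.
- by move=> q _; rewrite lee_fin !mulr_ge0//; exact: ext_ge0.
- by rewrite lee_fin.
apply: (@le_trans _ _ ((81 / (4 * de))%:E * (pk (conjc zeta * phi 0) * (shell_const al * t `^ (1 + al)))%:E)%E).
  by apply: lee_wpmul2l; [rewrite lee_fin|exact: shell_pk_le].
rewrite -EFinM lee_fin.
have pk2 : pk (conjc zeta * phi 0) <= 2 / (1 - a).
  apply: le_trans (pk_le (x1 _ n0)) _.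
  have [_ xa] := normc_conjM zt (dp 0 n0); have xn := normc_ge0 (conjc zeta * phi 0).
  apply: ler_pM; rewrite ?invr_ge0 ?subr_ge0 ?(ltW (x1 _ n0)) ?addr_ge0//.
    by move: xa a1; rewrite -/a; clear; lra.
  by rewrite lef_pV2 ?posrE ?subr_gt0 ?x1// lerD2l lerN2.
have tE : t `^ (1 + al) = (16 / (1 - a)) `^ (1 + al) * (de * de `^ al).
  by rewrite powR_mulS// /t powRM// ltW.
have dw : de `^ al <= 2 `^ `|al| * weight al zeta.
  apply: powR_comparable => //; rewrite ?subr_gt0 ?expr_lt1//.
    by rewrite /de; move: zt z0; clear; nra.
  by rewrite /de; move: zt z0; clear; nra.
rewrite tE; apply: (@le_trans _ _ (81 / (4 * de) * (2 / (1 - a) * (shell_const al *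
   ((16 / (1 - a)) `^ (1 + al) * (de * (2 `^ `|al| * weight al zeta))))))).
  apply: ler_wpM2l => //; apply: ler_pM => //.
  - exact: P0.
  - by apply: mulr_ge0 => //; rewrite !mulr_ge0 ?powR_ge0.
  apply: ler_wpM2l => //; apply: ler_wpM2l; first exact: powR_ge0.
  by apply: ler_wpM2l => //; exact: ltW.
rewrite le_eqVlt; apply/orP; left; apply/eqP; rewrite /K.
by field; rewrite !gt_eqF.
Qed.

End KernelIntegral.

(** * Composition on Bergman spaces *)

Section PullBack.
Variable R : realType.
Implicit Types (f phi : R[i] -> R[i]) (w zeta b : R[i]) (p : R[i] -> R).
Notation leb := (@lebesgue_measure R).
Notation plane := (measurableTypeR R * measurableTypeR R)%type.
Notation area := (@lebesgue_measure R \x @lebesgue_measure R)%E.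

Lemma normc_toCB (q : plane) b :
  normc (toC q - b) = Num.sqrt ((q.1 - complex.Re b) ^+ 2 + (q.2 - complex.Im b) ^+ 2).
Proof. by case: b. Qed.

Lemma depth_inv_ctsat phi (z : R[i]) : analytic_on_disc phi -> (forall z, disc z -> disc (phi z)) ->
  normc z < 1 -> ctsat (fun z => (1 - normc (phi z)) ^- 2) z.
Proof.
move=> ap dp z1; have cn := ctsat_circ (derivable_continuous_at (ap z z1)) (@ctsat_normc R (phi z)).
have ck : {for normc (phi z), continuous (fun x : R => (1 - x) ^- 2)}.
  apply: cvgV; first by rewrite expf_neq0// subr_eq0 gt_eqF// dp.
  by apply: cvgM; apply: cvgB; (exact: cvg_cst || exact: cvg_id).
exact: (ctsat_comp cn ck).
Qed.

Lemma measurable_kern phi (al : R) : analytic_on_disc phi ->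
  (forall z, disc z -> disc (phi z)) ->
  measurable_fun setT (fun x : plane * plane =>
    ext (weight al) x.1 * kern phi (toC x.1) (toC x.2)).
Proof.
move=> ap dp.
have ca z : normc z < 1 -> {for z, continuous (phi : R[i]^o -> R[i]^o)}.
  by move=> z1; exact: (derivable_continuous_at (ap z z1)).
pose eR := ext (fun z => complex.Re (phi z)) : plane -> R.
pose eI := ext (fun z => complex.Im (phi z)) : plane -> R.
pose eV := ext (fun z => (1 - normc (phi z)) ^- 2) : plane -> R.
pose eN := ext (fun z => normc (phi z)) : plane -> R.
have mR : measurable_fun setT eR.
  by apply: measurable_ext => z z1; exact: (ctsat_circ (ca z z1) (@ctsat_Re R _)).
have mI : measurable_fun setT eI.
  by apply: measurable_ext => z z1; exact: (ctsat_circ (ca z z1) (@ctsat_Im R _)).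
have mN : measurable_fun setT eN.
  by apply: measurable_ext => z z1; exact: (ctsat_circ (ca z z1) (@ctsat_normc R _)).
have mV : measurable_fun setT eV by apply: measurable_ext => z z1; exact: depth_inv_ctsat.
have mW := @measurable_ext_weight R al.
have m1 (u : plane -> R) : measurable_fun setT u -> measurable_fun setT (fun x : plane * plane => u x.1).
  by move=> mu; exact: (measurableT_comp mu measurable_fst).
have m21 : measurable_fun setT (fun x : plane * plane => x.2.1).
  exact: (measurableT_comp measurable_fst measurable_snd).
have m22 : measurable_fun setT (fun x : plane * plane => x.2.2).
  exact: (measurableT_comp measurable_snd measurable_snd).
have -> : (fun x : plane * plane => ext (weight al) x.1 * kern phi (toC x.1) (toC x.2)) =
    (fun x => ext (weight al) x.1 *
      (if Num.sqrt ((x.2.1 - eR x.1) ^+ 2 + (x.2.2 - eI x.1) ^+ 2) < (1 - eN x.1) / 2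
       then eV x.1 else 0)).
  apply/funext => -[u q]; rewrite /eR /eI /eN /eV /ext /=.
  by case: ifPn => [u1|_]; rewrite ?mul0r// /kern normc_toCB.
apply: measurable_funM; first exact: m1.
apply: measurable_fun_if => //.
- apply: measurable_fun_ltr.
    apply: measurableT_comp; first by apply: continuous_measurable_fun; exact: sqrt_continuous.
    by apply: measurable_funD; apply: measurable_funX; apply: measurable_funB => //; exact: m1.
  by apply: measurable_funM => //; apply: measurable_funB => //; exact: m1.
- apply: (measurable_funS (E := setT)) => //; exact: m1.
Qed.

(** The pointwise estimate at phi z is an integral against kern phi z; after an
exchange of the integrations the integral in z is the one of kernel_integral_le. *)
Lemma modp_composition_area p m M C phi (al A0 : R) : regular_exponent p m M C ->
  analytic_on_disc phi -> (forall z, disc z -> disc (phi z)) -> -1 < al -> 0 < A0 ->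
  exists2 A : R, 0 <= A & forall f, analytic_on_disc f ->
    (\int[area]_q (ext (weight al) q * ext (modp p f) q)%:E <= A0%:E)%E ->
    (\int[area]_q (ext (weight al) q * ext (fun z => modp p f (phi z)) q)%:E <= A%:E)%E.
Proof.
move=> regp ap dp al1 A00.
have [K1 K10 HK1] := modp_le_area al regp A00.
have [K2 K20 HK2] := kernel_integral_le ap dp al1.
exists (K1 * (K2 * A0)); first by rewrite !mulr_ge0// ltW.
move=> f af HA.
pose E := ext (modp p f) : plane -> R.
have cE z : normc z < 1 -> ctsat (modp p f) z.
  by move=> z1; exact: (modp_ctsat regp z1 (af z z1)).
have mE : measurable_fun setT E := measurable_ext cE.
have E0 q : 0 <= E q by apply: ext_ge0 => z _; rewrite ltW// modp_gt0.
have W0 q : 0 <= ext (weight al) q :> R by rewrite -lee_fin ext_weight_ge0.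
pose H (x : plane * plane) : \bar R :=
  (ext (weight al) x.1 * kern phi (toC x.1) (toC x.2) * E x.2)%:E.
have H0 x : (0 <= H x)%E by rewrite lee_fin; apply: mulr_ge0 => //; apply: mulr_ge0 => //; exact: kern_ge0.
have mH : measurable_fun setT H.
  apply/measurable_EFinP; apply: measurable_funM; first exact: measurable_kern.
  exact: (measurableT_comp mE measurable_snd).
have mHz z : measurable_fun setT (fun q => H (z, q)).
  exact: (measurableT_comp mH (pair1_measurable z)).
apply: (@le_trans _ _ (\int[area]_z (K1%:E * \int[area]_q H (z, q)))%E).
  apply: ge0_le_integralT => z.
    by rewrite lee_fin mulr_ge0//; apply: ext_ge0 => v _; rewrite ltW// modp_gt0.
  have I0 : (0 <= K1%:E * \int[area]_q H (z, q))%E.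
    by apply: mule_ge0; [rewrite lee_fin|exact: integral_ge0].
  rewrite {1}/ext; case: ifPn => [z1|_]; last by rewrite mul0r.
  rewrite {1}/ext z1; have pz := dp _ z1.
  set d := 1 - normc (phi (toC z)).
  have HE q : H (z, q) = ((weight al (toC z) / d ^+ 2)%:E *
      (\1_(dball (phi (toC z)) (d / 2)) q * E q)%:E)%E.
    rewrite -EFinM /H /= {1}/ext z1 /kern -/d indicE; congr EFin.
    case: ifPn => [qd|qd].
      by rewrite mem_set// mul1r.
    by rewrite memNset ?mul0r ?mulr0 ?mul0r// => /= qd'; move: qd; rewrite qd'.
  under eq_integral do rewrite HE.
  have mBE' : measurable_fun setT (fun q : plane => (\1_(dball (phi (toC z)) (d / 2)) q * E q)%:E : \bar R).
    apply/measurable_EFinP; apply: measurable_funM => //.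
    by apply: measurable_indic; exact: measurable_dball.
  rewrite (@ge0_integralZl _ _ R area setT measurableT _ mBE'); last 2 first.
  - by move=> q _; rewrite lee_fin mulr_ge0.
  - by rewrite lee_fin divr_ge0 ?weight_ge0// sqr_ge0.
  rewrite EFinM; apply: le_trans (lee_wpmul2l _ (HK1 f af HA _ pz)) _.
    by rewrite lee_fin weight_ge0.
  by rewrite -/d -/E !muleA -!EFinM [X in (X%:E * _ <= _)%E]mulrCA.
have mI : measurable_fun setT (fun z => \int[area]_q H (z, q))%E.
  exact: area_tonelli_measurable.
rewrite (@ge0_integralZl _ _ R area setT measurableT _ mI); last 2 first.
- by move=> q _; exact: integral_ge0.
- by rewrite lee_fin.
rewrite EFinM; apply: lee_wpmul2l; first by rewrite lee_fin.
rewrite area_tonelli//.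
have mWE : measurable_fun setT (fun q : plane => (ext (weight al) q * E q)%:E : \bar R).
  by apply/measurable_EFinP; apply: measurable_funM => //; exact: measurable_ext_weight.
apply: (@le_trans _ _ (\int[area]_q (K2%:E * (ext (weight al) q * E q)%:E))%E); last first.
  rewrite (@ge0_integralZl _ _ R area setT measurableT _ mWE); last 2 first.
  - by move=> q _; rewrite lee_fin mulr_ge0.
  - by rewrite lee_fin.
  by rewrite EFinM; apply: lee_wpmul2l; rewrite ?lee_fin.
apply: ge0_le_integralT => q; first exact: integral_ge0.
have [q1|q1] := boolP (normc (toC q) < 1); last first.
  rewrite /H /E /ext (negPf q1) /=; under eq_integral do rewrite mulr0.
  by rewrite integral0 mul0r mule0.
have mk : measurable_fun setT (fun z : plane => (ext (weight al) z * kern phi (toC z) (toC q))%:E : \bar R).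
  apply/measurable_EFinP.
  exact: (measurableT_comp (measurable_kern al ap dp) (pair2_measurable q)).
under eq_integral do rewrite /H /= mulrC EFinM.
rewrite (@ge0_integralZl _ _ R area setT measurableT _ mk); last 2 first.
- by move=> z _; rewrite lee_fin mulr_ge0// kern_ge0.
- by rewrite lee_fin.
have Eq0 : (0 <= (E q)%:E)%E by rewrite lee_fin.
apply: le_trans (lee_wpmul2l Eq0 (HK2 _ q1)) _.
by rewrite -!EFinM lee_fin /ext q1 mulrC mulrA.
Qed.

End PullBack.

Section BergmanOperator.
Variable R : realType.
Implicit Types (f h phi : R[i] -> R[i]) (p s u : R[i] -> R).
Notation leb := (@lebesgue_measure R).
Notation plane := (measurableTypeR R * measurableTypeR R)%type.
Notation area := (@lebesgue_measure R \x @lebesgue_measure R)%E.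
Notation D := (@toC R @^-1` @disc R).

Lemma measurable_ext_powR h s : analytic_on_disc h -> (forall z, normc z < 1 -> ctsat s z) ->
  measurable_fun setT (ext (fun z => normc (h z) `^ s z) : plane -> R).
Proof.
move=> ah cs.
have mh : measurable_fun setT (ext (fun z => normc (h z)) : plane -> R).
  apply: measurable_ext => z z1.
  exact: (ctsat_circ (derivable_continuous_at (ah z z1)) (@ctsat_normc R (h z))).
have ms : measurable_fun setT (ext s : plane -> R) := measurable_ext cs.
have -> : (ext (fun z => normc (h z) `^ s z) : plane -> R) =
    (fun q => if normc (toC q) < 1 then ext (fun z => normc (h z)) q `^ ext s q else 0).
  by apply/funext => q; rewrite /ext; case: ifPn.
apply: measurable_fun_if => //.
- by apply: measurable_fun_ltr => //; exact: measurable_normc_toC.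
- by apply: (measurable_funS (E := setT)) => //; exact: measurable_powR2.
Qed.

Lemma measurable_restrict_ext u : measurable_fun setT (ext u : plane -> R) ->
  measurable_fun D (fun q : plane => u (toC q)).
Proof.
move=> mu; apply: (eq_measurable_fun (ext u)).
  by move=> q; rewrite inE /disc /preimage /mkset => q1; rewrite /ext q1.
exact: (measurable_funS (E := setT)).
Qed.

Lemma integral_dAE (al : R) u : -1 < al -> (forall z, normc z < 1 -> 0 <= u z) ->
  measurable_fun setT (ext u : plane -> R) ->
  integral_dA al u = (((al + 1) / pi)%:E * \int[area]_q (ext (weight al) q * ext u q)%:E)%E.
Proof.
move=> al1 u0 mu; have a0 : 0 <= al + 1 by lra.
have mD := @toC_disc_measurable R.
pose g (q : plane) : \bar R := ((al + 1) * weight al (toC q) * u (toC q))%:E.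
have mg : measurable_fun D g.
  apply/measurable_EFinP; apply: measurable_funM; last exact: measurable_restrict_ext.
  apply: measurable_funM; first exact: measurable_cst.
  by apply: (measurable_funS (E := setT)) => //; exact: measurable_weight.
have g0 q : D q -> (0 <= g q)%E.
  by move=> q1; rewrite lee_fin !mulr_ge0 ?weight_ge0 ?u0.
have mWu : measurable_fun setT (fun q : plane => (ext (weight al) q * ext u q)%:E : \bar R).
  by apply/measurable_EFinP; apply: measurable_funM => //; exact: measurable_ext_weight.
rewrite /integral_dA /dA -/g.
have -> := @ge0_integral_mscale _ plane R (mrestr area mD) D mD (NngNum (pi_inv_ge0 R)) g mg g0.
have -> : (\int[mrestr area mD]_(x in D) g x = \int[area]_(x in D) g x)%E.
  apply: eq_measure_integral => A mA AD.
  by have E : area (A `&` D) = area A; [rewrite (setIidl AD)|exact: E].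
rewrite integral_indicM.
have -> : (\int[area]_q (\1_D q * ((al + 1) * weight al (toC q) * u (toC q)))%:E =
    \int[area]_q ((al + 1)%:E * (ext (weight al) q * ext u q)%:E))%E.
  apply: eq_integral => q _; rewrite -EFinM indicE /ext; congr EFin.
  case: ifPn => [q1|q1]; first by rewrite mem_set// mul1r mulrA.
  by rewrite memNset ?mul0r ?mulr0// => q1'; move: q1; rewrite q1'.
rewrite (@ge0_integralZl _ _ R area setT measurableT _ mWu)//.
- by rewrite muleA -EFinM /= mulrC.
- move=> q _; rewrite lee_fin mulr_ge0//; first by rewrite -lee_fin ext_weight_ge0.
  exact: ext_ge0.
Qed.

Lemma weight_integral_le (al : R) : -1 < al ->
  (\int[area]_q (ext (weight al) q)%:E <= (shell_const al)%:E)%E.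
Proof.
move=> al1; have := shell_weight_le al1 (@ltr01 R).
have -> : 1 `^ (1 + al) = 1 :> R by rewrite powR1.
rewrite mulr1; apply: le_trans; rewrite le_eqVlt; apply/orP; left; apply/eqP.
apply: eq_integral => q _; rewrite /ext indicE; case: ifPn => [q1|_]; last by rewrite mulr0.
by rewrite mem_set ?mul1r// /shell /mkset depth_gt0 q1 depth_le1.
Qed.

(** The case B = 1 bounds the norms; an arbitrary B shows that composition maps
one space into the other. *)
Lemma bergman_modular p m M C phi (al B : R) : regular_exponent p m M C ->
  analytic_on_disc phi -> (forall z, disc z -> disc (phi z)) -> -1 < al -> 0 <= B ->
  exists2 A : R, 1 <= A & forall f, analytic_on_disc f ->
    (integral_dA al (fun z => normc (f z) `^ p z)%R <= B%:E)%E ->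
    (integral_dA al (fun z => normc (f (phi z)) `^ p (phi z))%R <= A%:E)%E.
Proof.
move=> regp ap dp al1 B0; have a0 : 0 < al + 1 by lra.
have pi0 := pi_gt0 R.
have c0 : 0 < (al + 1) / pi by rewrite divr_gt0.
have sc0 := shell_const_ge0 al1.
pose A0 := shell_const al + B / ((al + 1) / pi) + 1.
have A00 : 0 < A0 by rewrite ltr_wpDl// addr_ge0// divr_ge0// ltW.
have [A1 A10 HA1] := modp_composition_area regp ap dp al1 A00.
exists (Num.max 1 ((al + 1) / pi * A1)); first by rewrite le_max lexx.
move=> f af HB.
have cp z : normc z < 1 -> ctsat p z by move=> z1; exact: (exponent_ctsat regp z1).
have cpp z : normc z < 1 -> ctsat (fun z => p (phi z)) z.
  by move=> z1; exact: (ctsat_circ (derivable_continuous_at (ap z z1)) (cp _ (dp z z1))).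
have mf := measurable_ext_powR af cp.
have mfp := measurable_ext_powR (analytic_comp af ap dp) cpp.
have W0 q : 0 <= ext (weight al) q :> R by rewrite -lee_fin ext_weight_ge0.
have mW : measurable_fun setT (fun q : plane => (ext (weight al) q)%:E : \bar R).
  by apply/measurable_EFinP; exact: measurable_ext_weight.
have mWf : measurable_fun setT
    (fun q : plane => (ext (weight al) q * ext (fun z => normc (f z) `^ p z)%R q)%:E : \bar R).
  by apply/measurable_EFinP; apply: measurable_funM => //; exact: measurable_ext_weight.
have Wf0 q : (0 <= (ext (weight al) q * ext (fun z => normc (f z) `^ p z)%R q)%:E)%E.
  by rewrite lee_fin mulr_ge0//; apply: ext_ge0 => z _; exact: powR_ge0.
have HE : (\int[area]_q (ext (weight al) q * ext (modp p f) q)%:E <= A0%:E)%E.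
  apply: (@le_trans _ _ (\int[area]_q ((ext (weight al) q)%:E +
     (ext (weight al) q * ext (fun z => normc (f z) `^ p z)%R q)%:E))%E).
    apply: ge0_le_integralT => q.
      by rewrite lee_fin mulr_ge0//; apply: ext_ge0 => z _; rewrite ltW// modp_gt0.
    rewrite -EFinD lee_fin /ext; case: ifPn => [q1|_]; last by rewrite !mulr0 addr0.
    rewrite -[X in X + _]mulr1 -mulrDr; apply: ler_wpM2l; first exact: weight_ge0.
    exact: modp_le_powR.
  rewrite (ge0_integralD _ measurableT (fun q _ => ext_weight_ge0 al q) mW (fun q _ => Wf0 q) mWf).
  apply: (@le_trans _ _ ((shell_const al)%:E + (B / ((al + 1) / pi))%:E)%E); last first.
    by rewrite -EFinD lee_fin lerDl.
  apply: leeD; first exact: weight_integral_le.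
  move: HB; rewrite integral_dAE//; last by move=> z _; exact: powR_ge0.
  by rewrite [B / _]mulrC [X in _ -> (_ <= X)%E]EFinM lee_pdivlMl.
rewrite integral_dAE//; last by move=> z _; exact: powR_ge0.
apply: (@le_trans _ _ (((al + 1) / pi)%:E * A1%:E)%E); last first.
  by rewrite -EFinM lee_fin le_max lexx orbT.
apply: lee_wpmul2l; first by rewrite lee_fin ltW.
apply: le_trans (HA1 f af HE); apply: ge0_le_integralT => q.
  by rewrite lee_fin mulr_ge0//; apply: ext_ge0 => z _; exact: powR_ge0.
rewrite lee_fin /ext; case: ifPn => [q1|_]; last by rewrite !mulr0.
by apply: ler_wpM2l; [exact: weight_ge0|exact: (powR_le_modp regp f (dp _ q1))].
Qed.

Lemma bergman_modular_dilate s (m al : R) f : -1 < al ->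
  (forall z, normc z < 1 -> m <= s z) -> (forall z, normc z < 1 -> ctsat s z) ->
  analytic_on_disc f -> forall k l : R, 1 <= k ->
  (integral_dA al (fun z => normc (f z / (k * l)%:C) `^ s z)%R <=
     (k `^ (- m))%:E * integral_dA al (fun z => normc (f z / l%:C) `^ s z)%R)%E.
Proof.
move=> al1 ms cs af k l k1; have a0 : 0 <= al + 1 by lra.
have k0 : 0 < k by exact: lt_le_trans k1.
have mW : measurable_fun D (fun q : plane => (al + 1) * weight al (toC q)).
  apply: measurable_funM; first exact: measurable_cst.
  by apply: (measurable_funS (E := setT)) => //; exact: measurable_weight.
have mu : measurable_fun D (fun q : plane => normc (f (toC q) / l%:C)).
  apply: (@measurable_ctsat R (fun z => normc (f z / l%:C)) 1) => z z1.
  exact: (ctsat_circ (derivable_continuous_at (@analytic_div R f l af z z1)) (@ctsat_normc R (f z / l%:C))).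
have mS : measurable_fun D (fun q : plane => s (toC q)) := measurable_ctsat cs.
have := @modular_scale_le R _ _ (dA R) D
  (fun q => (al + 1) * weight al (toC q)) (fun q => normc (f (toC q) / l%:C)) (fun q => s (toC q))
  (@toC_disc_measurable R) mW mu mS (fun q _ => mulr_ge0 a0 (weight_ge0 al (toC q)))
  (fun q _ => normc_ge0 (f (toC q) / l%:C)) k m k1 (fun q q1 => ms _ q1).
apply: le_trans; rewrite le_eqVlt; apply/orP; left; apply/eqP.
apply: eq_integral => q _; congr (_ * _ `^ _)%:E.
have kE : normc (k%:C^-1) = k^-1.
  by rewrite -rmorphV ?unitfE ?gt_eqF// normcR_ge0// invr_ge0 ltW.
by rewrite rmorphM /= invfM mulrA mulrAC (normcM (_ / _)) kE.
Qed.

Lemma bergman_composition_bounded p m M C phi (al : R) : regular_exponent p m M C ->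
  analytic_on_disc phi -> (forall z, disc z -> disc (phi z)) -> -1 < al ->
  bounded_operator al p (fun z => p (phi z)) (composition_operator phi).
Proof.
move=> regp aphi dphi al1; have [m0 pmM C0 _] := regp.
have aN1 : (al == -1) = false by rewrite gt_eqF.
have pm z : normc z < 1 -> m <= p z by move=> /pmM/andP[].
have cp z : normc z < 1 -> ctsat p z by move=> z1; exact: (exponent_ctsat regp z1).
have pmp z : normc z < 1 -> m <= p (phi z) by move=> /dphi; exact: pm.
have cpp z : normc z < 1 -> ctsat (fun z => p (phi z)) z.
  by move=> z1; exact: (ctsat_circ (derivable_continuous_at (aphi z z1)) (cp _ (dphi z z1))).
split.
  move=> f; rewrite /A_space /= aN1 => -[af If]; split; first exact: analytic_comp.
  have I0 : (0 <= integral_dA al (fun z => normc (f z) `^ p z)%R)%E.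
    apply: integral_ge0 => q q1; rewrite lee_fin !mulr_ge0 ?powR_ge0//; lra.
  have IE : integral_dA al (fun z => normc (f z) `^ p z) =
      (fine (integral_dA al (fun z => normc (f z) `^ p z)))%:E by rewrite fineK// ge0_fin_numE.
  have B0 := fine_ge0 I0.
  have [A _ HA] := bergman_modular regp aphi dphi al1 B0.
  by apply: le_lt_trans (HA f af _) (ltry A); rewrite -IE.
have [A A1 HA] := bergman_modular regp aphi dphi al1 (@ler01 R).
exists (dilation A m) => f; rewrite /A_space /A_norm /= !aN1 => -[af _].
have afp := analytic_comp af aphi dphi.
apply: luxemburg_transfer => //.
- by move=> l k _ k1; exact: (bergman_modular_dilate al1 pm cp af).
- move=> l k _ k1.
  exact: (@bergman_modular_dilate (fun z => p (phi z)) m al (fun z => f (phi z)) al1 pmp cpp afp k l k1).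
- move=> l; apply: integral_ge0 => q q1; rewrite lee_fin !mulr_ge0 ?powR_ge0//; lra.
- move=> l l0 /ltW HP.
  exact: (HA (fun z => f z / l%:C) (@analytic_div R f l af) HP).
Qed.

End BergmanOperator.

(** * Bounds of the exponent *)

Section ExponentBounds.
Variable R : realType.
Implicit Types (p : R[i] -> R) (z w : R[i]).
Notation plane := (measurableTypeR R * measurableTypeR R)%type.
Notation area := (@lebesgue_measure R \x @lebesgue_measure R)%E.
Notation D := (@toC R @^-1` @disc R).

(** As 1 / ln (1/x) increases with x on ]0, 1[, the distance may be replaced by
any upper bound less than 1. *)
Lemma log_holder_modulus p : log_holder p -> exists2 C : R, 0 <= C & log_modulus p C.
Proof.
move=> [C0 H]; exists (Num.max 0 C0); first by rewrite le_max lexx.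
move=> z w eta z1 w1 e0 e1 zw.
have l0 := lnV_gt0 e0 e1.
have M0 : 0 <= Num.max 0 C0 by rewrite le_max lexx.
have [->|zw0] := eqVneq z w.
  by rewrite subrr normr0 divr_ge0// ltW.
have n0 : 0 < normc (z - w) by rewrite normc_gt0 subr_eq0.
have n1 : normc (z - w) < 1 by exact: le_lt_trans e1.
apply: le_trans (H z w (ltW z1) (ltW w1) n1) _; rewrite div1r.
have l1 := lnV_gt0 n0 n1.
apply: (@le_trans _ _ (Num.max 0 C0 / ln ((normc (z - w))^-1))).
  by rewrite ler_pM2r ?invr_gt0// le_max lexx orbT.
apply: ler_wpM2l => //; rewrite lef_pV2 ?posrE// ler_ln ?posrE ?invr_gt0//.
by rewrite lef_pV2 ?posrE.
Qed.

(** Balls have positive measure, so for a continuous function on the disc a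
property that is open and fails almost nowhere never fails. *)
Lemma ae_disc_ball (P : set R[i]) w (r : R) : (\forall q \ae (@dA R), ~ P (toC q)) ->
  normc w < 1 -> 0 < r -> (forall z, normc (z - w) < r -> P z) -> False.
Proof.
move=> [N [mN N0 sub]] w1 r0 HP.
pose e := Num.min r (1 - normc w).
have e0 : 0 < e by rewrite lt_min r0 subr_gt0.
have BN : dball w e `<=` N.
  move=> q; rewrite /dball /preimage /mkset lt_min => /andP[qr _].
  by apply: sub => /= H; apply: H; exact: HP.
have BD : dball w e `<=` D.
  move=> q; rewrite /dball /preimage /mkset lt_min => /andP[_ qr].
  rewrite /disc /mkset.
  by rewrite -(subrK w (toC q)) (le_lt_trans (normcD _ _))// -ltrBrDr.
have mB := measurable_dball w e.
have : ((dA R) (dball w e) <= (dA R) N)%E by apply: le_measure => //; rewrite inE.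
rewrite N0.
have -> : dA R (dball w e) = ((pi : R)^-1%:E * area (dball w e `&` D))%E by [].
rewrite (setIidl BD) area_dball// -EFinM lee_fin leNgt.
by rewrite !mulr_gt0 ?invr_gt0 ?pi_gt0 ?exprn_gt0 ?disc_area_gt0.
Qed.

(** The exponent is continuous on the disc, so the bounds that hold almost
everywhere hold everywhere. *)
Lemma regular_exponent_exists p : log_holder p -> (0 < exponent_inf p)%E ->
  (exponent_inf p <= exponent_sup p)%E -> (exponent_sup p < +oo)%E ->
  exists m M C, regular_exponent p m M C.
Proof.
move=> lh i0 ile sy; have [C C0 pC] := log_holder_modulus lh.
have cp z : normc z < 1 -> ctsat p z by exact: log_modulus_ctsat C0 pC.
have [m iE] : exists m : R, exponent_inf p = m%:E.
  by move: i0 (le_lt_trans ile sy); case: exponent_inf => // r _ _; exists r.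
have [M sE] : exists M : R, exponent_sup p = M%:E.
  by move: (lt_le_trans i0 ile) sy; case: exponent_sup => // r _ _; exists r.
have m0 : 0 < m by rewrite -lte_fin -iE.
exists m, M, C; split=> // z z1; apply/andP; split; rewrite leNgt; apply/negP => bad.
- have [d d0 Hd] := (ctsatP p z).1 (cp z z1) (m - p z) (ltac:(by rewrite subr_gt0)).
  apply: (@ae_disc_ball [set v | p v < m] z d) => //.
    have := ess_inf_le (dA R) (EFin \o p \o @toC R); rewrite -/(exponent_inf p) iE.
    by apply: filterS => q /=; rewrite lee_fin leNgt => /negP.
  by move=> v /Hd; rewrite /= ltr_norml => /andP[_]; lra.
- have [d d0 Hd] := (ctsatP p z).1 (cp z z1) (p z - M) (ltac:(by rewrite subr_gt0)).
  apply: (@ae_disc_ball [set v | M < p v] z d) => //.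
    have := ess_sup_ge (dA R) (EFin \o p \o @toC R); rewrite -/(exponent_sup p) sE.
    by apply: filterS => q /=; rewrite lee_fin leNgt => /negP.
  by move=> v /Hd; rewrite /= ltr_norml => /andP[+ _]; lra.
Qed.

End ExponentBounds.

Theorem corollary3p9 (R : realType) (phi : R[i] -> R[i]) (p : R[i] -> R)
    (alpha : R)
    (phi_analytic : analytic_on_disc phi)
    (phi_disc : forall z : R[i], disc z -> disc (phi z))
    (p_harmonic : harmonic_on_disc p)
    (p_log_holder : log_holder_bounded_conjugate p)
    (p_inf_gt0 : (0 < exponent_inf p)%E)
    (p_inf_le_sup : (exponent_inf p <= exponent_sup p)%E)
    (p_sup_fin : (exponent_sup p < +oo)%E)
    (alpha_ge : -1 <= alpha) :
  bounded_operator alpha p (fun z => p (phi z)) (composition_operator phi).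
Proof.
have [m [M [C regp]]] :=
  regular_exponent_exists p_log_holder.1 p_inf_gt0 p_inf_le_sup p_sup_fin.
move: alpha_ge; rewrite le_eqVlt => /orP[/eqP <-|alpha_gt].
  exact: hardy_composition_bounded regp phi_analytic phi_disc.
exact: bergman_composition_bounded regp phi_analytic phi_disc alpha_gt.
Qed.
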